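(* Let $(\lambda_n)_{n\ge1}$ be a sequence in $\mathbb C\setminus\{0\}$ with $\sup_{n\in\mathbb N}|\lambda_n|<\infty$, let $\underline a=(a_n)$, $\underline b=(b_n)$ be sequences with $0<a_n<b_n$, and $\Delta_n=\log(b_n/a_n)$. Let $q\in(0,1)$, $\Delta>0$. There is a constant $a_0>0$ depending only on $\Delta,q$ such that, assuming: (a) for all sufficiently large $n$, $a_{n+1}\le|\lambda_{n+1}|e^{qa_n}$ and $b_{n+1}\ge|\lambda_{n+1}|e^{-qa_n}$; (b) $(a_1\cdots a_n)^{1/n}\to\infty$; (c) $\Delta_n>\Delta$ for all $n$; (d) $\liminf_{n\to\infty}a_n>a_0$; and $\lim_{n\to\infty}\frac{\log b_n}{\log a_n}=1$, we have \[ \dim_H I_{\underline a}^{\underline b}(E_{\underline\lambda})=1,\qquad \dim_P I_{\underline a}^{\underline b}(E_{\underline\lambda})=1+\limsup_{n\to\infty}\frac{\log(\Delta_1\cdots\Delta_{n+1})}{\log(a_1\cdots a_n)}. \]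
   Context: For $\lambda\in\mathbb C\setminus\{0\}$ let $E_\lambda(z)=\lambda e^z$. For $\underline\lambda=(\lambda_n)_{n\ge1}$ and sequences $\underline a,\underline b$ with $0<a_n<b_n$, \[ I_{\underline a}^{\underline b}(E_{\underline\lambda})=\{z\in\mathbb C:\ a_n\le |E_{\lambda_n}\circ\cdots\circ E_{\lambda_1}(z)|\le b_n \text{ for every sufficiently large } n\in\mathbb N\}. \] $\dim_H$, $\dim_P$ denote Hausdorff and packing dimension. *)

(* Defs.v *)
From Stdlib Require Import Reals Lra.
From Coquelicot Require Import Coquelicot.
Open Scope R_scope.

Definition cexp (z : C) : C :=
  (exp (Re z) * cos (Im z), exp (Re z) * sin (Im z)).

Definition E (lam z : C) : C := Cmult lam (cexp z).

(** Eiter lam n z = E_{lam n} o ... o E_{lam 1} (z); sequences are indexed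
    from 1, the value at index 0 is ignored. *)
Fixpoint Eiter (lam : nat -> C) (n : nat) (z : C) : C :=
  match n with
  | O => z
  | S m => E (lam (S m)) (Eiter lam m z)
  end.

Definition Iab (lam : nat -> C) (a b : nat -> R) : C -> Prop :=
  fun z => exists N : nat, forall n : nat, (N <= n)%nat ->
    a n <= Cmod (Eiter lam n z) <= b n.

Fixpoint prod1 (a : nat -> R) (n : nat) : R :=
  match n with
  | O => 1
  | S m => prod1 a m * a (S m)
  end.

Definition rpow (r s : R) : R :=
  if Req_EM_T r 0 then 0 else Rpower r s.

Definition diam_le (U : C -> Prop) (d : R) : Prop :=
  forall x y, U x -> U y -> Cmod (Cminus x y) <= d.

(** diameter of a set (as a real: meaningful for bounded sets; 0 for the
    empty set, for which [Lub_Rbar] is [m_infty]) *)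
Definition diam (U : C -> Prop) : R :=
  real (Lub_Rbar (fun r => exists x y, U x /\ U y /\ r = Cmod (Cminus x y))).

Definition hausdorff_delta (s delta : R) (A : C -> Prop) : Rbar :=
  Rbar_glb (fun v : Rbar => exists U : nat -> (C -> Prop),
     (forall i, diam_le (U i) delta) /\
     (forall z, A z -> exists i, U i z) /\
     v = Lim_seq (fun n => sum_f_R0 (fun i => rpow (diam (U i)) s) n)).

(** H^s(E) = lim_{delta -> 0} H^s_delta(E) = sup_delta H^s_delta(E) *)
Definition hausdorff_measure (s : R) (A : C -> Prop) : Rbar :=
  Sup_seq (fun n => hausdorff_delta s (/ INR (S n)) A).

Definition dimH (A : C -> Prop) : Rbar :=
  Rbar_glb (fun t : Rbar => exists s : R, t = Finite s /\ 0 < s /\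
                             hausdorff_measure s A = Finite 0).

(** P^s_delta(E) = sup { sum_i |B_i|^s : (B_i) disjoint closed balls
    centred in E, |B_i| <= delta }  (degenerate balls of radius 0 are
    allowed and contribute 0; this encodes finite families). *)
Definition packing_delta (s delta : R) (A : C -> Prop) : Rbar :=
  Rbar_lub (fun v : Rbar => v = Finite 0 \/
    exists (x : nat -> C) (r : nat -> R),
      (forall i, A (x i)) /\
      (forall i, 0 <= r i /\ 2 * r i <= delta) /\
      (forall i j, i <> j -> 0 < r i -> 0 < r j ->
         forall y, ~ (Cmod (Cminus y (x i)) <= r i /\
                      Cmod (Cminus y (x j)) <= r j)) /\
      v = Lim_seq (fun n => sum_f_R0 (fun i => rpow (2 * r i) s) n)).

(** packing premeasure P^s_0(E) = lim_{delta -> 0} P^s_delta(E) *)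
Definition packing_pre (s : R) (A : C -> Prop) : Rbar :=
  Inf_seq (fun n => packing_delta s (/ INR (S n)) A).

(** sum of a sequence of extended reals (used for nonnegative terms) *)
Fixpoint Rbar_psum (u : nat -> Rbar) (n : nat) : Rbar :=
  match n with
  | O => u O
  | S m => Rbar_plus (Rbar_psum u m) (u (S m))
  end.

Definition Rbar_series (u : nat -> Rbar) : Rbar := Sup_seq (Rbar_psum u).

Definition packing_measure (s : R) (A : C -> Prop) : Rbar :=
  Rbar_glb (fun v : Rbar => exists Ai : nat -> (C -> Prop),
     (forall z, A z -> exists i, Ai i z) /\
     v = Rbar_series (fun i => packing_pre s (Ai i))).

Definition dimP (A : C -> Prop) : Rbar :=
  Rbar_glb (fun t : Rbar => exists s : R, t = Finite s /\ 0 < s /\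
                             packing_measure s A = Finite 0).

(* Main.v *)
(** Since [Delta < Delta_n] while [Delta_n = o (log a_n)], the radii [a_n] tend to infinity, so
    any [a0 >= 1] works.  An orbit stays in the annuli iff [Re z_n] stays in the strip of width
    [Delta_{n+1}] that starts at [l_n = log (a_{n+1} / |lambda_{n+1}|)]; eventually [0 <= l_n <=
        a_n]
    and [Delta_{n+1} = o (a_n)], so the strip crosses the annulus transversally.

    Upper bounds.  If [|Im z - Im z'| <= 2] then
    [|z - z'| <= 2 |E z - E z'| / min (|E z|, |E z'|)], so covers pull back along inverse branches
    with ratio [2 / a_n], at the price of [3 b_n] branches.  For [s > 1] the factor
    [3 b_n (2 / a_n)^s] tends to [0], which kills the Hausdorff measure.  For box counting, the
    bound [r^-sigma] is propagated through the levels as soon as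
    [Delta_{n+1} <= (a_1 ... a_n)^d] with [d < sigma - 1].

    Lower bounds.  The boxes of width [Delta] and height about [2 pi] that the annuli contain form
    a tree, whose ends are parametrised by [[0, 1/2]] through mixed radix digits.  Since
    [|E z - E z'| <= max (|E z|, |E z'|) |z - z'|], points whose codes first differ at level [n]
    are at least [c / (b_1 ... b_n)] apart, so closeness in the plane controls closeness of the
    parameters, and the covers and packings of the set are compared with covers of an interval. *)
Require Import Defs.
From Stdlib Require Import Reals Lra Lia List Arith ClassicalEpsilon Classical Cantor FinFun.
From Coquelicot Require Import Coquelicot.
Open Scope R_scope.

(** * The exponential map *)

(** Two estimates produce the formula. First, [Delta_1 ... Delta_n] is [(a_1 ... a_n)^o(1)]: from
    above because [Delta_k = o(log a_k)], from below because it is at least [Delta^n] and (b) makes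
    that negligible. So only [Delta_{n+1}] survives in the limsup, and
    [b_1 ... b_n = (a_1 ... a_n)^(1+o(1))], so that contraction and expansion rates agree to leading
    order. Second, at scale about [1 / (a_1 ... a_n)] there are about [a_1 ... a_n Delta_{n+1}]
    separated pieces, since each strip is then resolved into its columns.

    The packing bound needs a good estimate only along a sequence of scales, so it uses all columns
    at the levels where [Delta_{n+1}] is large. The Hausdorff bound needs every scale: its tree
    keeps one column per level, so that codes differing by many digits lie far apart vertically, and
    the scales between two levels follow by interpolation.

    No measure is put on the plane. The length of the parameter interval plays the part of mass,
    through an elementary inequality for interval covers, and only lower bounds on distances between
    points of the set are needed. *)

Lemma Cmod_sq (z : C) : Cmod z * Cmod z = Re z * Re z + Im z * Im z.
Proof.
  unfold Cmod. rewrite sqrt_sqrt.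
  - unfold Re, Im. ring.
  - nra.
Qed.

Lemma Cmod_le_of_sq (z : C) (r : R) :
  0 <= r -> Re z * Re z + Im z * Im z <= r * r -> Cmod z <= r.
Proof.
  intros Hr H. pose proof (Cmod_sq z). pose proof (Cmod_ge_0 z). nra.
Qed.

Lemma Cmod_ge_of_sq (z : C) (r : R) :
  r * r <= Re z * Re z + Im z * Im z -> r <= Cmod z.
Proof.
  intros H. pose proof (Cmod_sq z). pose proof (Cmod_ge_0 z). nra.
Qed.

Lemma abs_Im_le_Cmod (z : C) : Rabs (Im z) <= Cmod z.
Proof.
  pose proof (Cmod_sq z). pose proof (Cmod_ge_0 z).
  apply Rabs_le; nra.
Qed.

Lemma Cmod_le_abs (z : C) : Cmod z <= Rabs (Re z) + Rabs (Im z).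
Proof.
  pose proof (Rabs_pos (Re z)). pose proof (Rabs_pos (Im z)).
  apply Cmod_le_of_sq; [lra|].
  rewrite <- (Rabs_pos_eq (Re z * Re z)) by nra.
  rewrite <- (Rabs_pos_eq (Im z * Im z)) by nra.
  rewrite !Rabs_mult. nra.
Qed.

Lemma Cmod_minus_sym (z w : C) : Cmod (Cminus z w) = Cmod (Cminus w z).
Proof.
  replace (Cminus z w) with (Copp (Cminus w z)) by ring. apply Cmod_opp.
Qed.

Lemma Cmod_minus_triangle (x y z : C) :
  Cmod (Cminus x z) <= Cmod (Cminus x y) + Cmod (Cminus y z).
Proof.
  replace (Cminus x z) with (Cplus (Cminus x y) (Cminus y z)) by ring.
  apply Cmod_triangle.
Qed.

Lemma Re_minus (z w : C) : Re (Cminus z w) = Re z - Re w.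
Proof. destruct z, w; simpl; ring. Qed.

Lemma Im_minus (z w : C) : Im (Cminus z w) = Im z - Im w.
Proof. destruct z, w; simpl; ring. Qed.

Lemma Cmod_cexp (z : C) : Cmod (cexp z) = exp (Re z).
Proof.
  unfold cexp, Cmod; simpl fst; simpl snd.
  pose proof (sin2_cos2 (Im z)) as H. unfold Rsqr in H.
  replace ((exp (Re z) * cos (Im z)) ^ 2 + (exp (Re z) * sin (Im z)) ^ 2)
    with (exp (Re z) * exp (Re z)) by nra.
  apply sqrt_square. left. apply exp_pos.
Qed.

Lemma Cmod_E (lam z : C) : Cmod (E lam z) = Cmod lam * exp (Re z).
Proof. unfold E. rewrite Cmod_mult, Cmod_cexp. reflexivity. Qed.

Lemma cexp_plus (z w : C) : cexp (Cplus z w) = Cmult (cexp z) (cexp w).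
Proof.
  destruct z as [x y], w as [u v]. unfold cexp, Cmult; simpl.
  rewrite exp_plus, cos_plus, sin_plus. f_equal; ring.
Qed.

Lemma E_shift (lam z w : C) : E lam w = Cmult (E lam z) (cexp (Cminus w z)).
Proof.
  unfold E. rewrite <- Cmult_assoc, <- cexp_plus.
  replace (Cplus z (Cminus w z)) with w by ring. reflexivity.
Qed.

Lemma sin_ge_lin (y : R) : 0 <= y <= 1 -> y * (5 / 6) <= sin y.
Proof.
  intros H. pose proof PI2_1.
  pose proof (sin_bound y 0 ltac:(lra) ltac:(lra)) as [H1 _].
  unfold sin_approx, sin_term in H1. simpl in H1.
  assert (y * (y * (y * 1)) <= y) by nra. lra.
Qed.

Lemma one_minus_cos (y : R) : 1 - cos y = 2 * (sin (y / 2) * sin (y / 2)).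
Proof.
  replace (cos y) with (cos (2 * (y / 2))) by (f_equal; field). rewrite cos_2a_sin. ring.
Qed.

Lemma sin_sq_ge (y : R) : Rabs y <= 1 -> y * y * (25 / 36) <= sin y * sin y.
Proof.
  intros H. destruct (Rle_dec 0 y) as [Hy | Hy].
  - rewrite Rabs_pos_eq in H by lra. pose proof (sin_ge_lin y). nra.
  - rewrite Rabs_left in H by lra. pose proof (sin_ge_lin (- y)) as H1.
    rewrite sin_neg in H1. nra.
Qed.

Lemma sin_sq_le (y : R) : sin y * sin y <= y * y.
Proof.
  destruct (Rle_dec 0 y) as [Hy | Hy].
  - pose proof (SIN_bound y). destruct (Rle_dec y 1) as [H1 | H1]; [idtac | nra].
    destruct (Req_dec y 0) as [-> | H0]; [rewrite sin_0; nra |].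
    pose proof (sin_lt_x y). pose proof (sin_ge_lin y). nra.
  - pose proof (SIN_bound y). destruct (Rle_dec (-1) y) as [H1 | H1]; [| nra].
    pose proof (sin_lt_x (- y)). pose proof (sin_ge_lin (- y)) as H2.
    rewrite sin_neg in *. nra.
Qed.

(** Separates radial from angular displacement. With [one_minus_cos] the angular term becomes the
    square of a half-angle sine, so the next two estimates reduce to one-variable bounds on [exp]
    and [sin]. *)
Lemma Cmod_cexp_minus_1_sq (d : C) :
  Cmod (Cminus (cexp d) 1) * Cmod (Cminus (cexp d) 1) =
  (exp (Re d) - 1) * (exp (Re d) - 1) + 2 * exp (Re d) * (1 - cos (Im d)).
Proof.
  rewrite Cmod_sq, Re_minus, Im_minus.
  change (Re (cexp d)) with (exp (Re d) * cos (Im d)).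
  change (Im (cexp d)) with (exp (Re d) * sin (Im d)).
  change (Re 1) with 1. change (Im 1) with 0.
  pose proof (sin2_cos2 (Im d)) as H. unfold Rsqr in H.
  generalize dependent (exp (Re d)). intros r.
  transitivity (r * r * (sin (Im d) * sin (Im d) + cos (Im d) * cos (Im d)) - 2 * r * cos (Im d) +
      1);
    [ring |].
  rewrite H. ring.
Qed.

(** For [Re d >= 0] the factor [exp (Re d)] only helps: the radial term is at least the square of
    [Re d], the angular one at least 25/36 of the square of [Im d]. The bound 2 puts the half angle
    in the range of [sin_sq_ge]. *)
Lemma cexp_minus_1_ge (d : C) :
  0 <= Re d -> Rabs (Im d) <= 2 -> Cmod d <= 2 * Cmod (Cminus (cexp d) 1).
Proof.
  intros H0 H2. pose proof (Cmod_cexp_minus_1_sq d) as H.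
  pose proof (Cmod_ge_0 (Cminus (cexp d) 1)).
  rewrite one_minus_cos in H.
  assert (H3 : Rabs (Im d / 2) <= 1).
  { unfold Rdiv. rewrite Rabs_mult, (Rabs_pos_eq (/ 2)) by lra. lra. }
  pose proof (sin_sq_ge _ H3). pose proof (exp_ineq1_le (Re d)).
  apply Cmod_le_of_sq; [lra |].
  assert (1 * (sin (Im d / 2) * sin (Im d / 2)) <= exp (Re d) * (sin (Im d / 2) * sin (Im d / 2))).
  { apply Rmult_le_compat_r; nra. }
  nra.
Qed.

Lemma cexp_minus_1_le (d : C) :
  Re d <= 0 -> Cmod (Cminus (cexp d) 1) <= Cmod d.
Proof.
  intros H0. pose proof (Cmod_cexp_minus_1_sq d) as H.
  pose proof (Cmod_ge_0 (Cminus (cexp d) 1)).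
  rewrite one_minus_cos in H.
  pose proof (sin_sq_le (Im d / 2)). pose proof (exp_ineq1_le (Re d)).
  assert (exp (Re d) <= 1).
  { rewrite <- exp_0. destruct H0 as [H0 | ->]; [left; apply exp_increasing; lra | lra]. }
  pose proof (exp_pos (Re d)).
  apply Cmod_ge_of_sq. rewrite H.
  assert (exp (Re d) * (sin (Im d / 2) * sin (Im d / 2)) <= 1 * (sin (Im d / 2) * sin (Im d / 2))).
  { apply Rmult_le_compat_r; nra. }
  nra.
Qed.

(** [E z - E w = E w (exp (z - w) - 1)], factored at whichever point has the smaller real part, so
    that the exponent has nonnegative real part as [cexp_minus_1_ge] requires. *)
Lemma E_contract (lam z w : C) (u : R) :
  0 < u -> Rabs (Im z - Im w) <= 2 -> u <= Cmod (E lam z) -> u <= Cmod (E lam w) ->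
  Cmod (Cminus z w) <= 2 / u * Cmod (Cminus (E lam z) (E lam w)).
Proof.
  assert (main : forall z w, 0 < u -> Rabs (Im z - Im w) <= 2 -> u <= Cmod (E lam w) ->
     Re w <= Re z -> Cmod (Cminus z w) <= 2 / u * Cmod (Cminus (E lam z) (E lam w))).
  { clear z w. intros z w Hu HI Hw HR.
    rewrite (E_shift lam w z).
    replace (Cminus (Cmult (E lam w) (cexp (Cminus z w))) (E lam w))
      with (Cmult (E lam w) (Cminus (cexp (Cminus z w)) 1)) by ring.
    rewrite Cmod_mult.
    pose proof (cexp_minus_1_ge (Cminus z w)) as H.
    rewrite Re_minus, Im_minus in H.
    specialize (H ltac:(lra) HI).
    pose proof (Cmod_ge_0 (Cminus (cexp (Cminus z w)) 1)).
    apply Rle_trans with (1 := H).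
    replace (2 / u * (Cmod (E lam w) * Cmod (Cminus (cexp (Cminus z w)) 1)))
      with (2 * (Cmod (E lam w) / u) * Cmod (Cminus (cexp (Cminus z w)) 1)) by (field; lra).
    apply Rmult_le_compat_r; [lra |].
    assert (1 <= Cmod (E lam w) / u).
    { apply Rmult_le_reg_r with u; [lra |]. unfold Rdiv. rewrite Rmult_assoc, Rinv_l by lra. lra. }
    lra. }
  intros Hu HI Hz Hw.
  destruct (Rle_dec (Re w) (Re z)) as [H | H].
  - auto.
  - rewrite (Cmod_minus_sym z w), (Cmod_minus_sym (E lam z)).
    apply main; auto; [| lra]. rewrite Rabs_minus_sym. auto.
Qed.

(** The same factorisation, now at the point with the larger real part, where [exp (z - w) - 1] is
    at most [z - w] in modulus. *)
Lemma E_expand (lam z w : C) (B : R) :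
  Cmod (E lam z) <= B -> Cmod (E lam w) <= B ->
  Cmod (Cminus (E lam z) (E lam w)) <= B * Cmod (Cminus z w).
Proof.
  assert (main : forall z w, Cmod (E lam z) <= B -> Cmod (E lam w) <= B ->
     Re z <= Re w -> Cmod (Cminus (E lam z) (E lam w)) <= B * Cmod (Cminus z w)).
  { clear z w. intros z w Hz Hw HR.
    rewrite (E_shift lam w z).
    replace (Cminus (Cmult (E lam w) (cexp (Cminus z w))) (E lam w))
      with (Cmult (E lam w) (Cminus (cexp (Cminus z w)) 1)) by ring.
    rewrite Cmod_mult.
    pose proof (cexp_minus_1_le (Cminus z w)) as H.
    rewrite Re_minus in H. specialize (H ltac:(lra)).
    apply Rmult_le_compat; auto; apply Cmod_ge_0. }
  intros Hz Hw. destruct (Rle_dec (Re z) (Re w)) as [H | H].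
  - auto.
  - rewrite (Cmod_minus_sym z w), (Cmod_minus_sym (E lam z)).
    apply main; auto. lra.
Qed.

(** * Finite covers *)

Definition lsum {T : Type} (f : T -> R) (l : list T) : R :=
  fold_right (fun x s => f x + s) 0 l.

Lemma lsum_cons {T} (f : T -> R) x l : lsum f (x :: l) = f x + lsum f l.
Proof. reflexivity. Qed.

Lemma lsum_app {T} (f : T -> R) l1 l2 : lsum f (l1 ++ l2) = lsum f l1 + lsum f l2.
Proof. induction l1 as [| x l IH]; simpl; [ring | rewrite IH; ring]. Qed.

Lemma lsum_le {T} (f g : T -> R) l :
  (forall x, In x l -> f x <= g x) -> lsum f l <= lsum g l.
Proof.
  induction l as [| x l IH]; simpl; intros H; [lra |].
  apply Rplus_le_compat; [apply H; auto | apply IH; intros; apply H; auto].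
Qed.

Lemma lsum_ext {T} (f g : T -> R) l :
  (forall x, In x l -> f x = g x) -> lsum f l = lsum g l.
Proof.
  intros H. apply Rle_antisym; apply lsum_le; intros x Hx; rewrite (H x Hx); lra.
Qed.

Lemma lsum_nonneg {T} (f : T -> R) l : (forall x, In x l -> 0 <= f x) -> 0 <= lsum f l.
Proof.
  induction l as [| x l IH]; simpl; intros H; [lra |].
  pose proof (H x (or_introl eq_refl)). assert (0 <= lsum f l) by (apply IH; auto). lra.
Qed.

Lemma lsum_const {T} (c : R) (l : list T) : lsum (fun _ => c) l = INR (length l) * c.
Proof.
  induction l as [| x l IH]; [simpl; ring |].
  cbn [length]. rewrite S_INR. simpl. rewrite IH. ring.
Qed.

Lemma lsum_scal {T} (c : R) (f : T -> R) l : lsum (fun x => c * f x) l = c * lsum f l.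
Proof. induction l as [| x l IH]; simpl; [ring | rewrite IH; ring]. Qed.

Lemma lsum_plus {T} (f g : T -> R) l : lsum (fun x => f x + g x) l = lsum f l + lsum g l.
Proof. induction l as [| x l IH]; simpl; [ring | rewrite IH; ring]. Qed.

Lemma lsum_map {T U} (h : T -> U) (f : U -> R) l : lsum f (map h l) = lsum (fun x => f (h x)) l.
Proof. induction l as [| x l IH]; simpl; [ring | rewrite IH; ring]. Qed.

Lemma lsum_flat_map {T U} (h : T -> list U) (f : U -> R) l :
  lsum f (flat_map h l) = lsum (fun x => lsum f (h x)) l.
Proof. induction l as [| x l IH]; simpl; [ring | rewrite lsum_app, IH; ring]. Qed.

Lemma lsum_incl {T} (f : T -> R) (l m : list T) :
  (forall x, 0 <= f x) -> NoDup l -> incl l m -> lsum f l <= lsum f m.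
Proof.
  intros Hf Hl. revert m. induction Hl as [| x l Hx Hl IH]; intros m Hm.
  - apply lsum_nonneg. auto.
  - destruct (in_split x m) as [m1 [m2 ->]]; [apply Hm; left; auto |].
    assert (H : lsum f l <= lsum f (m1 ++ m2)).
    { apply IH. intros y Hy. assert (H := Hm y (or_intror Hy)).
      apply in_app_iff. apply in_app_iff in H. destruct H as [H | [H | H]]; auto.
      subst. contradiction. }
    rewrite lsum_app in *. simpl. lra.
Qed.

Lemma sum_f_R0_lsum (f : nat -> R) n : sum_f_R0 f n = lsum f (seq 0 (S n)).
Proof.
  induction n as [| n IH]; [simpl; ring |].
  rewrite seq_S, lsum_app, <- IH. simpl. ring.
Qed.

(* For [s = 0] the weight [w] bounds the number of pieces, since [Rpower d 0 = 1]. *)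
Definition finite_cover (s del w : R) (A : C -> Prop) : Prop :=
  exists L : list ((C -> Prop) * R),
    (forall z, A z -> exists p, In p L /\ fst p z) /\
    (forall p, In p L -> diam_le (fst p) (snd p) /\ 0 < snd p <= del) /\
    lsum (fun p => Rpower (snd p) s) L <= w.

Lemma Rpower_pos x y : 0 < Rpower x y.
Proof. apply exp_pos. Qed.

Lemma finite_cover_mono s del w del' w' (A A' : C -> Prop) :
  finite_cover s del w A -> del <= del' -> w <= w' -> (forall z, A' z -> A z) -> finite_cover s
      del' w' A'.
Proof.
  intros [L [H1 [H2 H3]]] Hd Hw HA. exists L. repeat split; auto.
  - apply H2; auto.
  - apply H2; auto.
  - destruct (H2 p H); lra.
  - lra.
Qed.

Lemma finite_cover_union {I : Type} (s del : R) (l : list I) (w : I -> R) (A : I -> C -> Prop) B :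
  (forall i, In i l -> finite_cover s del (w i) (A i)) ->
  (forall z, B z -> exists i, In i l /\ A i z) ->
  finite_cover s del (lsum w l) B.
Proof.
  intros H HB.
  assert (G : finite_cover s del (lsum w l) (fun z => exists i, In i l /\ A i z)).
  { clear HB B. induction l as [| i l IH].
    - exists nil. simpl. split; [| split].
      + intros z [i [[] _]].
      + intros p [].
      + lra.
    - destruct IH as [L [H1 [H2 H3]]]; [intros; apply H; right; auto |].
      destruct (H i (or_introl eq_refl)) as [L' [H1' [H2' H3']]].
      exists (L' ++ L). split; [| split].
      + intros z [j [[<- | Hj] Hz]].
        * destruct (H1' z Hz) as [p [Hp Hpz]]. exists p. rewrite in_app_iff. auto.
        * destruct (H1 z) as [p [Hp Hpz]]; [exists j; auto |].
          exists p. rewrite in_app_iff. auto.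
      + intros p Hp. apply in_app_iff in Hp. destruct Hp; auto.
      + rewrite lsum_app. simpl. lra. }
  eapply finite_cover_mono; [exact G | lra | lra | exact HB].
Qed.

(** The new pieces are preimages cut with [T], so no inverse of [f] has to be named; the expansion
    of [f] on [T] bounds their diameters. *)
Lemma finite_cover_pull (s del w c : R) (f : C -> C) (X T : C -> Prop) :
  0 < c -> finite_cover s del w X -> (forall z, T z -> X (f z)) ->
  (forall z z', T z -> T z' -> Cmod (Cminus z z') <= c * Cmod (Cminus (f z) (f z'))) ->
  finite_cover s (c * del) (Rpower c s * w) T.
Proof.
  intros Hc [L [H1 [H2 H3]]] HT Hlip.
  exists (map (fun p => ((fun z => T z /\ fst p (f z)), c * snd p)) L).
  split; [| split].
  - intros z Hz. destruct (H1 (f z) (HT z Hz)) as [p [Hp Hpz]].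
    eexists. split; [apply in_map; exact Hp |]. simpl. auto.
  - intros p' Hp'. apply in_map_iff in Hp'. destruct Hp' as [p [<- Hp]].
    destruct (H2 p Hp) as [Hd Hdp]. simpl. split.
    + intros x y [Hx Hx'] [Hy Hy'].
      apply Rle_trans with (1 := Hlip x y Hx Hy).
      apply Rmult_le_compat_l; [lra |]. apply Hd; auto.
    + split; [apply Rmult_lt_0_compat; lra | apply Rmult_le_compat_l; lra].
  - rewrite lsum_map. simpl.
    rewrite (lsum_ext _ (fun p => Rpower c s * Rpower (snd p) s)).
    + rewrite lsum_scal. apply Rmult_le_compat_l; [left; apply Rpower_pos | auto].
    + intros p Hp. destruct (H2 p Hp). rewrite Rpower_mult_distr; lra.
Qed.

Lemma finite_cover_single (s d : R) (A : C -> Prop) :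
  0 < d -> diam_le A d -> finite_cover s d (Rpower d s) A.
Proof.
  intros Hd HA. exists ((A, d) :: nil). split; [| split].
  - intros z Hz. exists (A, d). simpl. auto.
  - intros p [<- | []]. simpl. split; auto; lra.
  - simpl. lra.
Qed.

Lemma ceil_nat (x : R) : 0 <= x -> exists n : nat, x <= INR n <= x + 1.
Proof.
  intros Hx. destruct (nfloor_ex x Hx) as [n Hn].
  exists (S n). rewrite S_INR. lra.
Qed.

Lemma floor_index (x h : R) (n : nat) :
  0 < h -> 0 <= x < INR n * h -> exists i, (i < n)%nat /\ INR i * h <= x <= INR i * h + h.
Proof.
  intros Hh Hx. destruct (nfloor_ex (x / h)) as [i Hi].
  { apply Rmult_le_pos; [lra | left; apply Rinv_0_lt_compat; lra]. }
  assert (Hxh : x = x / h * h) by (field; lra).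
  exists i. split.
  - apply INR_lt. apply Rmult_lt_reg_r with h; [lra |]. nra.
  - nra.
Qed.

Lemma floor_index_le (x h : R) (n : nat) :
  0 < h -> (0 < n)%nat -> 0 <= x <= INR n * h ->
  exists i, (i < n)%nat /\ INR i * h <= x <= INR i * h + h.
Proof.
  intros Hh Hn Hx. destruct (Rlt_dec x (INR n * h)) as [H | H].
  - apply floor_index; auto. lra.
  - exists (n - 1)%nat. split; [lia |].
    rewrite minus_INR by lia. simpl INR. nra.
Qed.

Lemma finite_cover_rectangle (x0 y0 h : R) (cx cy : nat) (A : C -> Prop) :
  0 < h -> (0 < cx)%nat -> (0 < cy)%nat ->
  (forall z, A z -> x0 <= Re z <= x0 + INR cx * h /\ y0 <= Im z <= y0 + INR cy * h) ->
  finite_cover 0 (2 * h) (INR cx * INR cy) A.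
Proof.
  intros Hh Hcx Hcy HA.
  pose (P := fun (p : nat * nat) z =>
    x0 + INR (fst p) * h <= Re z <= x0 + INR (fst p) * h + h /\
    y0 + INR (snd p) * h <= Im z <= y0 + INR (snd p) * h + h).
  replace (INR cx * INR cy) with (lsum (fun _ => 1) (list_prod (seq 0 cx) (seq 0 cy))).
  - apply finite_cover_union with (A := P).
    + intros p _. rewrite <- (Rpower_O (2 * h)) by lra. apply finite_cover_single; [lra |].
      intros z w Hz Hw. unfold P in *.
      apply Rle_trans with (1 := Cmod_le_abs _).
      rewrite Re_minus, Im_minus.
      assert (Rabs (Re z - Re w) <= h) by (apply Rabs_le; lra).
      assert (Rabs (Im z - Im w) <= h) by (apply Rabs_le; lra).
      lra.
    + intros z Hz. specialize (HA z Hz).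
      destruct (floor_index_le (Re z - x0) h cx) as [i [Hi Hi']]; auto; [lra |].
      destruct (floor_index_le (Im z - y0) h cy) as [j [Hj Hj']]; auto; [lra |].
      exists (i, j). split.
      * apply in_prod; apply in_seq; lia.
      * unfold P; simpl. lra.
  - rewrite lsum_const, length_prod, !length_seq, mult_INR. ring.
Qed.

(** * Orbits through annuli *)

Fixpoint orbit_from (lam : nat -> C) (n m : nat) (z : C) : C :=
  match m with
  | O => z
  | S k => E (lam (n + S k)%nat) (orbit_from lam n k z)
  end.

(** The modulus of the starting point itself is left free: the condition at [m = 1] confines its
    real part to a strip and says nothing about its imaginary part. *)
Definition in_annuli_from (lam : nat -> C) (a b : nat -> R) (n : nat) (z : C) : Prop :=
  forall m, (1 <= m)%nat -> a (n + m)%nat <= Cmod (orbit_from lam n m z) <= b (n + m)%nat.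

Lemma orbit_from_shift lam n m z : orbit_from lam n (S m) z = orbit_from lam (S n) m (E (lam (S
    n)) z).
Proof.
  induction m as [| m IH].
  - simpl. rewrite Nat.add_1_r. reflexivity.
  - change (orbit_from lam n (S (S m)) z) with (E (lam (n + S (S m))%nat) (orbit_from lam n (S m)
      z)).
    rewrite IH. simpl. rewrite <- !Nat.add_succ_comm. reflexivity.
Qed.

Lemma orbit_from_Eiter lam n m z : orbit_from lam n m (Eiter lam n z) = Eiter lam (n + m) z.
Proof.
  induction m as [| m IH]; simpl.
  - rewrite Nat.add_0_r. reflexivity.
  - rewrite IH, Nat.add_succ_r. reflexivity.
Qed.

Lemma in_annuli_from_bound lam a b n z : in_annuli_from lam a b n z -> a (S n) <= Cmod (E (lam (S
    n)) z) <= b (S n).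
Proof. intros H. specialize (H 1%nat (le_n _)). simpl in H. rewrite Nat.add_1_r in H. exact H. Qed.

Lemma in_annuli_from_next lam a b n z : in_annuli_from lam a b n z -> in_annuli_from lam a b (S n)
    (E (lam (S n)) z).
Proof.
  intros H m Hm. specialize (H (S m) ltac:(lia)). rewrite orbit_from_shift in H.
  rewrite <- Nat.add_succ_comm in H. exact H.
Qed.

Definition logratio (a b : nat -> R) (n : nat) : R := ln (b n / a n).

(** Height 1 keeps imaginary parts within the distance 2 that [E_contract] tolerates, so [E] is
    injective with controlled inverse on such a piece. *)
Definition annuli_strip lam a b n (eta : R) (z : C) : Prop :=
  in_annuli_from lam a b n z /\ eta <= Im z <= eta + 1.

Lemma Re_eq_ln lam z : lam <> (0, 0) -> Re z = ln (Cmod (E lam z)) - ln (Cmod lam).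
Proof.
  intros H. rewrite Cmod_E, ln_mult, ln_exp; [ring | | apply exp_pos].
  apply Cmod_gt_0. exact H.
Qed.

Lemma in_annuli_from_Re lam a b n z :
  lam (S n) <> (0, 0) -> 0 < a (S n) -> in_annuli_from lam a b n z ->
  ln (a (S n)) - ln (Cmod (lam (S n))) <= Re z <=
  ln (a (S n)) - ln (Cmod (lam (S n))) + logratio a b (S n).
Proof.
  intros Hl Ha HY. apply in_annuli_from_bound in HY. rewrite (Re_eq_ln (lam (S n)) z Hl).
  unfold logratio. rewrite ln_div by lra.
  pose proof (ln_le (a (S n)) (Cmod (E (lam (S n)) z)) ltac:(lra) ltac:(lra)).
  pose proof (ln_le (Cmod (E (lam (S n)) z)) (b (S n)) ltac:(lra) ltac:(lra)).
  lra.
Qed.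

Lemma finite_cover_weight_nonneg s del w A : finite_cover s del w A -> 0 <= w.
Proof.
  intros [L [_ [_ H]]]. apply Rle_trans with (2 := H).
  apply lsum_nonneg. intros. left. apply Rpower_pos.
Qed.

(** The image lies in the disc of radius [B = b (S n)], whose heights [[-B, B]] are covered by at
    most [2 B + 1 <= 3 B] unit strips of the next level. *)
Lemma finite_cover_strip_step lam a b n s del w eta :
  1 <= a (S n) -> a (S n) <= b (S n) ->
  (forall eta', finite_cover s del w (annuli_strip lam a b (S n) eta')) ->
  finite_cover s (2 / a (S n) * del) (3 * b (S n) * (Rpower (2 / a (S n)) s * w)) (annuli_strip
      lam a b n eta).
Proof.
  intros Ha Hb H. set (B := b (S n)) in *.
  destruct (ceil_nat (2 * B)) as [c Hc]; [lra |].
  assert (Hw : 0 <= w) by (apply finite_cover_weight_nonneg with (1 := H 0)).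
  apply finite_cover_mono with (del := 2 / a (S n) * del) (w := Rpower (2 / a (S n)) s * (3 * B *
      w))
    (A := annuli_strip lam a b n eta); [| lra | right; ring | auto].
  apply finite_cover_pull with (f := E (lam (S n))) (X := fun w => in_annuli_from lam a b (S n) w
      /\ Cmod w <= B).
  - apply Rdiv_lt_0_compat; lra.
  - apply finite_cover_mono with (del := del) (w := lsum (fun _ => w) (seq 0 c))
      (A := fun w => in_annuli_from lam a b (S n) w /\ Cmod w <= B); [| lra | | auto].
    + apply finite_cover_union with (A := fun i => annuli_strip lam a b (S n) (- B + INR i));
        [auto |].
      intros z [HY Hz]. pose proof (abs_Im_le_Cmod z) as HI.
      apply Rabs_le_between in HI.
      destruct (floor_index_le (Im z + B) 1 c) as [i [Hi Hi']].
      * lra.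
      * apply INR_lt. simpl. lra.
      * lra.
      * exists i. split; [apply in_seq; lia |]. split; [auto | lra].
    + rewrite lsum_const, length_seq. apply Rmult_le_compat_r; lra.
  - intros z [HY _]. split; [apply in_annuli_from_next; auto | apply in_annuli_from_bound in HY;
      unfold B; lra].
  - intros z z' [HY Hz] [HY' Hz']. apply in_annuli_from_bound in HY. apply in_annuli_from_bound in
      HY'.
    apply E_contract; try lra. apply Rabs_le; lra.
Qed.

(** A telescoping form of the integral test: [(s - 1) j^-s <= (j - 1)^-(s-1) - j^-(s-1)], which
    follows from [ln (j - 1) <= ln j - 1 / j]. *)
Lemma zeta_bound (s : R) (P : nat) :
  1 < s -> lsum (fun p => Rpower (INR (S p)) (- s)) (seq 0 P) <= 1 + / (s - 1).
Proof.
  intros Hs.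
  assert (G : forall P, lsum (fun p => Rpower (INR (S p)) (- s)) (seq 0 (S P)) <=
     1 + / (s - 1) - / (s - 1) * Rpower (INR (S P)) (- (s - 1))).
  { clear P. induction P as [| P IH].
    - unfold lsum, seq, fold_right. change (INR 1) with 1.
      unfold Rpower. rewrite ln_1, !Rmult_0_r, exp_0. lra.
    - rewrite seq_S, lsum_app. simpl (lsum _ (0 + S P :: nil)%nat).
      change (0 + S P)%nat with (S P).
      change (match P with 0%nat => 1 | S _ => INR P + 1 end) with (INR (S P)).
      replace (INR (S P) + 1) with (INR (S (S P))) by apply S_INR.
      set (j := INR (S (S P))).
      assert (Hj : INR (S P) = j - 1) by (unfold j; rewrite (S_INR (S P)); ring).
      assert (Hj2 : 2 <= j).
      { unfold j. rewrite !S_INR. pose proof (pos_INR P). lra. }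
      rewrite Hj in IH.
      assert (K : Rpower j (- (s - 1)) * (1 + (s - 1) / j) <= Rpower (j - 1) (- (s - 1))).
      { unfold Rpower.
        assert (ln (j - 1) <= ln j - / j).
        { assert (E : j - 1 = j * (1 - / j)) by (field; lra).
          assert (0 < 1 - / j).
          { assert (/ j < 1) by (rewrite <- Rinv_1; apply Rinv_lt_contravar; lra). lra. }
          rewrite E, ln_mult by lra.
          pose proof (exp_ineq1_le (ln (1 - / j))) as K. rewrite exp_ln in K by lra. lra. }
        apply Rle_trans with (exp (- (s - 1) * ln j) * exp ((s - 1) / j)).
        - apply Rmult_le_compat_l; [left; apply exp_pos | apply exp_ineq1_le].
        - rewrite <- exp_plus.
          assert (- (s - 1) * ln j + (s - 1) / j <= - (s - 1) * ln (j - 1)).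
          { unfold Rdiv. nra. }
          destruct H0 as [H0 | ->]; [left; apply exp_increasing; auto | lra]. }
      assert (K2 : Rpower j (- s) = Rpower j (- (s - 1)) / j).
      { replace (- s) with (- (s - 1) + - (1)) by ring.
        rewrite Rpower_plus, (Rpower_Ropp j 1), Rpower_1 by lra. reflexivity. }
      rewrite K2.
      assert (Hi : 0 < / (s - 1)) by (apply Rinv_0_lt_compat; lra).
      apply (Rmult_le_compat_l (/ (s - 1))) in K; [| lra].
      replace (/ (s - 1) * (Rpower j (- (s - 1)) * (1 + (s - 1) / j))) with
        (/ (s - 1) * Rpower j (- (s - 1)) + Rpower j (- (s - 1)) / j) in K by (field; lra).
      lra. }
  destruct P as [| P].
  - simpl. assert (0 < / (s - 1)) by (apply Rinv_0_lt_compat; lra). lra.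
  - apply Rle_trans with (1 := G P).
    assert (0 < / (s - 1)) by (apply Rinv_0_lt_compat; lra).
    pose proof (Rpower_pos (INR (S P)) (- (s - 1))). nra.
Qed.

Lemma exists_INR_gt (x : R) : exists n : nat, x < INR n /\ (0 < n)%nat.
Proof.
  destruct (INR_archimed 1 (Rmax x 0)) as [n Hn]; [lra |].
  exists (S n). rewrite S_INR. split; [| lia].
  pose proof (Rmax_l x 0). lra.
Qed.

(** The image lies in a strip of width [D], cut by height into squares of side [D]. Points of the
    [p]-th square have modulus at least both [p D] and [a (S n) >= D], hence at least
    [(p + 1) D / 2], and it pulls back to diameter [8 / (p + 1)]. The weights are summable for
    [s > 1], with a bound independent of [n], which makes this the base of an induction; [sg] treats
    the two half planes alike. *)
Lemma finite_cover_strip_weight lam a b n s eta :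
  1 < s -> lam (S (S n)) <> (0, 0) ->
  0 < a (S n) -> 0 < a (S (S n)) -> 0 < logratio a b (S (S n)) <= a (S n) ->
  finite_cover s 8 (2 * (Rpower 8 s * (1 + / (s - 1)))) (annuli_strip lam a b n eta).
Proof.
  intros Hs Hl Ha Ha' HD. set (D := logratio a b (S (S n))) in *.
  destruct (exists_INR_gt (b (S n) / D)) as [P [HP HP0]].
  assert (HPD : b (S n) < INR P * D).
  { apply Rmult_lt_reg_r with (/ D); [apply Rinv_0_lt_compat; lra |].
    rewrite Rmult_assoc, Rinv_r by lra. unfold Rdiv in HP. lra. }
  pose (A := fun (sg : R) (p : nat) z => annuli_strip lam a b n eta z /\
     INR p * D <= sg * Im (E (lam (S n)) z) <= INR p * D + D).
  assert (Hpiece : forall sg p, (sg = 1 \/ sg = -1) ->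
     finite_cover s 8 (Rpower 8 s * Rpower (INR (S p)) (- s)) (A sg p)).
  { intros sg p Hsg.
    assert (Hp : 1 <= INR (S p)) by (rewrite S_INR; pose proof (pos_INR p); lra).
    assert (Hip : 0 < / INR (S p) <= 1).
    { split; [apply Rinv_0_lt_compat; lra |]. rewrite <- Rinv_1. apply Rinv_le_contravar; lra. }
    apply finite_cover_mono with (del := 8 / INR (S p)) (w := Rpower (8 / INR (S p)) s) (A := A sg
        p);
      [| unfold Rdiv; lra | | auto].
    - apply finite_cover_single; [unfold Rdiv; lra |].
      intros z z' [[HY Hz] Hq] [[HY' Hz'] Hq'].
      set (w := E (lam (S n)) z) in *. set (w' := E (lam (S n)) z') in *.
      assert (Hw : forall z, in_annuli_from lam a b n z ->
         INR p * D <= sg * Im (E (lam (S n)) z) -> INR (S p) * D / 2 <= Cmod (E (lam (S n)) z)).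
      { intros x Hx Hi. apply in_annuli_from_bound in Hx.
        pose proof (abs_Im_le_Cmod (E (lam (S n)) x)) as HI. apply Rabs_le_between in HI.
        assert (INR p * D <= Cmod (E (lam (S n)) x)) by (destruct Hsg; subst sg; lra).
        rewrite S_INR. lra. }
      pose proof (Hw z HY (proj1 Hq)) as H1. pose proof (Hw z' HY' (proj1 Hq')) as H2.
      fold w in H1. fold w' in H2.
      assert (H0 : 0 < INR (S p) * D / 2) by nra.
      pose proof (E_contract (lam (S n)) z z' (INR (S p) * D / 2) H0
        ltac:(apply Rabs_le; lra) H1 H2) as HE.
      fold w w' in HE. apply Rle_trans with (1 := HE).
      assert (Hd : Cmod (Cminus w w') <= 2 * D).
      { apply Rle_trans with (1 := Cmod_le_abs _). rewrite Re_minus, Im_minus.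
        pose proof (in_annuli_from_Re _ _ _ _ _ Hl Ha' (in_annuli_from_next _ _ _ _ _ HY)) as R1.
        pose proof (in_annuli_from_Re _ _ _ _ _ Hl Ha' (in_annuli_from_next _ _ _ _ _ HY')) as R2.
        fold w D in R1. fold w' D in R2.
        assert (Rabs (Re w - Re w') <= D) by (apply Rabs_le; lra).
        assert (Rabs (Im w - Im w') <= D) by (apply Rabs_le; destruct Hsg; subst sg; lra).
        lra. }
      apply Rle_trans with (2 / (INR (S p) * D / 2) * (2 * D)).
      + apply Rmult_le_compat_l; [left; apply Rdiv_lt_0_compat; lra | auto].
      + right. field. lra.
    - right. unfold Rdiv. rewrite <- Rpower_mult_distr by lra. f_equal.
      rewrite Rpower_Ropp. unfold Rpower.
      rewrite ln_Rinv by lra. rewrite <- exp_Ropp. f_equal. ring. }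
  assert (Hsign : forall sg, (sg = 1 \/ sg = -1) ->
     finite_cover s 8 (Rpower 8 s * (1 + / (s - 1)))
       (fun z => annuli_strip lam a b n eta z /\ 0 <= sg * Im (E (lam (S n)) z))).
  { intros sg Hsg.
    eapply finite_cover_mono; [apply (finite_cover_union s 8 (seq 0 P) (fun p => Rpower 8 s *
        Rpower (INR (S p)) (- s)) (A sg)) with
      (B := fun z => annuli_strip lam a b n eta z /\ 0 <= sg * Im (E (lam (S n)) z)) | lra | |
          auto].
    - intros i _. apply Hpiece; auto.
    - intros z [Hz H0].
      assert (HB := in_annuli_from_bound _ _ _ _ _ (proj1 Hz)).
      pose proof (abs_Im_le_Cmod (E (lam (S n)) z)) as HI. apply Rabs_le_between in HI.
      destruct (floor_index (sg * Im (E (lam (S n)) z)) D P) as [i [Hi Hi']]; [lra | |].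
      + destruct Hsg; subst sg; lra.
      + exists i. split; [apply in_seq; lia |]. split; auto.
    - rewrite lsum_scal. apply Rmult_le_compat_l; [left; apply Rpower_pos |].
      apply zeta_bound; auto. }
  eapply finite_cover_mono; [apply (finite_cover_union s 8 (1 :: -1 :: nil) (fun _ => Rpower 8 s *
      (1 + / (s - 1)))
     (fun sg z => annuli_strip lam a b n eta z /\ 0 <= sg * Im (E (lam (S n)) z)) (annuli_strip
         lam a b n eta))
     | lra | | auto].
  - intros sg [<- | [<- | []]]; apply Hsign; auto.
  - intros z Hz. destruct (Rle_dec 0 (Im (E (lam (S n)) z))).
    + exists 1. split; [left; reflexivity |]. split; [auto | lra].
    + exists (-1). split; [right; left; reflexivity |]. split; [auto | lra].
  - simpl. lra.
Qed.

(** Direct count at one scale. On the unit column starting at [l + i] the image has modulus between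
    [u = a e^i] and [3 u], because [e <= 3]. It thus lies in a rectangle of width [D'] and height
    [6 u], and there are at most [D + 1] such columns. *)
Lemma finite_cover_strip_count lam a b n eta r :
  lam (S n) <> (0, 0) -> lam (S (S n)) <> (0, 0) ->
  0 < a (S n) -> 0 < a (S (S n)) -> 0 < logratio a b (S n) -> 0 < logratio a b (S (S n)) -> 0 < r
      <= 1 ->
  finite_cover 0 r ((logratio a b (S n) + 1) * ((4 * logratio a b (S (S n)) / (a (S n) * r) + 1) *
      (25 / r)))
    (annuli_strip lam a b n eta).
Proof.
  intros Hl Hl' Ha Ha' HD HD' Hr.
  set (D := logratio a b (S n)) in *. set (D' := logratio a b (S (S n))) in *.
  set (l := ln (a (S n)) - ln (Cmod (lam (S n)))).
  destruct (ceil_nat D) as [c Hc]; [lra |].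
  assert (Hc0 : (0 < c)%nat) by (apply INR_lt; simpl; lra).
  set (q := 4 * D' / (a (S n) * r) + 1).
  assert (Hq : 1 <= q).
  { unfold q. assert (0 < 4 * D' / (a (S n) * r)); [apply Rdiv_lt_0_compat; nra | lra]. }
  assert (H25 : 0 < 25 / r) by (apply Rdiv_lt_0_compat; lra).
  pose (A := fun i z => annuli_strip lam a b n eta z /\ l + INR i <= Re z <= l + INR i + 1).
  eapply finite_cover_mono; [apply (finite_cover_union 0 r (seq 0 c) (fun _ => q * (25 / r)) A
      (annuli_strip lam a b n eta))
     | lra | | auto].
  - intros i _. set (u := a (S n) * exp (INR i)).
    assert (Hu : 0 < u) by (apply Rmult_lt_0_compat; [lra | apply exp_pos]).
    assert (Hu' : a (S n) <= u).
    { unfold u. pose proof (exp_ineq1_le (INR i)). pose proof (pos_INR i). nra. }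
    assert (Hw : forall z, A i z -> u <= Cmod (E (lam (S n)) z) <= 3 * u).
    { intros z [_ Hz]. rewrite Cmod_E.
      assert (Hl0 : 0 < Cmod (lam (S n))) by (apply Cmod_gt_0; exact Hl).
      assert (Hel : Cmod (lam (S n)) * exp (l + INR i) = u).
      { unfold u. rewrite exp_plus. unfold l, Rminus. rewrite exp_plus, exp_Ropp, !exp_ln by lra.
        field. lra. }
      split.
      - rewrite <- Hel. apply Rmult_le_compat_l; [lra |].
        destruct (proj1 Hz) as [H | ->]; [left; apply exp_increasing; auto | lra].
      - apply Rle_trans with (Cmod (lam (S n)) * exp (l + INR i + 1)).
        + apply Rmult_le_compat_l; [lra |].
          destruct (proj2 Hz) as [H | ->]; [left; apply exp_increasing; auto | lra].
        + rewrite exp_plus, <- Rmult_assoc, Hel. pose proof exp_le_3. nra. }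
    (* Squares of side [h] have diameter at most [u r / 2], which the pull-back ratio [2 / u] turns
       into [r]; the height [6 u] takes [24 / r] of them. *)
    set (h := u * r / 4).
    assert (Hh : 0 < h) by (unfold h; nra).
    destruct (ceil_nat (D' / h)) as [cx Hcx]; [left; apply Rdiv_lt_0_compat; lra |].
    destruct (ceil_nat (24 / r)) as [cy Hcy]; [left; apply Rdiv_lt_0_compat; lra |].
    assert (HDh : 0 < D' / h) by (apply Rdiv_lt_0_compat; lra).
    assert (H24 : 0 < 24 / r) by (apply Rdiv_lt_0_compat; lra).
    pose (X := fun w => ln (a (S (S n))) - ln (Cmod (lam (S (S n)))) <= Re w <=
       ln (a (S (S n))) - ln (Cmod (lam (S (S n)))) + INR cx * h /\
       - (3 * u) <= Im w <= - (3 * u) + INR cy * h).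
    assert (HX : finite_cover 0 (2 * h) (INR cx * INR cy) X).
    { eapply finite_cover_rectangle; [lra | apply INR_lt; simpl; lra | apply INR_lt; simpl; lra |].
      intros z Hz. exact Hz. }
    eapply finite_cover_mono; [apply (finite_cover_pull 0 (2 * h) (INR cx * INR cy) (2 / u) (E
        (lam (S n))) X (A i))
       | | | auto].
    + apply Rdiv_lt_0_compat; lra.
    + exact HX.
    + intros z Hz. pose proof (Hw z Hz) as Hwz. destruct Hz as [[HY _] _].
      pose proof (in_annuli_from_Re _ _ _ _ _ Hl' Ha' (in_annuli_from_next _ _ _ _ _ HY)) as R1.
          fold D' in R1.
      pose proof (abs_Im_le_Cmod (E (lam (S n)) z)) as HI. apply Rabs_le_between in HI.
      assert (D' <= INR cx * h).
      { apply Rmult_le_reg_r with (/ h); [apply Rinv_0_lt_compat; lra |].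
        rewrite Rmult_assoc, Rinv_r by lra. unfold Rdiv in Hcx. lra. }
      assert (6 * u <= INR cy * h).
      { replace (6 * u) with (24 / r * h) by (unfold h; field; lra).
        apply Rmult_le_compat_r; lra. }
      unfold X. lra.
    + intros z z' Hz Hz'. pose proof (Hw z Hz). pose proof (Hw z' Hz').
      destruct Hz as [[_ Hz] _]. destruct Hz' as [[_ Hz'] _].
      apply E_contract; try lra. apply Rabs_le; lra.
    + right. unfold h. field. lra.
    + rewrite Rpower_O by (apply Rdiv_lt_0_compat; lra). rewrite Rmult_1_l.
      pose proof (pos_INR cx). pose proof (pos_INR cy).
      apply Rmult_le_compat; auto.
      * apply Rle_trans with (D' / h + 1); [lra |]. unfold q. apply Rplus_le_compat_r.
        unfold h. replace (D' / (u * r / 4)) with (4 * D' * / (u * r)) by (field; lra).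
        unfold Rdiv. apply Rmult_le_compat_l; [lra |]. apply Rinv_le_contravar; nra.
      * apply Rle_trans with (24 / r + 1); [lra |].
        assert (1 <= 1 / r) by (apply Rmult_le_reg_r with r; [lra |]; unfold Rdiv; rewrite
            Rmult_assoc, Rinv_l; lra).
        unfold Rdiv in *. lra.
  - intros z Hz. pose proof (in_annuli_from_Re _ _ _ _ _ Hl Ha (proj1 Hz)) as R1. fold l D in R1.
    destruct (floor_index_le (Re z - l) 1 c) as [i [Hi Hi']]; [lra | auto | lra |].
    exists i. split; [apply in_seq; lia |]. split; [auto | lra].
  - rewrite lsum_const, length_seq. apply Rmult_le_compat_r; [nra | lra].
Qed.

(** * Countable decompositions and Hausdorff null sets *)

Lemma choice_fun {T U : Type} (Q : T -> U -> Prop) :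
  (forall x, exists y, Q x y) -> exists f : T -> U, forall x, Q x (f x).
Proof.
  intros H. exists (fun x => proj1_sig (constructive_indefinite_description _ (H x))).
  intros x. apply proj2_sig.
Qed.

Definition finite_cover_null (s : R) (A : C -> Prop) : Prop := forall eta, 0 < eta -> finite_cover
    s eta eta A.

(** At exponent 0 the weight counts pieces, so this says that covering numbers are [O (r^-s)], a
    bound on the upper box dimension. *)
Definition box_count (s : R) (A : C -> Prop) : Prop :=
  exists K, forall r, 0 < r <= 1 -> finite_cover 0 r (K * Rpower r (- s)) A.

Definition countable_union_of (P : (C -> Prop) -> Prop) (A : C -> Prop) : Prop :=
  exists Ai : nat -> C -> Prop, (forall i, P (Ai i)) /\ (forall z, A z -> exists i, Ai i z).

Lemma countable_union_of_single P A : P A -> countable_union_of P A.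
Proof. intros H. exists (fun _ => A). split; auto. intros z Hz. exists 0%nat. auto. Qed.

Lemma countable_union_of_union P (A : nat -> C -> Prop) (B : C -> Prop) :
  (forall i, countable_union_of P (A i)) -> (forall z, B z -> exists i, A i z) ->
      countable_union_of P B.
Proof.
  intros H HB. unfold countable_union_of in H.
  destruct (choice_fun _ H) as [F HF].
  exists (fun k => F (fst (of_nat k)) (snd (of_nat k))). split.
  - intros k. apply HF.
  - intros z Hz. destruct (HB z Hz) as [i Hi]. destruct (proj2 (HF i) z Hi) as [j Hj].
    exists (to_nat (i, j)). rewrite cancel_of_to. exact Hj.
Qed.

Definition lip_stable (P : (C -> Prop) -> Prop) : Prop :=
  forall c f (X T : C -> Prop), 1 <= c -> P X -> (forall z, T z -> X (f z)) ->
  (forall z z', T z -> T z' -> Cmod (Cminus z z') <= c * Cmod (Cminus (f z) (f z'))) -> P T.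

Lemma finite_cover_null_lip s : lip_stable (finite_cover_null s).
Proof.
  intros c f X T Hc HX HT Hl eta Heta.
  pose proof (Rpower_pos c s) as Hp.
  set (e := Rmin (eta / c) (eta / Rpower c s)).
  assert (He : 0 < e) by (apply Rmin_pos; apply Rdiv_lt_0_compat; lra).
  eapply finite_cover_mono; [apply (finite_cover_pull s e e c f X T) | | | auto]; auto; try lra.
  - replace eta with (c * (eta / c)) by (field; lra).
    apply Rmult_le_compat_l; [lra | apply Rmin_l].
  - replace eta with (Rpower c s * (eta / Rpower c s)) by (field; lra).
    apply Rmult_le_compat_l; [lra | apply Rmin_r].
Qed.

Lemma box_count_lip s : lip_stable (box_count s).
Proof.
  intros c f X T Hc [K HX] HT Hl. exists (K * Rpower (/ c) (- s)). intros r Hr.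
  assert (Hic : 0 < / c <= 1).
  { split; [apply Rinv_0_lt_compat; lra |]. rewrite <- Rinv_1. apply Rinv_le_contravar; lra. }
  eapply finite_cover_mono; [apply (finite_cover_pull 0 (/ c * r) (K * Rpower (/ c * r) (- s)) c f
      X T) | | | auto]; auto.
  - lra.
  - apply HX. split; [apply Rmult_lt_0_compat; lra | nra].
  - right. field. lra.
  - rewrite Rpower_O, <- Rpower_mult_distr by lra. right. ring.
Qed.

(** Since [E] never vanishes, the pieces with imaginary part in a unit interval and
    [/ INR (S m) <= Cmod (E lam z)] exhaust the plane, and on each of them [E_contract] gives a
    Lipschitz inverse. Integers appear as differences [INR j1 - INR j2]. *)
Lemma countable_union_of_E P lam (X : C -> Prop) :
  lip_stable P -> lam <> (0, 0) -> countable_union_of P X -> countable_union_of P (fun z => X (E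
      lam z)).
Proof.
  intros HP Hl [Xi [HXi HX]].
  pose (T := fun i j1 j2 m z => Xi i (E lam z) /\ INR j1 - INR j2 <= Im z <= INR j1 - INR j2 + 1 /\
     / INR (S m) <= Cmod (E lam z)).
  apply countable_union_of_union with (A := fun i z => Xi i (E lam z)).
  2: { intros z Hz. apply HX. exact Hz. }
  intros i. apply countable_union_of_union with (A := fun j1 z => exists j2 m, T i j1 j2 m z).
  2: { intros z Hz.
    assert (Hj : exists j1 j2 : nat, INR j1 - INR j2 <= Im z <= INR j1 - INR j2 + 1).
    { destruct (exists_INR_gt (- Im z)) as [j2 [Hj2 _]].
      destruct (nfloor_ex (Im z + INR j2)) as [j1 Hj1]; [lra |].
      exists j1, j2. lra. }
    destruct Hj as [j1 [j2 Hj]].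
    assert (Hm : 0 < Cmod (E lam z)).
    { rewrite Cmod_E. apply Rmult_lt_0_compat; [apply Cmod_gt_0; exact Hl | apply exp_pos]. }
    destruct (exists_INR_gt (/ Cmod (E lam z))) as [m [Hm' _]].
    exists j1, j2, m. split; [exact Hz | split; [exact Hj |]].
    rewrite <- (Rinv_inv (Cmod (E lam z))). apply Rinv_le_contravar.
    - apply Rinv_0_lt_compat; auto.
    - rewrite S_INR. lra. }
  intros j1. apply countable_union_of_union with (A := fun j2 z => exists m, T i j1 j2 m z).
  2: { intros z [j2 H]. exists j2. exact H. }
  intros j2. apply countable_union_of_union with (A := T i j1 j2).
  2: { intros z [m H]. exists m. exact H. }
  intros m. apply countable_union_of_single.
  assert (Hm : 1 <= INR (S m)) by (rewrite S_INR; pose proof (pos_INR m); lra).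
  assert (Him : 0 < / INR (S m)) by (apply Rinv_0_lt_compat; lra).
  apply (HP (2 / / INR (S m)) (E lam) (Xi i)).
  - unfold Rdiv. rewrite Rinv_inv. lra.
  - apply HXi.
  - intros z [H _]. exact H.
  - intros z z' [_ [Hz Hz1]] [_ [Hz' Hz1']].
    apply E_contract; auto. apply Rabs_le. lra.
Qed.

Lemma countable_union_of_Eiter P lam n (X : C -> Prop) :
  lip_stable P -> (forall k, (1 <= k)%nat -> lam k <> (0, 0)) -> countable_union_of P X ->
  countable_union_of P (fun z => X (Eiter lam n z)).
Proof.
  intros HP Hl. revert X. induction n as [| n IH]; intros X HX; simpl; auto.
  apply (IH (fun w => X (E (lam (S n)) w))). apply countable_union_of_E; auto. apply Hl. lia.
Qed.

Lemma countable_union_of_Iab P lam a b N0 :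
  lip_stable P -> (forall k, (1 <= k)%nat -> lam k <> (0, 0)) ->
  (forall n eta, (N0 <= n)%nat -> P (annuli_strip lam a b n eta)) -> countable_union_of P (Iab lam
      a b).
Proof.
  intros HP Hl H.
  apply countable_union_of_union with (A := fun n z => in_annuli_from lam a b (N0 + n) (Eiter lam
      (N0 + n) z)).
  - intros n. apply (countable_union_of_Eiter P lam (N0 + n) (in_annuli_from lam a b (N0 + n)));
      auto.
    apply countable_union_of_union with
      (A := fun j1 z => exists j2, annuli_strip lam a b (N0 + n) (INR j1 - INR j2) z).
    + intros j1. apply countable_union_of_union with
        (A := fun j2 z => annuli_strip lam a b (N0 + n) (INR j1 - INR j2) z); [| auto].
      intros j2. apply countable_union_of_single. apply H. lia.
    + intros z Hz. destruct (exists_INR_gt (- Im z)) as [j2 [Hj2 _]].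
      destruct (nfloor_ex (Im z + INR j2)) as [j1 Hj1]; [lra |].
      exists j1, j2. split; [exact Hz | lra].
  - intros z [N HN]. exists N. intros m Hm. rewrite orbit_from_Eiter. apply HN. lia.
Qed.

Lemma diam_nonneg U : 0 <= diam U.
Proof.
  unfold diam. destruct (Lub_Rbar_correct (fun r => exists x y, U x /\ U y /\ r = Cmod (Cminus x
      y)))
    as [H1 H2].
  destruct (Lub_Rbar _) as [l | |]; simpl; try lra.
  destruct (classic (exists x, U x)) as [[x Hx] | Hn].
  - assert (H : Rbar_le 0 l).
    { apply H1. exists x, x. split; [auto | split; [auto |]].
      replace (Cminus x x) with (RtoC 0) by ring. rewrite Cmod_0. reflexivity. }
    exact H.
  - specialize (H2 m_infty). destruct H2.
    intros r [x [y [Hx _]]]. exfalso. eauto.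
Qed.

Lemma diam_le_real U d : 0 <= d -> diam_le U d -> diam U <= d.
Proof.
  intros Hd HU. unfold diam.
  destruct (Lub_Rbar_correct (fun r => exists x y, U x /\ U y /\ r = Cmod (Cminus x y)))
    as [H1 H2].
  assert (H3 : Rbar_le (Lub_Rbar (fun r => exists x y, U x /\ U y /\ r = Cmod (Cminus x y))) d).
  { apply H2. intros r [x [y [Hx [Hy ->]]]]. apply HU; auto. }
  destruct (Lub_Rbar _) as [l | |]; simpl in *; auto; try lra.
Qed.

Lemma le_diam U d x y : diam_le U d -> U x -> U y -> Cmod (Cminus x y) <= diam U.
Proof.
  intros HU Hx Hy. unfold diam.
  destruct (Lub_Rbar_correct (fun r => exists x y, U x /\ U y /\ r = Cmod (Cminus x y)))
    as [H1 H2].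
  assert (H3 : Rbar_le (Lub_Rbar (fun r => exists x y, U x /\ U y /\ r = Cmod (Cminus x y))) d).
  { apply H2. intros r [x' [y' [Hx' [Hy' ->]]]]. apply HU; auto. }
  assert (H4 : Rbar_le (Cmod (Cminus x y))
     (Lub_Rbar (fun r => exists x y, U x /\ U y /\ r = Cmod (Cminus x y)))).
  { apply H1. eauto. }
  destruct (Lub_Rbar _) as [l | |]; simpl in *; auto; try contradiction.
Qed.

Lemma rpow_nonneg r s : 0 <= rpow r s.
Proof. unfold rpow. destruct (Req_EM_T r 0); [lra | left; apply Rpower_pos]. Qed.

Lemma rpow_pos_eq r s : 0 < r -> rpow r s = Rpower r s.
Proof. intros H. unfold rpow. destruct (Req_EM_T r 0); [lra | reflexivity]. Qed.

Lemma Rpower_le_l x y s : 0 < s -> 0 < x -> x <= y -> Rpower x s <= Rpower y s.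
Proof. intros. apply Rle_Rpower_l; lra. Qed.

Lemma rpow_le x y s : 0 < s -> 0 <= x -> 0 < y -> x <= y -> rpow x s <= Rpower y s.
Proof.
  intros Hs Hx Hy H. unfold rpow. destruct (Req_EM_T x 0).
  - left. apply Rpower_pos.
  - apply Rpower_le_l; lra.
Qed.

Lemma Lim_seq_le_const (u : nat -> R) c : (forall n, u n <= c) -> Rbar_le (Lim_seq u) c.
Proof.
  intros H. rewrite <- (Lim_seq_const c). apply Lim_seq_le_loc. exists 0%nat. auto.
Qed.

Lemma Lim_seq_ge_const (u : nat -> R) c : (forall n, c <= u n) -> Rbar_le c (Lim_seq u).
Proof.
  intros H. rewrite <- (Lim_seq_const c). apply Lim_seq_le_loc. exists 0%nat. auto.
Qed.

Lemma Rbar_le_antisym_eps (x : Rbar) :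
  Rbar_le 0 x -> (forall eps, 0 < eps -> Rbar_le x eps) -> x = 0.
Proof.
  intros H0 H. destruct x as [x | |]; simpl in *.
  - f_equal. apply Rle_antisym; [| auto].
    apply le_epsilon. intros eps He. specialize (H eps He). lra.
  - destruct (H 1 ltac:(lra)).
  - destruct H0.
Qed.

Lemma sum_half (eps : R) n :
  lsum (fun i => eps * (/ 2) ^ S i) (seq 0 n) = eps * (1 - (/ 2) ^ n).
Proof.
  induction n as [| n IH]; [simpl; ring |].
  rewrite seq_S, lsum_app, IH. simpl. field.
Qed.

(** The Cantor code of [(i, j)] is at least [i + j], so the first [n] codes are distinct pairs
    inside the [n] by [n] square. *)
Lemma lsum_pairs (g : nat -> nat -> R) (n : nat) :
  (forall i j, 0 <= g i j) ->
  lsum (fun k => g (fst (of_nat k)) (snd (of_nat k))) (seq 0 n) <=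
  lsum (fun i => lsum (g i) (seq 0 n)) (seq 0 n).
Proof.
  intros Hg.
  rewrite <- (lsum_map of_nat (fun p => g (fst p) (snd p))).
  apply Rle_trans with (lsum (fun p => g (fst p) (snd p))
    (flat_map (fun i => map (pair i) (seq 0 n)) (seq 0 n))).
  - apply lsum_incl.
    + intros; apply Hg.
    + apply Injective_map_NoDup; [| apply seq_NoDup].
      intros x y H. rewrite <- (cancel_to_of x), H, cancel_to_of. reflexivity.
    + intros [i j] H. apply in_map_iff in H. destruct H as [k [Hk Hk']].
      apply in_seq in Hk'. pose proof (to_nat_non_decreasing i j) as Hm.
      rewrite <- Hk, cancel_to_of in Hm.
      apply in_flat_map. exists i. split; [apply in_seq; lia |].
      apply in_map. apply in_seq; lia.
  - right. rewrite lsum_flat_map. apply lsum_ext. intros i _. rewrite lsum_map. reflexivity.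
Qed.

Lemma lsum_nth {T} (f : T -> R) (L : list T) (d : T) (n : nat) :
  (forall x, In x L -> 0 <= f x) ->
  lsum (fun j => if lt_dec j (length L) then f (nth j L d) else 0) (seq 0 n) <= lsum f L.
Proof.
  revert L. induction n as [| n IH]; intros L HL; [apply lsum_nonneg; auto |].
  replace (seq 0 (S n)) with (0%nat :: map S (seq 0 n)) by (simpl; rewrite seq_shift; reflexivity).
  destruct L as [| x L].
  - rewrite (lsum_ext _ (fun _ => 0)); [rewrite lsum_const; simpl; lra |].
    intros j _. destruct (lt_dec j (length nil)) as [H | H]; [simpl in H; lia | reflexivity].
  - rewrite !lsum_cons. apply Rplus_le_compat.
    { simpl. destruct (lt_dec 0 (S (length L))); [lra | lia]. }
    apply Rle_trans with (2 := IH L ltac:(intros; apply HL; right; auto)).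
    rewrite lsum_map. apply lsum_le. intros j _. simpl length. simpl nth.
    destruct (lt_dec (S j) (S (length L))), (lt_dec j (length L)); try lia; lra.
Qed.

Lemma Rbar_glb_le (Q : Rbar -> Prop) x : Q x -> Rbar_le (Rbar_glb Q) x.
Proof. intros H. unfold Rbar_glb. destruct (Rbar_ex_glb Q) as [l [H1 H2]]. simpl. auto. Qed.

Lemma Rbar_glb_ge (Q : Rbar -> Prop) l :
  (forall x, Q x -> Rbar_le l x) -> Rbar_le l (Rbar_glb Q).
Proof. intros H. unfold Rbar_glb. destruct (Rbar_ex_glb Q) as [m [H1 H2]]. simpl. auto. Qed.

Lemma Rbar_lub_ge (Q : Rbar -> Prop) x : Q x -> Rbar_le x (Rbar_lub Q).
Proof. intros H. unfold Rbar_lub. destruct (Rbar_ex_lub Q) as [l [H1 H2]]. simpl. auto. Qed.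

Lemma Rbar_lub_le (Q : Rbar -> Prop) l :
  (forall x, Q x -> Rbar_le x l) -> Rbar_le (Rbar_lub Q) l.
Proof. intros H. unfold Rbar_lub. destruct (Rbar_ex_lub Q) as [m [H1 H2]]. simpl. auto. Qed.

Lemma sum_rpow_nonneg (d : nat -> R) s n : 0 <= sum_f_R0 (fun i => rpow (d i) s) n.
Proof. apply cond_pos_sum. intros. apply rpow_nonneg. Qed.

Lemma hausdorff_delta_nonneg s del A : Rbar_le 0 (hausdorff_delta s del A).
Proof.
  apply Rbar_glb_ge. intros v [U [_ [_ ->]]].
  apply Lim_seq_ge_const. intros n. apply sum_rpow_nonneg.
Qed.

Lemma Sup_seq_le_const (u : nat -> Rbar) c : (forall n, Rbar_le (u n) c) -> Rbar_le (Sup_seq u) c.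
Proof. intros H. rewrite Rbar_sup_eq_lub. apply Rbar_lub_le. intros x [n ->]. auto. Qed.

Lemma Sup_seq_ge (u : nat -> Rbar) n : Rbar_le (u n) (Sup_seq u).
Proof. rewrite Rbar_sup_eq_lub. apply Rbar_lub_ge. eauto. Qed.

(** The [i]-th set is covered with weight at most [eps / 2^(i+1)], and the finite covers are merged
    into one sequence by Cantor pairing. *)
Lemma hausdorff_null s A : 0 < s -> countable_union_of (finite_cover_null s) A ->
    hausdorff_measure s A = 0.
Proof.
  intros Hs [Ai [HAi HA]].
  assert (H : forall del, 0 < del -> Rbar_le (hausdorff_delta s del A) 0).
  { intros del Hdel.
    cut (hausdorff_delta s del A = 0); [intros ->; apply Rbar_le_refl |].
    apply Rbar_le_antisym_eps; [apply hausdorff_delta_nonneg |]. intros eps Heps.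
    pose (eta := fun i => Rmin del (eps * (/ 2) ^ S i)).
    assert (Heta : forall i, 0 < eta i).
    { intros i. apply Rmin_pos; auto. apply Rmult_lt_0_compat; auto. apply pow_lt. lra. }
    assert (HL := fun i => HAi i (eta i) (Heta i)). unfold finite_cover in HL.
    destruct (choice_fun _ HL) as [L HLs].
    (* Positions beyond the end of a list are filled with the empty set, whose [diam] is 0 and whose
       [rpow] is therefore 0. *)
    pose (dft := ((fun _ : C => False), 1)).
    pose (U := fun k => fst (nth (snd (of_nat k)) (L (fst (of_nat k))) dft)).
    apply Rbar_le_trans with (Lim_seq (fun n => sum_f_R0 (fun i => rpow (diam (U i)) s) n)).
    { apply Rbar_glb_le. exists U. repeat split.
      - intros k. unfold U. destruct (of_nat k) as [i j]. simpl.
        destruct (lt_dec j (length (L i))) as [Hj | Hj].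
        + destruct (HLs i) as [_ [H2 _]]. destruct (H2 _ (nth_In _ dft Hj)) as [Hd Hd'].
          intros x y Hx Hy. apply Rle_trans with (1 := Hd x y Hx Hy).
          apply Rle_trans with (1 := proj2 Hd'). apply Rmin_l.
        + rewrite nth_overflow by lia. intros x y [].
      - intros z Hz. destruct (HA z Hz) as [i Hi]. destruct (HLs i) as [H1 _].
        destruct (H1 z Hi) as [p [Hp Hpz]]. destruct (In_nth _ _ dft Hp) as [j [Hj Hjp]].
        exists (to_nat (i, j)). unfold U. rewrite cancel_of_to. simpl. rewrite Hjp. exact Hpz. }
    apply Lim_seq_le_const. intros n. rewrite sum_f_R0_lsum.
    pose (g := fun i j => if lt_dec j (length (L i)) then Rpower (snd (nth j (L i) dft)) s else 0).
    apply Rle_trans with (lsum (fun k => g (fst (of_nat k)) (snd (of_nat k))) (seq 0 (S n))).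
    { apply lsum_le. intros k _. unfold U, g. destruct (of_nat k) as [i j]. simpl fst; simpl snd.
      destruct (lt_dec j (length (L i))) as [Hj | Hj].
      - destruct (HLs i) as [_ [H2 _]]. destruct (H2 _ (nth_In _ dft Hj)) as [Hd Hd'].
        apply rpow_le; try lra; [apply diam_nonneg |]. apply diam_le_real; [lra | auto].
      - rewrite nth_overflow by lia. unfold rpow, dft; simpl.
        destruct (Req_EM_T (diam (fun _ => False)) 0) as [e | e]; [lra |].
        exfalso. apply e. apply Rle_antisym; [| apply diam_nonneg].
        apply diam_le_real; [lra |]. intros x y []. }
    apply Rle_trans with (1 := lsum_pairs g (S n) ltac:(
      intros; unfold g; destruct (lt_dec _ _); [left; apply Rpower_pos | lra])).
    apply Rle_trans with (lsum (fun i => eps * (/ 2) ^ S i) (seq 0 (S n))).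
    { apply lsum_le. intros i _.
      apply Rle_trans with (lsum (fun p => Rpower (snd p) s) (L i)).
      - apply (lsum_nth (fun p => Rpower (snd p) s)). intros; left; apply Rpower_pos.
      - destruct (HLs i) as [_ [_ H3]]. apply Rle_trans with (1 := H3). apply Rmin_r. }
    rewrite sum_half. assert (0 < (/ 2) ^ S n) by (apply pow_lt; lra). nra. }
  apply Rbar_le_antisym.
  - apply Sup_seq_le_const. intros n. apply H. apply Rinv_0_lt_compat. apply lt_0_INR. lia.
  - apply Rbar_le_trans with (1 := hausdorff_delta_nonneg s (/ INR 1) A).
    apply (Sup_seq_ge (fun n => hausdorff_delta s (/ INR (S n)) A) 0).
Qed.

(** * Packing null sets *)

(** Pigeonhole: a piece of diameter at most [d] contains at most one of the points, and at exponent
    0 the weight is the number of pieces. *)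
Lemma finite_cover_separated {I : Type} (d w : R) (A : C -> Prop) (l : list I) (x : I -> C) :
  finite_cover 0 d w A -> NoDup l -> (forall i, In i l -> A (x i)) ->
  (forall i j, In i l -> In j l -> i <> j -> d < Cmod (Cminus (x i) (x j))) ->
  INR (length l) <= w.
Proof.
  intros [L [H1 [H2 H3]]] Hl HA Hsep.
  assert (HL : lsum (fun p => Rpower (snd p) 0) L = INR (length L)).
  { rewrite (lsum_ext _ (fun _ => 1)); [rewrite lsum_const; ring |].
    intros p Hp. apply Rpower_O. apply H2; auto. }
  apply Rle_trans with (2 := H3). rewrite HL. apply le_INR.
  assert (Hphi : forall i, exists p, In i l -> In p L /\ fst p (x i)).
  { intros i. destruct (classic (In i l)) as [Hi | Hi].
    - destruct (H1 (x i) (HA i Hi)) as [p Hp]. exists p. auto.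
    - exists ((fun _ => False), 0). contradiction. }
  destruct (choice_fun _ Hphi) as [phi Hphi'].
  rewrite <- (length_map phi l). apply NoDup_incl_length.
  - apply NoDup_map_NoDup_ForallPairs; auto.
    intros i j Hi Hj Hij. apply NNPP. intros Hn.
    pose proof (Hsep i j Hi Hj Hn) as Hd.
    destruct (Hphi' i Hi) as [Hp Hpi]. destruct (Hphi' j Hj) as [_ Hpj].
    rewrite <- Hij in Hpj. destruct (H2 _ Hp) as [Hdl Hdd].
    pose proof (Hdl _ _ Hpi Hpj). lra.
  - intros p Hp. apply in_map_iff in Hp. destruct Hp as [i [<- Hi]]. apply Hphi'; auto.
Qed.

Lemma lsum_filter {T} (f : T -> R) (p : T -> bool) l :
  lsum f l = lsum f (filter p l) + lsum f (filter (fun x => negb (p x)) l).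
Proof.
  induction l as [| x l IH]; simpl; [ring |].
  rewrite IH. destruct (p x); simpl; ring.
Qed.

Lemma Rpower_half k e : Rpower ((/ 2) ^ k) e = (Rpower (/ 2) e) ^ k.
Proof.
  rewrite <- (Rpower_pow k (/ 2)), <- (Rpower_pow k (Rpower (/ 2) e)) by (try apply Rpower_pos;
      lra).
  rewrite !Rpower_mult. f_equal. ring.
Qed.

(* The balls with [2^-(k+1) < rho <= 2^-k] have centres more than [2^-(k+1)] apart, so box
   counting bounds how many there are. *)
Lemma packing_sum_dyadic (sg s K : R) (A : C -> Prop) (x : nat -> C) (rho : nat -> R) :
  0 < sg < s -> (forall r, 0 < r <= 1 -> finite_cover 0 r (K * Rpower r (- sg)) A) ->
  (forall i, A (x i)) ->
  (forall i j, i <> j -> 0 < rho i -> 0 < rho j -> (rho i + rho j) / 2 < Cmod (Cminus (x i) (x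
      j))) ->
  forall t m l, NoDup l -> (forall i, In i l -> (/ 2) ^ (m + t) < rho i <= (/ 2) ^ m) ->
  lsum (fun i => Rpower (rho i) s) l <=
    K * Rpower 2 sg * (Rpower (/ 2) (s - sg)) ^ m / (1 - Rpower (/ 2) (s - sg)).
Proof.
  intros Hs HF HA Hsep. set (th := Rpower (/ 2) (s - sg)).
  assert (Hth : 0 < th < 1).
  { split; [apply Rpower_pos |]. unfold th, Rpower. rewrite <- exp_0. apply exp_increasing.
    rewrite ln_Rinv by lra. pose proof ln_lt_2. nra. }
  assert (HK : 0 <= K).
  { pose proof (finite_cover_weight_nonneg _ _ _ _ (HF 1 ltac:(lra))) as H.
    pose proof (Rpower_pos 1 (- sg)). nra. }
  pose proof (Rpower_pos 2 sg) as H2s.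
  induction t as [| t IH]; intros m l Hl Hr.
  - destruct l as [| i l].
    + simpl. apply Rmult_le_pos; [| left; apply Rinv_0_lt_compat; lra].
      repeat apply Rmult_le_pos; try lra. apply pow_le; lra.
    + specialize (Hr i (or_introl eq_refl)). rewrite Nat.add_0_r in Hr. lra.
  (* The coarsest dyadic class is split off; the remaining [t] classes start one level lower. The
     class bounds form a geometric series of ratio [th], so the total does not depend on [t]. *)
  - pose (p := fun i => if Rlt_dec ((/ 2) ^ (S m)) (rho i) then true else false).
    rewrite (lsum_filter _ p).
    assert (Ha : lsum (fun i => Rpower (rho i) s) (filter p l) <= K * Rpower 2 sg * th ^ m).
    { apply Rle_trans with (lsum (fun _ => (Rpower (/ 2) s) ^ m) (filter p l)).
      - apply lsum_le. intros i Hi. apply filter_In in Hi. destruct Hi as [Hi _].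
        specialize (Hr i Hi). rewrite <- Rpower_half.
        assert (0 < (/ 2) ^ (m + S t)) by (apply pow_lt; lra).
        apply Rpower_le_l; lra.
      - rewrite lsum_const.
        assert (Hh : 0 < (/ 2) ^ S m <= 1).
        { split; [apply pow_lt; lra |]. rewrite <- (pow1 (S m)). apply pow_incr. lra. }
        assert (Hc : INR (length (filter p l)) <= K * Rpower ((/ 2) ^ S m) (- sg)).
        { apply finite_cover_separated with (d := (/ 2) ^ S m) (A := A) (x := x); auto.
          - apply NoDup_filter; auto.
          - intros i j Hi Hj Hij. apply filter_In in Hi. apply filter_In in Hj.
            destruct Hi as [_ Hi], Hj as [_ Hj]. unfold p in *.
            destruct (Rlt_dec ((/ 2) ^ S m) (rho i)); [| discriminate].
            destruct (Rlt_dec ((/ 2) ^ S m) (rho j)); [| discriminate].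
            pose proof (Hsep i j Hij ltac:(lra) ltac:(lra)). lra. }
        pose proof (pow_lt _ m (Rpower_pos (/ 2) s)) as Hp.
        apply Rle_trans with (K * Rpower ((/ 2) ^ S m) (- sg) * Rpower (/ 2) s ^ m);
          [apply Rmult_le_compat_r; lra |].
        rewrite Rpower_half. rewrite <- tech_pow_Rmult.
        right. replace th with (Rpower (/ 2) (- sg) * Rpower (/ 2) s).
        + replace (Rpower (/ 2) (- sg)) with (Rpower 2 sg).
          * rewrite Rpow_mult_distr. ring.
          * unfold Rpower. rewrite ln_Rinv by lra. f_equal. ring.
        + unfold th. rewrite <- Rpower_plus. f_equal. ring. }
    assert (Hb : lsum (fun i => Rpower (rho i) s) (filter (fun i => negb (p i)) l) <=
        K * Rpower 2 sg * th ^ S m / (1 - th)).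
    { apply IH; [apply NoDup_filter; auto |]. intros i Hi. apply filter_In in Hi.
      destruct Hi as [Hi Hp]. specialize (Hr i Hi). unfold p in Hp.
      destruct (Rlt_dec ((/ 2) ^ S m) (rho i)); [discriminate |].
      rewrite Nat.add_succ_r in Hr. change (S m + t)%nat with (S (m + t)). lra. }
    apply Rle_trans with (1 := Rplus_le_compat _ _ _ _ Ha Hb).
    right. simpl. field. lra.
Qed.

Lemma half_pow_small (x : R) : 0 < x -> exists n, (/ 2) ^ n < x.
Proof.
  intros Hx. destruct (pow_lt_1_zero (/ 2)) with (y := x) as [n Hn]; auto.
  { rewrite Rabs_pos_eq; lra. }
  exists n. specialize (Hn n (le_n _)). rewrite Rabs_pos_eq in Hn; auto. apply pow_le. lra.
Qed.

Lemma list_pos_lower (rho : nat -> R) l :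
  (forall i, In i l -> 0 < rho i) -> exists n, forall i, In i l -> (/ 2) ^ n < rho i.
Proof.
  induction l as [| i l IH]; intros H.
  - exists 0%nat. intros i [].
  - destruct IH as [n Hn]; [intros; apply H; right; auto |].
    destruct (half_pow_small (rho i)) as [m Hm]; [apply H; left; auto |].
    exists (n + m)%nat. intros j [<- | Hj].
    + apply Rle_lt_trans with (2 := Hm). rewrite pow_add.
      assert (0 < (/ 2) ^ m) by (apply pow_lt; lra).
      assert ((/ 2) ^ n <= 1) by (rewrite <- (pow1 n); apply pow_incr; lra). nra.
    + apply Rle_lt_trans with (2 := Hn j Hj). rewrite pow_add.
      assert (0 < (/ 2) ^ n) by (apply pow_lt; lra).
      assert ((/ 2) ^ m <= 1) by (rewrite <- (pow1 m); apply pow_incr; lra). nra.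
Qed.

(** If the centres were closer, the point dividing the segment in the ratio [r : r'] would lie in
    both balls. *)
Lemma disjoint_balls_dist (x y : C) (r r' : R) :
  0 < r -> 0 < r' ->
  (forall z, ~ (Cmod (Cminus z x) <= r /\ Cmod (Cminus z y) <= r')) ->
  r + r' < Cmod (Cminus x y).
Proof.
  intros Hr Hr' H. apply Rnot_le_lt. intros Hle.
  set (t := r / (r + r')).
  assert (Ht : 0 < t) by (apply Rdiv_lt_0_compat; lra).
  assert (Ht' : 1 - t = r' / (r + r')) by (unfold t; field; lra).
  assert (Ht2 : 0 < 1 - t) by (rewrite Ht'; apply Rdiv_lt_0_compat; lra).
  apply (H (Cplus x (Cmult (RtoC t) (Cminus y x)))). split.
  - replace (Cminus (Cplus x (Cmult t (Cminus y x))) x) with (Cmult t (Cminus y x)) by ring.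
    rewrite Cmod_mult, Cmod_R, Rabs_pos_eq, Cmod_minus_sym by lra.
    replace r with (t * (r + r')) by (unfold t; field; lra).
    apply Rmult_le_compat_l; lra.
  - replace (Cminus (Cplus x (Cmult t (Cminus y x))) y)
      with (Cmult (RtoC (1 - t)) (Cminus x y)).
    2: { rewrite RtoC_minus. ring. }
    rewrite Cmod_mult, Cmod_R, Rabs_pos_eq by lra.
    replace r' with ((1 - t) * (r + r')) by (rewrite Ht'; field; lra).
    apply Rmult_le_compat_l; lra.
Qed.

Lemma packing_delta_nonneg s del A : Rbar_le 0 (packing_delta s del A).
Proof. apply Rbar_lub_ge. left. reflexivity. Qed.

Lemma packing_pre_nonneg s A : Rbar_le 0 (packing_pre s A).
Proof.
  unfold packing_pre. rewrite Inf_eq_glb. apply Rbar_glb_ge.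
  intros x [n ->]. apply packing_delta_nonneg.
Qed.

Lemma packing_pre_le s A n : Rbar_le (packing_pre s A) (packing_delta s (/ INR (S n)) A).
Proof. unfold packing_pre. rewrite Inf_eq_glb. apply Rbar_glb_le. eauto. Qed.

(** Balls of diameter at most [2^-m] contribute at most [c * th^m], which tends to 0 with the scale.
    A partial sum has a least positive radius, so finitely many dyadic classes suffice, and
    degenerate balls contribute nothing. *)
Lemma packing_pre_null sg s A : 0 < sg < s -> box_count sg A -> packing_pre s A = 0.
Proof.
  intros Hs [K HF].
  set (th := Rpower (/ 2) (s - sg)).
  assert (Hth : 0 < th < 1).
  { split; [apply Rpower_pos |]. unfold th, Rpower. rewrite <- exp_0. apply exp_increasing.
    rewrite ln_Rinv by lra. pose proof ln_lt_2. nra. }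
  apply Rbar_le_antisym_eps; [apply packing_pre_nonneg |]. intros eps Heps.
  set (c := K * Rpower 2 sg / (1 - th)).
  assert (Hm : exists m, c * th ^ m <= eps).
  { destruct (Rle_dec c 0) as [Hc | Hc].
    - exists 0%nat. simpl. lra.
    - destruct (pow_lt_1_zero th) with (y := eps / c) as [n Hn].
      + rewrite Rabs_pos_eq; lra.
      + apply Rdiv_lt_0_compat; lra.
      + exists n. specialize (Hn n (le_n _)).
        rewrite Rabs_pos_eq in Hn by (apply pow_le; lra).
        replace eps with (c * (eps / c)) by (field; lra).
        apply Rmult_le_compat_l; lra. }
  destruct Hm as [m Hm].
  destruct (exists_INR_gt (/ ((/ 2) ^ m))) as [n [Hn _]].
  assert (Hm0 : 0 < (/ 2) ^ m) by (apply pow_lt; lra).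
  assert (Hdel : / INR (S n) <= (/ 2) ^ m).
  { rewrite <- (Rinv_inv ((/ 2) ^ m)). apply Rinv_le_contravar.
    - apply Rinv_0_lt_compat; auto.
    - rewrite S_INR. lra. }
  apply Rbar_le_trans with (1 := packing_pre_le s A n).
  apply Rbar_lub_le. intros v [-> | [x [r [HA [Hr [Hdis ->]]]]]]; [simpl; lra |].
  apply Lim_seq_le_const. intros k.
  rewrite sum_f_R0_lsum.
  pose (p := fun i => if Rlt_dec 0 (r i) then true else false).
  rewrite (lsum_filter _ p).
  rewrite (lsum_ext _ (fun _ => 0) (filter (fun i => negb (p i)) (seq 0 (S k)))).
  2: { intros i Hi. apply filter_In in Hi. destruct Hi as [_ Hi]. unfold p in Hi.
       destruct (Rlt_dec 0 (r i)); [discriminate |].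
       pose proof (proj1 (Hr i)). unfold rpow. destruct (Req_EM_T (2 * r i) 0); lra. }
  rewrite lsum_const, Rmult_0_r, Rplus_0_r.
  assert (Hpos : forall i, In i (filter p (seq 0 (S k))) -> 0 < 2 * r i).
  { intros i Hi. apply filter_In in Hi. destruct Hi as [_ Hi]. unfold p in Hi.
    destruct (Rlt_dec 0 (r i)); [lra | discriminate]. }
  destruct (list_pos_lower (fun i => 2 * r i) _ Hpos) as [M HM].
  rewrite (lsum_ext _ (fun i => Rpower (2 * r i) s)).
  2: { intros i Hi. apply rpow_pos_eq. auto. }
  apply Rle_trans with (2 := Hm).
  replace (c * th ^ m) with (K * Rpower 2 sg * th ^ m / (1 - th)) by (unfold c; field; lra).
  apply (packing_sum_dyadic sg s K A x (fun i => 2 * r i)) with (t := M); auto.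
  - intros i j Hij Hi Hj.
    pose proof (disjoint_balls_dist (x i) (x j) (r i) (r j) ltac:(lra) ltac:(lra)
      (fun z => Hdis i j Hij ltac:(lra) ltac:(lra) z)). lra.
  - apply NoDup_filter. apply seq_NoDup.
  - intros i Hi. split.
    + apply Rle_lt_trans with (2 := HM i Hi). rewrite pow_add.
      assert (0 < (/ 2) ^ M) by (apply pow_lt; lra).
      assert ((/ 2) ^ m <= 1) by (rewrite <- (pow1 m); apply pow_incr; lra). nra.
    + destruct (Hr i). lra.
Qed.

Lemma Rbar_psum_nonneg u n : (forall i, Rbar_le 0 (u i)) -> Rbar_le 0 (Rbar_psum u n).
Proof.
  intros H. induction n as [| n IH]; [apply H |]. simpl Rbar_psum.
  specialize (H (S n)). destruct (Rbar_psum u n), (u (S n)); simpl in *; auto; lra.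
Qed.

Lemma packing_null sg s A : 0 < sg < s -> countable_union_of (box_count sg) A -> packing_measure s
    A = 0.
Proof.
  intros Hs [Ai [HAi HA]]. apply Rbar_le_antisym.
  - apply Rbar_glb_le. exists Ai. split; auto.
    symmetry. transitivity (Sup_seq (fun _ => Finite 0)).
    + apply Sup_seq_ext. intros n. induction n as [| n IH].
      * apply (packing_pre_null sg s); auto.
      * simpl. rewrite IH, (packing_pre_null sg s (Ai (S n))); auto. simpl. f_equal. lra.
    + apply Rbar_le_antisym.
      * apply Sup_seq_le_const. intros; apply Rbar_le_refl.
      * apply (Sup_seq_ge (fun _ => Finite 0) 0%nat).
  - apply Rbar_glb_ge. intros v [Bi [_ ->]].
    apply Rbar_le_trans with (Rbar_psum (fun i => packing_pre s (Bi i)) 0).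
    + apply packing_pre_nonneg.
    + apply Sup_seq_ge.
Qed.

(** * Asymptotics of the annuli and upper bounds *)

(** The asymptotic form of the hypotheses in which both dimensions are computed. [tame_left] places
    the left edge of the strip between the imaginary axis and the circle of radius [a n],
    [tame_width] makes the strip thin compared with that circle, and [tame_growth] is (b) in
    logarithmic form. *)
Record tame (Delta : R) (lam : nat -> C) (a b : nat -> R) : Prop := {
  tame_Delta : 0 < Delta;
  tame_lam : forall n, (1 <= n)%nat -> lam n <> (0, 0);
  tame_ab : forall n, (1 <= n)%nat -> 0 < a n < b n;
  tame_logratio : forall n, (1 <= n)%nat -> Delta < logratio a b n;
  tame_a : forall X, eventually (fun n => X <= a n);
  tame_small : forall eps, 0 < eps -> eventually (fun n => logratio a b n <= eps * ln (a n));
  tame_left : eventually (fun n => 0 <= ln (a (S n)) - ln (Cmod (lam (S n))) <= a n);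
  tame_width : forall eps, 0 < eps -> eventually (fun n => logratio a b (S n) <= eps * a n);
  tame_growth : forall X, eventually (fun n => X * INR n <= ln (prod1 a n))
}.

Lemma LimInf_gt_eventually (u : nat -> R) (c : R) :
  Rbar_lt c (LimInf_seq u) -> eventually (fun n => c <= u n).
Proof.
  intros H. unfold LimInf_seq in H. destruct (ex_LimInf_seq u) as [l Hl]. simpl in H.
  destruct l as [l | |]; simpl in *.
  - destruct (Hl (mkposreal (l - c) ltac:(lra))) as [_ [N HN]]. exists N. intros n Hn.
    specialize (HN n Hn). simpl in HN. lra.
  - destruct (Hl c) as [N HN]. exists N. intros n Hn. left. auto.
  - contradiction.
Qed.

Lemma le_ln_of_exp_le x y : 0 < x -> exp y <= x -> y <= ln x.
Proof. intros Hx H. rewrite <- (ln_exp y). apply ln_le; [apply exp_pos | auto]. Qed.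

Lemma prod1_pos (a : nat -> R) n : (forall k, (1 <= k)%nat -> 0 < a k) -> 0 < prod1 a n.
Proof.
  intros H. induction n as [| n IH]; simpl; [lra |]. apply Rmult_lt_0_compat; auto. apply H. lia.
Qed.

Lemma ln_prod1_S (a : nat -> R) n :
  (forall k, (1 <= k)%nat -> 0 < a k) -> ln (prod1 a (S n)) = ln (prod1 a n) + ln (a (S n)).
Proof. intros H. simpl. rewrite ln_mult; auto; [apply prod1_pos; auto | apply H; lia]. Qed.

Lemma tame_intro (q Delta : R) (lam : nat -> C) (a b : nat -> R) :
  0 < q < 1 -> 0 < Delta ->
  (forall n, (1 <= n)%nat -> lam n <> (0,0)) ->
  (exists M : R, forall n, (1 <= n)%nat -> Cmod (lam n) <= M) ->
  (forall n, (1 <= n)%nat -> 0 < a n < b n) ->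
  (exists N : nat, forall n, (N <= n)%nat -> a (S n) <= Cmod (lam (S n)) * exp (q * a n)) ->
  is_lim_seq (fun n => Rpower (prod1 a n) (/ INR n)) p_infty ->
  (forall n, (1 <= n)%nat -> ln (b n / a n) > Delta) ->
  Rbar_lt (Finite 1) (LimInf_seq a) ->
  is_lim_seq (fun n => ln (b n) / ln (a n)) 1 ->
  tame Delta lam a b.
Proof.
  intros Hq HDelta Hlam [M HM] Hab [Na Hna] Hgrow HD Hinf Hlim.
  assert (Hpos : forall k, (1 <= k)%nat -> 0 < a k) by (intros k Hk; apply Hab; auto).
  destruct (LimInf_gt_eventually a 1 Hinf) as [N1 HN1].
  assert (Hsmall : forall eps, 0 < eps -> eventually (fun n => 0 < ln (a n) /\ logratio a b n <=
      eps * ln (a n))).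
  { intros eps Heps. apply is_lim_seq_spec in Hlim.
    destruct (Hlim (mkposreal (Rmin eps (1 / 2)) ltac:(apply Rmin_pos; lra))) as [N HN].
    exists (S (N + N1)). intros n Hn. specialize (HN n ltac:(lia)). simpl in HN.
    assert (H1 := HN1 n ltac:(lia)). assert (H2 := Hab n ltac:(lia)).
    assert (Hl : 0 <= ln (a n)) by (rewrite <- ln_1; apply ln_le; lra).
    pose proof (Rmin_l eps (1 / 2)). pose proof (Rmin_r eps (1 / 2)).
    apply Rabs_lt_between in HN.
    destruct Hl as [Hl | Hl].
    - split; auto. unfold logratio. rewrite ln_div by lra.
      assert (ln (b n) = ln (b n) / ln (a n) * ln (a n)) by (field; lra). nra.
    (* If [ln (a n) = 0], division by zero makes the quotient 0, which is not within 1/2 of 1; hence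
       the [Rmin] with [1 / 2]. *)
    - exfalso. rewrite <- Hl in HN. unfold Rdiv in HN. rewrite Rinv_0, Rmult_0_r in HN. lra. }
  assert (Ha : forall X, eventually (fun n => X <= a n)).
  { intros X. set (X' := Rmax X 1). assert (HX : X <= X' /\ 1 <= X') by (split; [apply Rmax_l |
      apply Rmax_r]).
    assert (Hlx : 0 <= ln X') by (rewrite <- ln_1; apply ln_le; lra).
    (* With this tolerance, [Delta < Delta_n <= eps * ln (a n)] forces [ln (a n)] above
       [ln X' + 1]. *)
    destruct (Hsmall (Delta / (ln X' + 1))) as [N HN]; [apply Rdiv_lt_0_compat; lra |].
    exists (S N). intros n Hn. specialize (HN n ltac:(lia)).
    assert (H2 := HD n ltac:(lia)). assert (H3 := Hab n ltac:(lia)). unfold logratio in HN.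
    assert (H4 : ln X' + 1 < ln (a n)).
    { apply Rmult_lt_reg_l with (Delta / (ln X' + 1)); [apply Rdiv_lt_0_compat; lra |].
      replace (Delta / (ln X' + 1) * (ln X' + 1)) with Delta by (field; lra). lra. }
    assert (X' < a n) by (apply ln_lt_inv; lra). lra. }
  assert (HM0 : 0 < M).
  { apply Rlt_le_trans with (2 := HM 1%nat (le_n _)). apply Cmod_gt_0. apply (Hlam 1%nat). lia. }
  assert (Hleft : eventually (fun n => 0 <= ln (a (S n)) - ln (Cmod (lam (S n))) <= q * a n)).
  { destruct (Ha M) as [N HN]. exists (N + Na)%nat. intros n Hn.
    specialize (HN (S n) ltac:(lia)). specialize (HM (S n) ltac:(lia)).
    specialize (Hna n ltac:(lia)). specialize (Hab (S n) ltac:(lia)).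
    assert (Hl0 : 0 < Cmod (lam (S n))) by (apply Cmod_gt_0; apply (Hlam (S n)); lia).
    pose proof (ln_le (Cmod (lam (S n))) (a (S n)) Hl0 ltac:(lra)).
    pose proof (ln_le (a (S n)) _ ltac:(lra) Hna) as H1.
    rewrite ln_mult, ln_exp in H1 by (auto; apply exp_pos). lra. }
  constructor; auto.
  - intros eps Heps. destruct (Hsmall eps Heps) as [N HN]. exists N. intros n Hn. apply HN; auto.
  - destruct Hleft as [N HN], (Ha 0) as [N' HN']. exists (N + N')%nat. intros n Hn.
    specialize (HN n ltac:(lia)). specialize (HN' n ltac:(lia)). nra.
  (* By (a) and the bound [M], [ln (a (S n)) <= ln M + q * a n <= 2 * a n] once [a n >= ln M]; half
     of [eps] therefore suffices for [Hsmall]. *)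
  - intros eps Heps. destruct Hleft as [N HN], (Ha (Rmax 0 (ln M))) as [N' HN'].
    destruct (Hsmall (eps / 2)) as [N2 HN2]; [lra |].
    exists (N + N' + N2)%nat. intros n Hn.
    specialize (HN n ltac:(lia)). specialize (HN' n ltac:(lia)). specialize (HN2 (S n) ltac:(lia)).
    pose proof (Rmax_l 0 (ln M)). pose proof (Rmax_r 0 (ln M)).
    assert (Hl0 : 0 < Cmod (lam (S n))) by (apply Cmod_gt_0; apply (Hlam (S n)); lia).
    pose proof (ln_le (Cmod (lam (S n))) M Hl0 (HM (S n) ltac:(lia))).
    assert (ln (a (S n)) <= 2 * a n) by nra. nra.
  - intros X. apply is_lim_seq_spec in Hgrow. destruct (Hgrow (exp X)) as [N HN].
    exists (S N). intros n Hn. specialize (HN n ltac:(lia)).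
    unfold Rpower in HN. apply exp_lt_inv in HN.
    assert (Hn0 : 0 < INR n) by (apply lt_0_INR; lia).
    apply Rmult_le_reg_l with (/ INR n); [apply Rinv_0_lt_compat; auto |].
    replace (/ INR n * (X * INR n)) with X by (field; lra). lra.
Qed.

Lemma tame_pos Delta lam a b : tame Delta lam a b -> forall k, (1 <= k)%nat -> 0 < a k.
Proof. intros H k Hk. apply (tame_ab _ _ _ _ H k Hk). Qed.

Lemma tame_logratio_pos Delta lam a b : tame Delta lam a b -> forall k, (1 <= k)%nat -> 0 <
    logratio a b k.
Proof. intros H k Hk. pose proof (tame_logratio _ _ _ _ H k Hk). pose proof (tame_Delta _ _ _ _
    H). lra. Qed.

Lemma tame_b_eq Delta lam a b k : tame Delta lam a b -> (1 <= k)%nat -> b k = a k * exp (logratio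
    a b k).
Proof.
  intros H Hk. pose proof (tame_ab _ _ _ _ H k Hk). unfold logratio.
  rewrite exp_ln by (apply Rdiv_lt_0_compat; lra). field. lra.
Qed.

(** The starting weight [w] is the same at every level, so one may start [m] levels deeper and pull
    back [m] times; each pull-back at least halves both diameters and weight. *)
Lemma tame_finite_cover_null Delta lam a b s :
  tame Delta lam a b -> 1 < s ->
  exists N, forall n eta, (N <= n)%nat -> finite_cover_null s (annuli_strip lam a b n eta).
Proof.
  intros HT Hs.
  (* The threshold makes [3 b (2 / a)^s <= 1 / 2]: half of the surplus [(s - 1) * ln a] pays for
     [Delta_n], the other half for [ln 6 + s * ln 2]. *)
  destruct (tame_a _ _ _ _ HT (Rmax 8 (exp (2 * (ln 6 + s * ln 2) / (s - 1))))) as [N1 HN1].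
  destruct (tame_small _ _ _ _ HT ((s - 1) / 2) ltac:(lra)) as [N2 HN2].
  destruct (tame_width _ _ _ _ HT 1 ltac:(lra)) as [N3 HN3].
  exists (N1 + N2 + N3)%nat.
  set (w := 2 * (Rpower 8 s * (1 + / (s - 1)))).
  assert (G : forall m n eta, (N1 + N2 + N3 <= n)%nat ->
    finite_cover s (8 * (/ 2) ^ m) (w * (/ 2) ^ m) (annuli_strip lam a b n eta)).
  { induction m as [| m IH]; intros n eta Hn.
    - simpl. rewrite !Rmult_1_r. apply finite_cover_strip_weight; auto.
      + apply (tame_lam _ _ _ _ HT). lia.
      + apply (tame_pos _ _ _ _ HT). lia.
      + apply (tame_pos _ _ _ _ HT). lia.
      + split; [apply (tame_logratio_pos _ _ _ _ HT); lia |].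
        specialize (HN3 (S n) ltac:(lia)). lra.
    - specialize (HN1 (S n) ltac:(lia)). specialize (HN2 (S n) ltac:(lia)).
      pose proof (Rmax_l 8 (exp (2 * (ln 6 + s * ln 2) / (s - 1)))) as H8.
      pose proof (Rmax_r 8 (exp (2 * (ln 6 + s * ln 2) / (s - 1)))) as He.
      assert (Hab := tame_ab _ _ _ _ HT (S n) ltac:(lia)).
      assert (Hln : 2 * (ln 6 + s * ln 2) / (s - 1) <= ln (a (S n))) by (apply le_ln_of_exp_le;
          lra).
      assert (Hln' : ln 6 + s * ln 2 <= (s - 1) / 2 * ln (a (S n))).
      { replace (ln 6 + s * ln 2) with ((s - 1) / 2 * (2 * (ln 6 + s * ln 2) / (s - 1))) by
          (field; lra).
        apply Rmult_le_compat_l; lra. }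
      assert (H2a : 0 < 2 / a (S n) <= 1 / 2).
      { split; [apply Rdiv_lt_0_compat; lra |].
        apply Rmult_le_reg_r with (a (S n)); [lra |].
        replace (2 / a (S n) * a (S n)) with 2 by (field; lra). lra. }
      assert (Hfac : 3 * b (S n) * Rpower (2 / a (S n)) s <= / 2).
      { rewrite (tame_b_eq _ _ _ _ _ HT) by lia. unfold Rpower.
        rewrite ln_div by lra.
        replace (3 * (a (S n) * exp (logratio a b (S n))) * exp (s * (ln 2 - ln (a (S n)))))
          with (exp (ln 3 + ln (a (S n)) + logratio a b (S n) + s * (ln 2 - ln (a (S n))))).
        2: { rewrite !exp_plus, !exp_ln by lra. ring. }
        rewrite <- (exp_ln (/ 2)) by lra. rewrite ln_Rinv by lra.
        assert (Hl6 : ln 6 = ln 2 + ln 3) by (rewrite <- ln_mult by lra; f_equal; lra).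
        assert (Hx : ln 3 + ln (a (S n)) + logratio a b (S n) + s * (ln 2 - ln (a (S n))) <= - ln
            2) by lra.
        destruct Hx as [Hx | ->]; [left; apply exp_increasing; auto | lra]. }
      eapply finite_cover_mono; [apply (finite_cover_strip_step lam a b n s (8 * (/ 2) ^ m) (w *
          (/ 2) ^ m) eta) | | | auto].
      + lra.
      + lra.
      + intros eta'. apply IH. lia.
      + assert (0 < (/ 2) ^ m) by (apply pow_lt; lra). simpl.
        apply Rle_trans with (1 / 2 * (8 * (/ 2) ^ m)); [apply Rmult_le_compat_r; lra | lra].
      + assert (0 < (/ 2) ^ m) by (apply pow_lt; lra). simpl.
        assert (Hw : 0 <= w).
        { unfold w. pose proof (Rpower_pos 8 s).
          assert (0 < / (s - 1)) by (apply Rinv_0_lt_compat; lra). nra. }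
        apply Rle_trans with (/ 2 * (w * (/ 2) ^ m)); [| lra].
        replace (3 * b (S n) * (Rpower (2 / a (S n)) s * (w * (/ 2) ^ m)))
          with (3 * b (S n) * Rpower (2 / a (S n)) s * (w * (/ 2) ^ m)) by ring.
        apply Rmult_le_compat_r; [nra | lra]. }
  intros n eta Hn e He.
  assert (Hw : 0 <= w).
  { unfold w. pose proof (Rpower_pos 8 s).
    assert (0 < / (s - 1)) by (apply Rinv_0_lt_compat; lra). nra. }
  destruct (half_pow_small (e / (8 + w))) as [m Hm]; [apply Rdiv_lt_0_compat; lra |].
  assert (0 < (/ 2) ^ m) by (apply pow_lt; lra).
  assert (Hm' : (8 + w) * (/ 2) ^ m < e).
  { apply Rmult_lt_reg_l with (/ (8 + w)); [apply Rinv_0_lt_compat; lra |].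
    rewrite <- Rmult_assoc, Rinv_l by lra. unfold Rdiv in Hm. lra. }
  eapply finite_cover_mono; [apply (G m n eta Hn) | nra | nra | auto].
Qed.

Lemma tame_growth_pos Delta lam a b c :
  tame Delta lam a b -> eventually (fun n => c <= ln (prod1 a n) /\ 0 < ln (prod1 a n)).
Proof.
  intros HT. destruct (tame_growth _ _ _ _ HT 1) as [N HN].
  destruct (exists_INR_gt c) as [m [Hm _]].
  exists (S (N + m)). intros n Hn. specialize (HN n ltac:(lia)).
  assert (INR m <= INR n) by (apply le_INR; lia).
  assert (0 < INR n) by (apply lt_0_INR; lia). lra.
Qed.

(** Above, [ln Delta_k <= Delta_k <= eps / 2 * ln a_k] for large [k]; below, the product is at least
    [Delta^n], and [n] is negligible against [ln (a_1 ... a_n)]. This isolates [Delta_{n+1}] in the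
    quotient of the theorem. *)
Lemma tame_prod_logratio_negligible Delta lam a b eps :
  tame Delta lam a b -> 0 < eps ->
  eventually (fun n => Rabs (ln (prod1 (logratio a b) n)) <= eps * ln (prod1 a n)).
Proof.
  intros HT Heps.
  assert (HDp := tame_logratio_pos _ _ _ _ HT). assert (HD := tame_Delta _ _ _ _ HT).
  destruct (tame_small _ _ _ _ HT (eps / 2) ltac:(lra)) as [N HN].
  set (W := fun n => ln (prod1 (logratio a b) n)). set (L := fun n => ln (prod1 a n)).
  assert (HW : forall n, W (S n) = W n + ln (logratio a b (S n))) by (intros; apply ln_prod1_S;
      auto).
  assert (HL : forall n, L (S n) = L n + ln (a (S n))).
  { intros; apply ln_prod1_S. apply (tame_pos _ _ _ _ HT). }
  assert (Hlow : forall n, INR n * ln Delta <= W n).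
  { induction n as [| n IH]; [unfold W; simpl; rewrite ln_1; lra |].
    rewrite HW, S_INR. pose proof (tame_logratio _ _ _ _ HT (S n) ltac:(lia)).
    pose proof (ln_le Delta (logratio a b (S n)) HD ltac:(lra)). lra. }
  assert (Hup : forall m, W (N + m)%nat - eps / 2 * L (N + m)%nat <= W N - eps / 2 * L N).
  { induction m as [| m IH]; [rewrite Nat.add_0_r; lra |].
    rewrite Nat.add_succ_r, HW, HL. specialize (HN (S (N + m)) ltac:(lia)).
    pose proof (HDp (S (N + m)) ltac:(lia)) as Hp.
    pose proof (exp_ineq1_le (ln (logratio a b (S (N + m))))) as H1. rewrite exp_ln in H1 by auto.
        lra. }
  destruct (tame_growth _ _ _ _ HT (Rabs (ln Delta) / eps)) as [N1 HN1].
  destruct (tame_growth_pos _ _ _ _ ((W N - eps / 2 * L N) * 2 / eps) HT) as [N2 HN2].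
  exists (N + N1 + N2)%nat. intros n Hn.
  specialize (HN1 n ltac:(lia)). specialize (HN2 n ltac:(lia)).
  specialize (Hlow n). specialize (Hup (n - N)%nat). replace (N + (n - N))%nat with n in Hup by lia.
  fold (W n). fold (L n) in *.
  apply (Rmult_le_compat_l eps) in HN1; [| lra].
  replace (eps * (Rabs (ln Delta) / eps * INR n)) with (INR n * Rabs (ln Delta)) in HN1 by (field;
      lra).
  destruct HN2 as [HN2 _]. apply (Rmult_le_compat_l (eps / 2)) in HN2; [| lra].
  replace (eps / 2 * ((W N - eps / 2 * L N) * 2 / eps)) with (W N - eps / 2 * L N) in HN2 by
      (field; lra).
  pose proof (pos_INR n). pose proof (Rle_abs (- ln Delta)) as HA. rewrite Rabs_Ropp in HA.
  apply Rabs_le. split; [nra | lra].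
Qed.

Definition logratio_quotient (a b : nat -> R) (n : nat) : R :=
  ln (prod1 (fun k => ln (b k / a k)) (S n)) / ln (prod1 a n).

Lemma logratio_quotient_eq Delta lam a b n :
  tame Delta lam a b -> 0 < ln (prod1 a n) ->
  ln (prod1 (logratio a b) n) + ln (logratio a b (S n)) = logratio_quotient a b n * ln (prod1 a n).
Proof.
  intros HT HL. unfold logratio_quotient. change (fun k => ln (b k / a k)) with (logratio a b).
  rewrite ln_prod1_S by (apply (tame_logratio_pos _ _ _ _ HT)). field. lra.
Qed.

(** The gap between [y] and [x] is what later absorbs the negligible product of the earlier
    [Delta_k]. *)
Lemma LimSup_lt_eventually (u : nat -> R) (x : R) :
  Rbar_lt (LimSup_seq u) x -> exists y, y < x /\ eventually (fun n => u n <= y).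
Proof.
  intros H. unfold LimSup_seq in H. destruct (ex_LimSup_seq u) as [l Hl]. simpl in H.
  destruct l as [l | |]; simpl in *; try contradiction.
  - exists ((l + x) / 2). split; [lra |].
    destruct (Hl (mkposreal ((x - l) / 2) ltac:(lra))) as [_ [N HN]]. exists N. intros n Hn.
    specialize (HN n Hn). simpl in HN. lra.
  - exists (x - 1). split; [lra |]. destruct (Hl (x - 1)) as [N HN]. exists N. intros n Hn. left.
      auto.
Qed.

Lemma LimSup_gt_frequently (u : nat -> R) (x : R) :
  Rbar_lt x (LimSup_seq u) -> exists y, x < y /\ forall N, exists n, (N <= n)%nat /\ y <= u n.
Proof.
  intros H. unfold LimSup_seq in H. destruct (ex_LimSup_seq u) as [l Hl]. simpl in H.
  destruct l as [l | |]; simpl in *; try contradiction.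
  - exists ((l + x) / 2). split; [lra |]. intros N.
    destruct (Hl (mkposreal ((l - x) / 2) ltac:(lra))) as [H1 _].
    destruct (H1 N) as [n [Hn Hn']]. exists n. split; auto. simpl in Hn'. lra.
  - exists (x + 1). split; [lra |]. intros N. destruct (Hl (x + 1) N) as [n [Hn Hn']].
    exists n. split; auto. lra.
Qed.

Lemma tame_logratio_le Delta lam a b (x : R) :
  tame Delta lam a b -> Rbar_lt (LimSup_seq (logratio_quotient a b)) x ->
  eventually (fun n => ln (logratio a b (S n)) <= x * ln (prod1 a n)).
Proof.
  intros HT Hx. destruct (LimSup_lt_eventually _ _ Hx) as [y [Hy [N HN]]].
  destruct (tame_prod_logratio_negligible _ _ _ _ (x - y) HT ltac:(lra)) as [N1 HN1].
  destruct (tame_growth_pos _ _ _ _ 0 HT) as [N2 HN2].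
  exists (N + N1 + N2)%nat. intros n Hn.
  specialize (HN n ltac:(lia)). specialize (HN1 n ltac:(lia)). destruct (HN2 n ltac:(lia)) as [_
      H0].
  apply Rabs_le_between in HN1. pose proof (logratio_quotient_eq _ _ _ _ n HT H0) as HE. nra.
Qed.

Lemma tame_logratio_ge Delta lam a b (x : R) :
  tame Delta lam a b -> Rbar_lt x (LimSup_seq (logratio_quotient a b)) ->
  forall N, exists n, (N <= n)%nat /\ x * ln (prod1 a n) <= ln (logratio a b (S n)).
Proof.
  intros HT Hx N. destruct (LimSup_gt_frequently _ _ Hx) as [y [Hy HN]].
  destruct (tame_prod_logratio_negligible _ _ _ _ (y - x) HT ltac:(lra)) as [N1 HN1].
  destruct (tame_growth_pos _ _ _ _ 0 HT) as [N2 HN2].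
  destruct (HN (N + N1 + N2)%nat) as [n [Hn Hn']]. exists n. split; [lia |].
  specialize (HN1 n ltac:(lia)). destruct (HN2 n ltac:(lia)) as [_ H0].
  apply Rabs_le_between in HN1. pose proof (logratio_quotient_eq _ _ _ _ n HT H0) as HE. nra.
Qed.

(** [Delta_{n+1}] stays above [Delta] while [ln (a_1 ... a_n)] tends to infinity. This keeps every
    exponent [sg] of the packing bound above 1. *)
Lemma tame_limsup_nonneg Delta lam a b :
  tame Delta lam a b -> Rbar_le 0 (LimSup_seq (logratio_quotient a b)).
Proof.
  intros HT. apply Rbar_not_lt_le. intros Hlt.
  assert (Hx : exists x, x < 0 /\ Rbar_lt (LimSup_seq (logratio_quotient a b)) x).
  { destruct (LimSup_lt_eventually _ _ Hlt) as [y [Hy Hev]].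
    exists (y / 2). split; [lra |].
    apply Rbar_le_lt_trans with y; [| simpl; lra].
    rewrite <- (LimSup_seq_const y). apply LimSup_le. exact Hev. }
  destruct Hx as [x [Hx Hlx]].
  destruct (tame_logratio_le _ _ _ _ _ HT Hlx) as [N HN].
  destruct (tame_growth_pos _ _ _ _ ((- ln Delta + 1) / - x) HT) as [N1 HN1].
  specialize (HN (N + N1)%nat ltac:(lia)). destruct (HN1 (N + N1)%nat ltac:(lia)) as [H1 _].
  pose proof (tame_logratio _ _ _ _ HT (S (N + N1)) ltac:(lia)).
  pose proof (ln_le Delta (logratio a b (S (N + N1))) (tame_Delta _ _ _ _ HT) ltac:(lra)).
  apply (Rmult_le_compat_l (- x)) in H1; [| lra].
  replace (- x * ((- ln Delta + 1) / - x)) with (- ln Delta + 1) in H1 by (field; lra).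
  lra.
Qed.

Lemma exp_le_mono x y : x <= y -> exp x <= exp y.
Proof. intros [H | ->]; [left; apply exp_increasing; auto | lra]. Qed.

Lemma Rpower_le_exp_small r x y : 0 < r <= 1 -> x <= y -> Rpower r y <= Rpower r x.
Proof.
  intros Hr Hxy. apply exp_le_mono.
  assert (ln r <= 0) by (rewrite <- ln_1; apply ln_le; lra). nra.
Qed.

(** The critical term is [D1 D2 / (a r^2)]. For [sg >= 2] it suffices that [D2 <= a]. For [sg < 2],
    [r^(sg-2)] is largest at [r = 2 / a], and what remains, [D1 a (2 / a)^sg D2], is bounded by the
    step inequality since [D1 <= exp D1]. The constants are [125 = 25 (4 + 1)], and [1 + 1 / Delta]
    turns [D1 + 1] into a multiple of [D1]. *)
Lemma box_count_base_arith (sg a D1 D2 P1 P2 r Delta : R) :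
  1 < sg -> 4 <= a -> 0 < Delta <= D1 -> 0 < D2 <= a -> D1 <= P1 -> D2 <= P2 ->
  3 * (a * exp D1) * (Rpower (2 / a) sg * P2) <= P1 -> 2 / a <= r <= 1 ->
  (D1 + 1) * ((4 * D2 / (a * r) + 1) * (25 / r)) <=
    125 * (1 + / Delta) * P1 * Rpower r (- sg).
Proof.
  intros Hs Ha HD1 HD2 HP1 HP2 Hstep Hr.
  assert (H2a : 0 < 2 / a) by (apply Rdiv_lt_0_compat; lra).
  assert (HiD : 0 < / Delta) by (apply Rinv_0_lt_compat; lra).
  assert (Hir : 1 <= / r) by (rewrite <- Rinv_1; apply Rinv_le_contravar; lra).
  assert (H1 : D1 + 1 <= (1 + / Delta) * D1).
  { assert (1 <= / Delta * D1).
    { rewrite <- (Rinv_l Delta) by lra. apply Rmult_le_compat_l; lra. }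
    lra. }
  assert (Hr1 : / r <= Rpower r (- sg)).
  { replace (/ r) with (Rpower r (- (1))) by (rewrite Rpower_Ropp, Rpower_1; lra).
    apply Rpower_le_exp_small; lra. }
  assert (HA : D1 * (4 * D2 / (a * r)) * / r <= 4 * P1 * Rpower r (- sg)).
  { destruct (Rle_dec 2 sg) as [H2 | H2].
    - assert (Hr2 : / r * / r <= Rpower r (- sg)).
      { replace (/ r * / r) with (Rpower r (- (2))).
        - apply Rpower_le_exp_small; lra.
        - rewrite Rpower_Ropp. replace 2 with (1 + 1) by ring.
          rewrite Rpower_plus, Rpower_1, Rinv_mult by lra. reflexivity. }
      replace (D1 * (4 * D2 / (a * r)) * / r) with (4 * (D1 * (D2 / a)) * (/ r * / r)) by (field;
          lra).
      assert (D2 / a <= 1).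
      { apply Rmult_le_reg_r with a; [lra |]. unfold Rdiv. rewrite Rmult_assoc, Rinv_l by lra.
          lra. }
      assert (0 < D2 / a) by (apply Rdiv_lt_0_compat; lra).
      apply Rmult_le_compat; nra.
    - assert (Hrs : / r * / r <= Rpower r (- sg) * (Rpower (2 / a) sg * (a * a / 4))).
      { replace (/ r * / r) with (Rpower r (- sg) * Rpower r (sg - 2)).
        2: { rewrite <- Rpower_plus. replace (- sg + (sg - 2)) with (- (1 + 1)) by ring.
             rewrite Rpower_Ropp, Rpower_plus, Rpower_1, Rinv_mult by lra. reflexivity. }
        apply Rmult_le_compat_l; [left; apply Rpower_pos |].
        replace (Rpower (2 / a) sg * (a * a / 4)) with (Rpower (2 / a) (sg - 2)).
        - replace (sg - 2) with (- (2 - sg)) by ring. rewrite !Rpower_Ropp.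
          apply Rinv_le_contravar; [apply Rpower_pos | apply Rpower_le_l; lra].
        - unfold Rminus at 1. rewrite Rpower_plus. f_equal.
          replace (- (2)) with (- (1 + 1)) by ring.
          rewrite Rpower_Ropp, Rpower_plus, Rpower_1 by lra. field. lra. }
      replace (D1 * (4 * D2 / (a * r)) * / r) with (4 * (D1 * (D2 / a)) * (/ r * / r)) by (field;
          lra).
      assert (0 < D2 / a) by (apply Rdiv_lt_0_compat; lra).
      apply Rle_trans with (4 * (D1 * (D2 / a)) * (Rpower r (- sg) * (Rpower (2 / a) sg * (a * a /
          4)))).
      { apply Rmult_le_compat_l; [| auto]. assert (0 < D1 * (D2 / a)) by (apply Rmult_lt_0_compat;
          lra). lra. }
      replace (4 * (D1 * (D2 / a)) * (Rpower r (- sg) * (Rpower (2 / a) sg * (a * a / 4))))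
        with ((D1 * a) * (Rpower (2 / a) sg * D2) * Rpower r (- sg)) by (field; lra).
      apply Rmult_le_compat_r; [left; apply Rpower_pos |].
      pose proof (exp_ineq1_le D1). pose proof (Rpower_pos (2 / a) sg) as Hp.
      assert (Rpower (2 / a) sg * D2 <= Rpower (2 / a) sg * P2) by (apply Rmult_le_compat_l; lra).
      assert (0 < Rpower (2 / a) sg * D2) by (apply Rmult_lt_0_compat; lra).
      apply Rle_trans with ((a * exp D1) * (Rpower (2 / a) sg * P2)); [| nra].
      apply Rmult_le_compat; nra. }
  pose proof (Rpower_pos r (- sg)) as Hp.
  assert (H4 : 0 < 4 * D2 / (a * r)) by (apply Rdiv_lt_0_compat; nra).
  apply Rle_trans with ((1 + / Delta) * D1 * ((4 * D2 / (a * r) + 1) * (25 / r))).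
  { apply Rmult_le_compat_r; [| lra]. unfold Rdiv at 2. apply Rmult_le_pos; nra. }
  replace ((1 + / Delta) * D1 * ((4 * D2 / (a * r) + 1) * (25 / r)))
    with ((1 + / Delta) * (25 * (D1 * (4 * D2 / (a * r)) * / r + D1 * / r))) by (field; lra).
  replace (125 * (1 + / Delta) * P1 * Rpower r (- sg)) with
    ((1 + / Delta) * (25 * (4 * P1 * Rpower r (- sg) + P1 * Rpower r (- sg)))) by ring.
  assert (D1 * / r <= P1 * Rpower r (- sg)) by (apply Rmult_le_compat; lra).
  apply Rmult_le_compat_l; lra.
Qed.

(** At level [n] the covering number is bounded by a constant times [Phi n * r^-sg]. Scales
    [r >= 2 / a (S n)] are counted directly; smaller ones are pulled back from level [S n] at scale
    [r * a (S n) / 2], at least [2 r], which is why the induction runs over [k] with [2^-k <= r]. *)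
Lemma tame_box_count Delta lam a b (sg : R) :
  tame Delta lam a b -> Rbar_lt (Rbar_plus 1 (LimSup_seq (logratio_quotient a b))) sg ->
  exists N, forall n eta, (N <= n)%nat -> box_count sg (annuli_strip lam a b n eta).
Proof.
  intros HT Hsg.
  pose proof (tame_limsup_nonneg _ _ _ _ HT) as HD0.
  assert (HDp : exists d', 0 <= d' < sg - 1 /\ Rbar_lt (LimSup_seq (logratio_quotient a b)) d').
  { destruct (LimSup_seq (logratio_quotient a b)) as [d | |]; simpl in *; try contradiction.
    exists ((sg - 1 + d) / 2). lra. }
  destruct HDp as [d [Hd Hd']].
  destruct (tame_logratio_le _ _ _ _ _ HT Hd') as [N0 HN0].
  set (e := sg - 1 - d). assert (He : 0 < e) by (unfold e; lra).
  (* One level gains [a^-e]: half of [e] absorbs [Delta_n], the other half the constant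
     [3 * 2^sg]. *)
  destruct (tame_a _ _ _ _ HT (Rmax 4 (exp (2 * (ln 3 + sg * ln 2) / e)))) as [N1 HN1].
  destruct (tame_small _ _ _ _ HT (e / 2) ltac:(lra)) as [N2 HN2].
  destruct (tame_width _ _ _ _ HT 1 ltac:(lra)) as [N3 HN3].
  set (N := (N0 + N1 + N2 + N3)%nat). exists N.
  (* [Phi n = (a_1 ... a_n)^d] dominates [Delta_{n+1}] since [d] exceeds the limsup, and one level
     of its growth is beaten by [b (2 / a)^sg] since [1 + d < sg]. *)
  set (Phi := fun n => exp (d * ln (prod1 a n))).
  assert (HPhi : forall n, (N <= n)%nat -> logratio a b (S n) <= Phi n).
  { intros n Hn. unfold Phi. rewrite <- (exp_ln (logratio a b (S n))).
    - apply exp_le_mono. apply HN0. unfold N in Hn. lia.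
    - apply (tame_logratio_pos _ _ _ _ HT). lia. }
  assert (Ha4 : forall n, (N <= n)%nat -> 4 <= a n).
  { intros n Hn. specialize (HN1 n ltac:(unfold N in Hn; lia)).
    pose proof (Rmax_l 4 (exp (2 * (ln 3 + sg * ln 2) / e))). lra. }
  assert (Hstep : forall n, (N <= n)%nat ->
     3 * b (S n) * (Rpower (2 / a (S n)) sg * Phi (S n)) <= Phi n).
  { intros n Hn. unfold N in Hn. pose proof (Ha4 (S n) ltac:(unfold N; lia)) as H4.
    specialize (HN1 (S n) ltac:(lia)). specialize (HN2 (S n) ltac:(lia)).
    pose proof (Rmax_r 4 (exp (2 * (ln 3 + sg * ln 2) / e))) as Hr.
    assert (Hln : 2 * (ln 3 + sg * ln 2) / e <= ln (a (S n))) by (apply le_ln_of_exp_le; lra).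
    assert (Hln' : ln 3 + sg * ln 2 <= e / 2 * ln (a (S n))).
    { replace (ln 3 + sg * ln 2) with (e / 2 * (2 * (ln 3 + sg * ln 2) / e)) by (field; lra).
      apply Rmult_le_compat_l; lra. }
    rewrite (tame_b_eq _ _ _ _ _ HT) by lia. unfold Phi.
    rewrite ln_prod1_S by (apply (tame_pos _ _ _ _ HT)).
    unfold Rpower. rewrite ln_div by lra.
    replace (3 * (a (S n) * exp (logratio a b (S n))) * (exp (sg * (ln 2 - ln (a (S n)))) *
      exp (d * (ln (prod1 a n) + ln (a (S n)))))) with
      (exp (ln 3 + ln (a (S n)) + logratio a b (S n) + sg * (ln 2 - ln (a (S n))) +
         d * (ln (prod1 a n) + ln (a (S n))))).
    2: { rewrite !exp_plus, !exp_ln by lra. ring. }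
    apply exp_le_mono. unfold e in *. nra. }
  assert (Hbase : forall n r eta, (N <= n)%nat -> 2 / a (S n) <= r <= 1 ->
     finite_cover 0 r (125 * (1 + / Delta) * Phi n * Rpower r (- sg)) (annuli_strip lam a b n eta)).
  { intros n r eta Hn Hr. pose proof (Ha4 (S n) ltac:(lia)) as H4.
    assert (H2a : 0 < 2 / a (S n)) by (apply Rdiv_lt_0_compat; lra).
    eapply finite_cover_mono; [apply (finite_cover_strip_count lam a b n eta r) | lra | | auto].
    - apply (tame_lam _ _ _ _ HT); lia.
    - apply (tame_lam _ _ _ _ HT); lia.
    - lra.
    - apply (tame_pos _ _ _ _ HT); lia.
    - apply (tame_logratio_pos _ _ _ _ HT); lia.
    - apply (tame_logratio_pos _ _ _ _ HT); lia.
    - lra.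
    - apply box_count_base_arith with (P2 := Phi (S n)); auto.
      + lra.
      + split; [apply (tame_Delta _ _ _ _ HT) | left; apply (tame_logratio _ _ _ _ HT); lia].
      + split; [apply (tame_logratio_pos _ _ _ _ HT); lia |].
        specialize (HN3 (S n) ltac:(unfold N in Hn; lia)). lra.
      + rewrite <- (tame_b_eq _ _ _ _ _ HT) by lia. auto. }
  assert (G : forall k n r eta, (N <= n)%nat -> (/ 2) ^ k <= r <= 1 ->
     finite_cover 0 r (125 * (1 + / Delta) * Phi n * Rpower r (- sg)) (annuli_strip lam a b n eta)).
  { induction k as [| k IH]; intros n r eta Hn Hr;
      pose proof (Ha4 (S n) ltac:(lia)) as H4;
      assert (H2a : 0 < 2 / a (S n) <= 1 / 2) by (split; [apply Rdiv_lt_0_compat; lra |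
        apply Rmult_le_reg_r with (a (S n)); [lra | unfold Rdiv; rewrite Rmult_assoc, Rinv_l;
            lra]]).
    - apply Hbase; auto. simpl in Hr. lra.
    - destruct (Rle_dec (2 / a (S n)) r) as [H2 | H2]; [apply Hbase; auto; lra |].
      assert (Hr0 : 0 < r) by (eapply Rlt_le_trans; [| apply Hr]; apply pow_lt; lra).
      set (r' := r * (a (S n) / 2)).
      assert (Hr' : (/ 2) ^ k <= r' <= 1).
      { unfold r'. simpl in Hr. split; [nra |].
        replace 1 with (2 / a (S n) * (a (S n) / 2)) by (field; lra).
        apply Rmult_le_compat_r; lra. }
      assert (Hrr : 2 / a (S n) * r' = r) by (unfold r'; field; lra).
      assert (Hab := tame_ab _ _ _ _ HT (S n) ltac:(lia)).
      eapply finite_cover_mono; [apply (finite_cover_strip_step lam a b n 0 r' (125 * (1 + /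
          Delta) * Phi (S n) * Rpower r' (- sg)) eta) | lra | | auto].
      + lra.
      + lra.
      + intros eta'. apply IH; [lia | auto].
      + rewrite Rpower_O, Rmult_1_l by lra.
        assert (HR : Rpower r' (- sg) = Rpower r (- sg) * Rpower (2 / a (S n)) sg).
        { unfold r'. rewrite <- Rpower_mult_distr by lra. f_equal.
          replace (a (S n) / 2) with (/ (2 / a (S n))) by (field; lra).
          unfold Rpower. rewrite ln_Rinv by lra. f_equal. ring. }
        rewrite HR. specialize (Hstep n Hn).
        assert (HiD : 0 < / Delta) by (apply Rinv_0_lt_compat; apply (tame_Delta _ _ _ _ HT)).
        replace (3 * b (S n) * (125 * (1 + / Delta) * Phi (S n) * (Rpower r (- sg) * Rpower (2 / a
            (S n)) sg)))
          with (125 * (1 + / Delta) * (3 * b (S n) * (Rpower (2 / a (S n)) sg * Phi (S n))) *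
              Rpower r (- sg)) by ring.
        apply Rmult_le_compat_r; [left; apply Rpower_pos |].
        apply Rmult_le_compat_l; lra. }
  intros n eta Hn. exists (125 * (1 + / Delta) * Phi n). intros r Hr.
  destruct (half_pow_small r) as [k Hk]; [lra |].
  apply (G k); auto. lra.
Qed.

Lemma tame_dimH_le Delta lam a b : tame Delta lam a b -> Rbar_le (dimH (Iab lam a b)) 1.
Proof.
  intros HT.
  assert (H : forall s, 1 < s -> Rbar_le (dimH (Iab lam a b)) s).
  { intros s Hs. apply Rbar_glb_le. exists s. split; [auto | split; [lra |]].
    destruct (tame_finite_cover_null _ _ _ _ _ HT Hs) as [N HN].
    apply hausdorff_null; [lra |]. apply (countable_union_of_Iab _ _ _ _ N); auto.
    - apply finite_cover_null_lip.
    - apply (tame_lam _ _ _ _ HT). }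
  destruct (dimH (Iab lam a b)) as [d | |]; simpl in *; auto.
  - apply Rnot_lt_le. intros Hd. specialize (H ((1 + d) / 2) ltac:(lra)). lra.
  - apply (H 2). lra.
Qed.

Lemma tame_dimP_le Delta lam a b :
  tame Delta lam a b ->
  Rbar_le (dimP (Iab lam a b)) (Rbar_plus 1 (LimSup_seq (logratio_quotient a b))).
Proof.
  intros HT. pose proof (tame_limsup_nonneg _ _ _ _ HT) as H0.
  assert (H : forall s : R, Rbar_lt (Rbar_plus 1 (LimSup_seq (logratio_quotient a b))) s ->
    Rbar_le (dimP (Iab lam a b)) s).
  { intros s Hs.
    assert (Hm : exists sg : R, 0 < sg < s /\ Rbar_lt (Rbar_plus 1 (LimSup_seq (logratio_quotient
        a b))) sg).
    { destruct (LimSup_seq (logratio_quotient a b)) as [d | |]; simpl in *; try contradiction.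
      exists ((s + (1 + d)) / 2). lra. }
    destruct Hm as [sg [Hsg Hlt]].
    apply Rbar_glb_le. exists s. split; [auto | split; [lra |]].
    destruct (tame_box_count _ _ _ _ _ HT Hlt) as [N HN].
    apply packing_null with sg; [lra |]. apply (countable_union_of_Iab _ _ _ _ N); auto.
    - apply box_count_lip.
    - apply (tame_lam _ _ _ _ HT). }
  destruct (LimSup_seq (logratio_quotient a b)) as [d | |]; simpl in *; try contradiction.
  - destruct (dimP (Iab lam a b)) as [p | |]; simpl in *; auto.
    + apply Rnot_lt_le. intros Hd. specialize (H ((1 + d + p) / 2) ltac:(lra)). lra.
    + apply (H (2 + d)). lra.
  - destruct (dimP (Iab lam a b)); simpl; auto.
Qed.

(** * Lower bounds from parametrisations *)

Lemma lsum_seq_mono (f : nat -> R) n m :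
  (forall i, 0 <= f i) -> (n <= m)%nat -> lsum f (seq 0 n) <= lsum f (seq 0 m).
Proof.
  intros Hf Hnm. apply lsum_incl; auto.
  - apply seq_NoDup.
  - intros i Hi. apply in_seq in Hi. apply in_seq. lia.
Qed.

Lemma lsum_seq_ge (f : nat -> R) i n :
  (forall i, 0 <= f i) -> (i < n)%nat -> f i <= lsum f (seq 0 n).
Proof.
  intros Hf Hi. replace (f i) with (lsum f (i :: nil)) by (simpl; ring).
  apply lsum_incl; auto.
  - constructor; [intros [] | constructor].
  - intros j [<- | []]. apply in_seq. lia.
Qed.

(** Heine-Borel and subadditivity of length in one supremum argument: near each point some [phi i]
    grows at least as fast as the identity, so the supremum of the points reached by finitely many
    increments is attained and cannot lie below [c]. *)
Lemma growth_cover (phi : nat -> R -> R) (c : R) :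
  0 < c -> (forall i x y, x <= y -> phi i x <= phi i y) ->
  (forall x, 0 <= x <= c -> exists i eta, 0 < eta /\
     forall y y', x - eta < y -> y <= y' -> y' < x + eta -> y' - y <= phi i y' - phi i y) ->
  exists n, c <= lsum (fun i => phi i c - phi i 0) (seq 0 n).
Proof.
  intros Hc Hmon Hloc.
  pose (P := fun x => 0 <= x <= c /\ exists n, x <= lsum (fun i => phi i x - phi i 0) (seq 0 n)).
  destruct (completeness P) as [m [Hm1 Hm2]].
  - exists c. intros x [Hx _]. lra.
  - exists 0. split; [lra |]. exists 0%nat. simpl. lra.
  - assert (Hm : 0 <= m <= c).
    { split.
      - apply Hm1. split; [lra |]. exists 0%nat. simpl. lra.
      - apply Hm2. intros x [Hx _]. lra. }
    destruct (Hloc m Hm) as [i [eta [Heta Hi]]].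
    assert (Hx : exists x, P x /\ m - eta < x <= m).
    { apply NNPP. intros Hn. assert (m <= m - eta); [| lra].
      apply Hm2. intros x Hx. apply Rnot_lt_le. intros Hlt. apply Hn. exists x.
      split; [exact Hx | split; [exact Hlt | apply Hm1; exact Hx]]. }
    destruct Hx as [x [[Hxc [n Hn]] Hxm]].
    set (y := Rmin c (m + eta / 2)).
    assert (Hy : y <= c /\ y <= m + eta / 2) by (split; [apply Rmin_l | apply Rmin_r]).
    assert (Hxy : x <= y) by (unfold y; apply Rmin_glb; lra).
    assert (HPy : P y).
    { split; [lra |]. exists (n + S i)%nat.
      assert (H1 : lsum (fun j => phi j x - phi j 0) (seq 0 n) <=
                   lsum (fun j => phi j x - phi j 0) (seq 0 (n + S i))).
      { apply lsum_seq_mono; [| lia]. intros j. pose proof (Hmon j 0 x ltac:(lra)). lra. }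
      assert (H2 : phi i y - phi i x <= lsum (fun j => phi j y - phi j x) (seq 0 (n + S i))).
      { apply (lsum_seq_ge (fun j => phi j y - phi j x)); [| lia].
        intros j. pose proof (Hmon j x y Hxy). lra. }
      pose proof (Hi x y ltac:(lra) Hxy ltac:(lra)) as H3.
      rewrite (lsum_ext (fun j => phi j y - phi j 0)
        (fun j => (phi j y - phi j x) + (phi j x - phi j 0))) by (intros; ring).
      rewrite lsum_plus. lra. }
    assert (Hyc : y = c).
    { pose proof (Hm1 y HPy) as Hym. unfold y, Rmin in *. destruct (Rle_dec c (m + eta / 2)); lra. }
    rewrite Hyc in HPy. apply HPy.
Qed.

(** For [h > 0], the length of the part of [[p - h, p + h]] to the left of [x]. *)
Definition clamp (p h x : R) : R := Rmax 0 (Rmin (x - (p - h)) (2 * h)).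

Lemma clamp_mono p h x y : x <= y -> clamp p h x <= clamp p h y.
Proof.
  intros H. unfold clamp. apply Rle_max_compat_l. apply Rle_min_compat_r. lra.
Qed.

Lemma clamp_range p h x : 0 < h -> 0 <= clamp p h x <= 2 * h.
Proof.
  intros H. unfold clamp. split; [apply Rmax_l |].
  apply Rmax_lub; [lra |]. apply Rmin_r.
Qed.

Lemma clamp_inside p h x : p - h <= x <= p + h -> clamp p h x = x - (p - h).
Proof.
  intros H. unfold clamp. rewrite Rmin_left by lra. apply Rmax_right. lra.
Qed.

(** Countable subadditivity of length in a finite form; [phi i x] is the total length to the left of
    [x] of the intervals in the [i]-th list. *)
Lemma cover_length (L : nat -> list (R * R)) (c : R) :
  0 < c -> (forall i p, In p (L i) -> 0 < snd p) ->
  (forall x, 0 <= x <= c -> exists i p, In p (L i) /\ Rabs (x - fst p) < snd p) ->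
  exists n, c <= lsum (fun i => lsum (fun p => 2 * snd p) (L i)) (seq 0 n).
Proof.
  intros Hc Hpos Hcov.
  pose (phi := fun i x => lsum (fun p => clamp (fst p) (snd p) x) (L i)).
  destruct (growth_cover phi c Hc) as [n Hn].
  - intros i x y Hxy. apply lsum_le. intros; apply clamp_mono; auto.
  - intros x Hx. destruct (Hcov x Hx) as [i [[p h] [Hp Hxp]]]. simpl in Hxp.
    exists i, (h - Rabs (x - p)). split; [lra |].
    intros y y' Hy Hyy' Hy'. destruct (in_split _ _ Hp) as [l1 [l2 Hl]].
    unfold phi. rewrite Hl, !lsum_app, !lsum_cons. simpl fst; simpl snd.
    pose proof (lsum_le (fun q => clamp (fst q) (snd q) y) (fun q => clamp (fst q) (snd q) y') l1
      ltac:(intros; apply clamp_mono; auto)).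
    pose proof (lsum_le (fun q => clamp (fst q) (snd q) y) (fun q => clamp (fst q) (snd q) y') l2
      ltac:(intros; apply clamp_mono; auto)).
    pose proof (Rle_abs (x - p)). pose proof (Rle_abs (- (x - p))) as Ha. rewrite Rabs_Ropp in Ha.
    rewrite !clamp_inside by lra. lra.
  - exists n. apply Rle_trans with (1 := Hn). apply lsum_le. intros i _.
    unfold phi. pose proof (lsum_nonneg (fun p => clamp (fst p) (snd p) 0) (L i)) as H0.
    assert (H1 : lsum (fun p => clamp (fst p) (snd p) c) (L i) <= lsum (fun p => 2 * snd p) (L i)).
    { apply lsum_le. intros p Hp. apply clamp_range. eauto. }
    assert (0 <= lsum (fun p => clamp (fst p) (snd p) 0) (L i)).
    { apply H0. intros p Hp. apply clamp_range. eauto. }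
    lra.
Qed.

Lemma Lim_seq_ge_term (u : nat -> R) n : (forall m, (n <= m)%nat -> u n <= u m) -> Rbar_le (u n)
    (Lim_seq u).
Proof.
  intros H. rewrite <- (Lim_seq_const (u n)). apply Lim_seq_le_loc. exists n. auto.
Qed.

Lemma rpow_mono x y s : 0 < s -> 0 <= x <= y -> rpow x s <= rpow y s.
Proof.
  intros Hs H. unfold rpow. destruct (Req_EM_T x 0), (Req_EM_T y 0); try lra.
  - left. apply Rpower_pos.
  - apply Rpower_le_l; lra.
Qed.

(** A piece [U i] meets the points of parameters in a set of diameter at most [K * diam^s], hence
    within one interval; the interval lengths must add up to at least [c]. *)
Lemma hausdorff_lower (s c K : R) (A : C -> Prop) (x : R -> C) :
  0 < s -> 0 < c -> 0 < K -> (forall t, 0 <= t <= c -> A (x t)) ->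
  (forall t t', 0 <= t <= c -> 0 <= t' <= c ->
     Rabs (t - t') <= K * rpow (Cmod (Cminus (x t) (x t'))) s) ->
  hausdorff_measure s A <> 0.
Proof.
  intros Hs Hc HK HA Hh H0.
  set (v0 := c / (4 * K)). assert (Hv0 : 0 < v0) by (apply Rdiv_lt_0_compat; lra).
  assert (H : Rbar_le v0 (hausdorff_delta s (/ INR 1) A)).
  { apply Rbar_glb_ge. intros v [U [HU [Hcov ->]]].
    apply Rbar_not_lt_le. intros Hlt.
    set (u := fun n => sum_f_R0 (fun i => rpow (diam (U i)) s) n).
    assert (Hu : forall n, u n <= v0).
    { intros n. assert (Hn : Rbar_le (u n) (Lim_seq u)).
      { apply Lim_seq_ge_term. intros m Hm. unfold u. rewrite !sum_f_R0_lsum.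
        apply lsum_seq_mono; [intros; apply rpow_nonneg | lia]. }
      pose proof (Rbar_le_lt_trans _ _ _ Hn Hlt) as Hl. simpl in Hl. lra. }
    (* The summable slack makes the intervals open and nonempty. If the sums stayed below [v0], the
       total length would be at most [2 K v0 + c / 4 = 3 c / 4]. *)
    pose (h := fun i => K * rpow (diam (U i)) s + c / 8 * (/ 2) ^ S i).
    assert (Hh0 : forall i, 0 < h i).
    { intros i. unfold h. pose proof (rpow_nonneg (diam (U i)) s).
      assert (0 < (/ 2) ^ S i) by (apply pow_lt; lra). nra. }
    assert (HL : forall i, exists l : list (R * R),
       (l = nil \/ exists t, l = (t, h i) :: nil) /\
       (forall t, 0 <= t <= c -> U i (x t) -> exists p, In p l /\ Rabs (t - fst p) < snd p)).
    { intros i. destruct (classic (exists t, 0 <= t <= c /\ U i (x t))) as [[t [Ht Htu]] | Hn].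
      - exists ((t, h i) :: nil). split; [eauto |].
        intros t' Ht' Htu'. exists (t, h i). split; [left; auto |]. simpl.
        apply Rle_lt_trans with (1 := Hh t' t Ht' Ht).
        apply Rle_lt_trans with (K * rpow (diam (U i)) s).
        + apply Rmult_le_compat_l; [lra |]. apply rpow_mono; auto. split; [apply Cmod_ge_0 |].
          apply (le_diam _ _ _ _ (HU i)); auto.
        + unfold h. assert (0 < (/ 2) ^ S i) by (apply pow_lt; lra). nra.
      - exists nil. split; auto. intros t Ht Htu. exfalso. eauto. }
    destruct (choice_fun _ HL) as [L HLs].
    destruct (cover_length L c Hc) as [n Hn].
    - intros i p Hp. destruct (HLs i) as [[E | [t E]] _]; rewrite E in Hp; [destruct Hp |].
      destruct Hp as [<- | []]. apply Hh0.
    - intros t Ht. destruct (Hcov (x t) (HA t Ht)) as [i Hi].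
      destruct (HLs i) as [_ H2]. destruct (H2 t Ht Hi) as [p Hp]. exists i, p. auto.
    - assert (Hle : lsum (fun i => lsum (fun p => 2 * snd p) (L i)) (seq 0 n) <=
        lsum (fun i => 2 * K * rpow (diam (U i)) s + c / 4 * (/ 2) ^ S i) (seq 0 n)).
      { apply lsum_le. intros i _. specialize (Hh0 i). unfold h in *.
        destruct (HLs i) as [[E | [t E]] _]; rewrite E; simpl lsum; simpl in *; lra. }
      rewrite lsum_plus, lsum_scal, sum_half in Hle.
      assert (Hs2 : lsum (fun i => rpow (diam (U i)) s) (seq 0 n) <= v0).
      { apply Rle_trans with (2 := Hu n). unfold u. rewrite sum_f_R0_lsum.
        apply lsum_seq_mono; [intros; apply rpow_nonneg | lia]. }
      assert (0 < (/ 2) ^ n) by (apply pow_lt; lra).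
      assert (2 * K * v0 = c / 2) by (unfold v0; field; lra).
      assert (2 * K * lsum (fun i => rpow (diam (U i)) s) (seq 0 n) <= 2 * K * v0)
        by (apply Rmult_le_compat_l; lra).
      nra. }
  pose proof (Sup_seq_ge (fun n => hausdorff_delta s (/ INR (S n)) A) 0) as H1.
  pose proof (Rbar_le_trans _ _ _ H H1) as H2. fold (hausdorff_measure s A) in H2.
  rewrite H0 in H2. simpl in H2. lra.
Qed.

(** Equal balls of radius [r] around the points form a packing; the finite list becomes a sequence
    by adding balls of radius 0. *)
Lemma packing_separated {T : Type} (s del r p : R) (A : C -> Prop) (x : T -> C) (l : list T) :
  0 < r -> 2 * r <= del -> Rbar_le (packing_delta s del A) p ->
  NoDup l -> (forall t, In t l -> A (x t)) ->
  (forall t t', In t l -> In t' l -> t <> t' -> 2 * r < Cmod (Cminus (x t) (x t'))) ->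
  INR (length l) * Rpower (2 * r) s <= p.
Proof.
  intros Hr Hdel Hp Hl HA Hsep.
  destruct l as [| t0 l0] eqn:El.
  { simpl. rewrite Rmult_0_l. pose proof (Rbar_le_trans _ _ _ (packing_delta_nonneg s del A) Hp).
    auto. }
  rewrite <- El in *.
  assert (Hlen : (0 < length l)%nat) by (rewrite El; simpl; lia).
  pose (rr := fun k => if lt_dec k (length l) then r else 0).
  pose (u := fun n => sum_f_R0 (fun i => rpow (2 * rr i) s) n).
  assert (H : Rbar_le (Lim_seq u) p).
  { apply Rbar_le_trans with (2 := Hp). apply Rbar_lub_ge. right.
    exists (fun k => x (nth k l t0)), rr. repeat split.
    - intros k. apply HA. destruct (lt_dec k (length l)) as [Hk | Hk].
      + apply nth_In; auto.
      + rewrite nth_overflow by lia. rewrite El. left. auto.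
    - unfold rr. destruct (lt_dec i (length l)); lra.
    - unfold rr. destruct (lt_dec i (length l)); lra.
    - intros i j Hij Hi Hj y [Hy1 Hy2]. unfold rr in *.
      destruct (lt_dec i (length l)) as [Hil |]; [| lra].
      destruct (lt_dec j (length l)) as [Hjl |]; [| lra].
      assert (Hne : nth i l t0 <> nth j l t0).
      { intros E. apply Hij. apply (proj1 (NoDup_nth l t0) Hl); auto. }
      pose proof (Hsep _ _ (nth_In l t0 Hil) (nth_In l t0 Hjl) Hne) as Hd.
      pose proof (Cmod_minus_triangle (x (nth i l t0)) y (x (nth j l t0))) as Ht.
      rewrite (Cmod_minus_sym _ y) in Ht. lra. }
  assert (Hu : u (length l - 1)%nat = INR (length l) * Rpower (2 * r) s).
  { unfold u. rewrite sum_f_R0_lsum. replace (S (length l - 1)) with (length l) by lia.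
    rewrite (lsum_ext _ (fun _ => Rpower (2 * r) s)).
    - rewrite lsum_const, length_seq. reflexivity.
    - intros i Hi. apply in_seq in Hi. unfold rr. destruct (lt_dec i (length l)); [| lia].
      apply rpow_pos_eq. lra. }
  rewrite <- Hu.
  assert (H2 : Rbar_le (u (length l - 1)%nat) (Lim_seq u)).
  { apply Lim_seq_ge_term. intros m Hm. unfold u. rewrite !sum_f_R0_lsum.
    apply lsum_seq_mono; [intros; apply rpow_nonneg | lia]. }
  exact (Rbar_le_trans _ _ _ H2 H).
Qed.

(** A separated list that is not maximal can be extended, and the packing bound limits its length,
    so the extension must stop. *)
Lemma maximal_separated {T : Type} (s del r p : R) (A : C -> Prop) (x : T -> C) (Q : T -> Prop) :
  0 < r -> 2 * r <= del -> Rbar_le (packing_delta s del A) p ->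
  (forall t, Q t -> A (x t)) ->
  exists l : list T, (forall t, In t l -> Q t) /\ INR (length l) * Rpower (2 * r) s <= p /\
    (forall t, Q t -> exists t', In t' l /\ Cmod (Cminus (x t) (x t')) <= 2 * r).
Proof.
  intros Hr Hdel Hp HQ.
  pose (V := fun l : list T => NoDup l /\ (forall t, In t l -> Q t) /\
    (forall t t', In t l -> In t' l -> t <> t' -> 2 * r < Cmod (Cminus (x t) (x t')))).
  assert (HV : forall l, V l -> INR (length l) * Rpower (2 * r) s <= p).
  { intros l [H1 [H2 H3]]. apply (packing_separated s del r p A x l); auto. }
  apply NNPP. intros Hn.
  assert (Hext : forall l, V l -> exists t, V (t :: l)).
  { intros l Hl. apply NNPP. intros Hne. apply Hn. exists l. split; [apply Hl | split; [auto |]].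
    intros t Ht. apply NNPP. intros Hne'. apply Hne. exists t.
    assert (Hfar : forall t', In t' l -> 2 * r < Cmod (Cminus (x t) (x t'))).
    { intros t' Ht'. apply Rnot_le_lt. intros Hle. apply Hne'. eauto. }
    destruct Hl as [H1 [H2 H3]]. split; [| split].
    - constructor; auto. intros Hin. specialize (Hfar t Hin).
      replace (Cminus (x t) (x t)) with (RtoC 0) in Hfar by ring. rewrite Cmod_0 in Hfar. lra.
    - intros t' [<- | Ht']; auto.
    - intros t1 t2 [<- | Ht1] [<- | Ht2] Hne12; auto.
      + contradiction.
      + rewrite Cmod_minus_sym. auto. }
  assert (Hlong : forall n, exists l, V l /\ length l = n).
  { induction n as [| n [l [Hl Hn']]].
    - exists nil. split; [| auto]. split; [apply NoDup_nil | split; [intros t [] | intros t t' []]].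
    - destruct (Hext l Hl) as [t Ht]. exists (t :: l). split; auto. simpl. auto. }
  destruct (exists_INR_gt (p / Rpower (2 * r) s)) as [n [Hn' _]].
  destruct (Hlong n) as [l [Hl Hlen]]. specialize (HV l Hl). rewrite Hlen in HV.
  pose proof (Rpower_pos (2 * r) s) as Hpos.
  apply (Rmult_lt_compat_r (Rpower (2 * r) s)) in Hn'; auto.
  replace (p / Rpower (2 * r) s * Rpower (2 * r) s) with p in Hn' by (field; lra). lra.
Qed.

Lemma Rbar_psum_ge u n : (forall i, Rbar_le 0 (u i)) -> Rbar_le (u n) (Rbar_psum u n).
Proof.
  intros H. destruct n as [| n]; [apply Rbar_le_refl |]. simpl Rbar_psum.
  pose proof (Rbar_psum_nonneg u n H) as H1. specialize (H (S n)).
  destruct (Rbar_psum u n), (u (S n)); simpl in *; auto; lra.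
Qed.

(** Each piece of a decomposition may be tested at a scale of its own, so good scales need only
    exist arbitrarily far down. At that scale a maximal separated set in the piece yields intervals
    that cover its parameters, of total length at most [4 K] times its premeasure up to a small
    error. *)
Lemma packing_lower (s c K : R) (A : C -> Prop) (x : R -> C) :
  0 < s -> 0 < c -> 0 < K -> (forall t, 0 <= t <= c -> A (x t)) ->
  (forall rho, 0 < rho -> exists r, 0 < r < rho /\
     forall t t', 0 <= t <= c -> 0 <= t' <= c -> Cmod (Cminus (x t) (x t')) <= 2 * r ->
       Rabs (t - t') <= K * Rpower (2 * r) s) ->
  packing_measure s A <> 0.
Proof.
  intros Hs Hc HK HA Hscale H0.
  (* Premeasures and errors each sum to at most [v0], so the total length would be at most
     [4 K (2 v0) = c / 2]. *)
  set (v0 := c / (16 * K)). assert (Hv0 : 0 < v0) by (apply Rdiv_lt_0_compat; lra).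
  assert (H : Rbar_le v0 (packing_measure s A)).
  2: { rewrite H0 in H. simpl in H. lra. }
  apply Rbar_glb_ge. intros v [B [Hcov ->]]. apply Rbar_not_lt_le. intros Hlt.
  set (P := fun i => packing_pre s (B i)) in *.
  assert (HP0 : forall i, Rbar_le 0 (P i)) by (intros; apply packing_pre_nonneg).
  assert (Hpsum : forall n, Rbar_lt (Rbar_psum P n) v0).
  { intros n. apply Rbar_le_lt_trans with (2 := Hlt). apply (Sup_seq_ge (Rbar_psum P)). }
  assert (HPf : forall i, P i = Finite (real (P i))).
  { intros i. pose proof (Rbar_le_lt_trans _ _ _ (Rbar_psum_ge P i HP0) (Hpsum i)) as H1.
    specialize (HP0 i). destruct (P i); simpl in *; auto; contradiction. }
  assert (Hsum : forall n, Rbar_psum P n = Finite (lsum (fun i => real (P i)) (seq 0 (S n)))).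
  { induction n as [| n IH].
    - simpl. rewrite (HPf 0%nat) at 1. f_equal. ring.
    - rewrite seq_S, lsum_app. simpl Rbar_psum. rewrite IH, (HPf (S n)) at 1. simpl. f_equal.
        ring. }
  set (e := fun i => v0 * (/ 2) ^ S i).
  assert (He : forall i, 0 < e i) by (intros; apply Rmult_lt_0_compat; [auto | apply pow_lt; lra]).
  assert (HL : forall i, exists l : list (R * R),
     (forall p, In p l -> 0 < snd p) /\
     lsum (fun p => 2 * snd p) l <= 4 * K * (real (P i) + e i) /\
     (forall t, 0 <= t <= c -> B i (x t) -> exists p, In p l /\ Rabs (t - fst p) < snd p)).
  { intros i.
    assert (Hn : exists n, Rbar_lt (packing_delta s (/ INR (S n)) (B i)) (real (P i) + e i)).
    { apply NNPP. intros Hn.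
      assert (Hge : Rbar_le (real (P i) + e i) (P i)).
      { unfold P at 2, packing_pre. rewrite Inf_eq_glb. apply Rbar_glb_ge. intros y [n ->].
        apply Rbar_not_lt_le. intros Hlt'. apply Hn. exists n. exact Hlt'. }
      rewrite (HPf i) in Hge. simpl in Hge. specialize (He i). lra. }
    destruct Hn as [n Hn].
    assert (Hin : 0 < / INR (S n)) by (apply Rinv_0_lt_compat; apply lt_0_INR; lia).
    destruct (Hscale (/ INR (S n) / 2)) as [r [Hr Hrs]]; [lra |].
    destruct (maximal_separated s (/ INR (S n)) r (real (P i) + e i) (B i) x
      (fun t => 0 <= t <= c /\ B i (x t))) as [l [Hl1 [Hl2 Hl3]]].
    - lra.
    - lra.
    - apply Rbar_lt_le. exact Hn.
    - intros t [_ Ht]. exact Ht.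
    - pose proof (Rpower_pos (2 * r) s) as Hpos.
      assert (HKp : 0 < K * Rpower (2 * r) s) by (apply Rmult_lt_0_compat; lra).
      exists (map (fun t => (t, 2 * (K * Rpower (2 * r) s))) l). split; [| split].
      + intros p Hp. apply in_map_iff in Hp. destruct Hp as [t [<- _]]. simpl. lra.
      + rewrite lsum_map. simpl. rewrite lsum_const.
        replace (INR (length l) * (2 * (2 * (K * Rpower (2 * r) s))))
          with (4 * K * (INR (length l) * Rpower (2 * r) s)) by ring.
        apply Rmult_le_compat_l; lra.
      + intros t Ht HBt. destruct (Hl3 t (conj Ht HBt)) as [t' [Ht' Hd]].
        exists (t', 2 * (K * Rpower (2 * r) s)). split.
        * apply in_map_iff. eauto.
        * simpl. pose proof (Hrs t t' Ht (proj1 (Hl1 t' Ht')) Hd). lra. }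
  destruct (choice_fun _ HL) as [L HLs].
  destruct (cover_length L c Hc) as [n Hn].
  - intros i p Hp. apply (HLs i). exact Hp.
  - intros t Ht. destruct (Hcov (x t) (HA t Ht)) as [i Hi].
    destruct (HLs i) as [_ [_ H2]]. destruct (H2 t Ht Hi) as [p Hp]. exists i, p. exact Hp.
  - assert (Hle : lsum (fun i => lsum (fun p => 2 * snd p) (L i)) (seq 0 n) <=
        lsum (fun i => 4 * K * (real (P i) + e i)) (seq 0 n)).
    { apply lsum_le. intros i _. apply (HLs i). }
    rewrite lsum_scal, lsum_plus in Hle. unfold e in Hle. rewrite sum_half in Hle.
    assert (Hs2 : lsum (fun i => real (P i)) (seq 0 n) <= v0).
    { specialize (Hpsum n). rewrite Hsum in Hpsum. simpl in Hpsum.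
      apply Rle_trans with (lsum (fun i => real (P i)) (seq 0 (S n))); [| left; exact Hpsum].
      apply lsum_seq_mono; [| lia]. intros i. specialize (HP0 i). rewrite HPf in HP0. exact HP0. }
    assert (0 < (/ 2) ^ n) by (apply pow_lt; lra).
    assert (H16 : 16 * K * v0 = c) by (unfold v0; field; lra).
    assert (4 * K * (lsum (fun i => real (P i)) (seq 0 n) + v0 * (1 - (/ 2) ^ n)) <= 4 * K * (2 *
        v0)).
    { apply Rmult_le_compat_l; [lra |]. nra. }
    lra.
Qed.

(** * Inverse branches and backward orbits *)

Lemma angle_in_window (th y : R) :
  exists th', y <= th' <= y + 2 * PI /\ cos th' = cos th /\ sin th' = sin th.
Proof.
  pose proof PI_RGT_0 as Hpi.
  destruct (exists_INR_gt ((y - th) / (2 * PI))) as [k [Hk _]].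
  apply (Rmult_lt_compat_r (2 * PI)) in Hk; [| lra].
  replace ((y - th) / (2 * PI) * (2 * PI)) with (y - th) in Hk by (field; lra).
  set (t1 := th + 2 * INR k * PI).
  destruct (nfloor_ex ((t1 - y) / (2 * PI))) as [j Hj].
  { apply Rmult_le_pos; [unfold t1; lra | left; apply Rinv_0_lt_compat; lra]. }
  assert (Ht : t1 - y = (t1 - y) / (2 * PI) * (2 * PI)) by (field; lra).
  exists (t1 - 2 * INR j * PI). split; [nra |].
  replace (cos th) with (cos t1) by (unfold t1; apply cos_period).
  replace (sin th) with (sin t1) by (unfold t1; apply sin_period).
  split.
  - rewrite <- (cos_period _ j). f_equal. ring.
  - rewrite <- (sin_period _ j). f_equal. ring.
Qed.

Lemma polar_upper (w : C) :
  0 < Cmod w -> 0 <= Im w ->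
  cos (acos (Re w / Cmod w)) = Re w / Cmod w /\ sin (acos (Re w / Cmod w)) = Im w / Cmod w.
Proof.
  intros Hw Hi. set (c := Re w / Cmod w).
  assert (Hc : c * c + (Im w / Cmod w) * (Im w / Cmod w) = 1).
  { unfold c. replace (Re w / Cmod w * (Re w / Cmod w) + Im w / Cmod w * (Im w / Cmod w))
      with ((Re w * Re w + Im w * Im w) / (Cmod w * Cmod w)) by (field; lra).
    rewrite <- Cmod_sq. field. lra. }
  assert (Hs : 0 <= Im w / Cmod w).
  { apply Rmult_le_pos; [auto | left; apply Rinv_0_lt_compat; auto]. }
  assert (Hc1 : -1 <= c <= 1) by nra.
  split; [apply cos_acos; auto |].
  rewrite sin_acos by auto. replace (1 - c²) with (Im w / Cmod w * (Im w / Cmod w)).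
  - apply sqrt_square. auto.
  - unfold Rsqr. lra.
Qed.

Lemma polar (w : C) : exists th, w = (Cmod w * cos th, Cmod w * sin th).
Proof.
  destruct (Req_dec (Cmod w) 0) as [H0 | H0].
  - exists 0. rewrite (Cmod_eq_0 _ H0), Cmod_0. unfold RtoC. f_equal; ring.
  - assert (Hw : 0 < Cmod w) by (pose proof (Cmod_ge_0 w); lra).
    destruct (Rle_dec 0 (Im w)) as [Hi | Hi].
    + destruct (polar_upper w Hw Hi) as [H1 H2]. exists (acos (Re w / Cmod w)).
      rewrite H1, H2. rewrite (surjective_pairing w) at 1. unfold Re, Im. f_equal; field; auto.
    + assert (Hc : Cmod (Cconj w) = Cmod w) by apply Cmod_conj.
      destruct (polar_upper (Cconj w)) as [H1 H2].
      * rewrite Hc. auto.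
      * simpl. unfold Im in *. lra.
      * rewrite Hc in *. simpl in H1, H2. exists (- acos (fst w / Cmod w)).
        change (Re (Cconj w)) with (fst w) in *. change (Im (Cconj w)) with (- snd w) in *.
        rewrite cos_neg, sin_neg, H1, H2.
        rewrite (surjective_pairing w) at 1. f_equal; field; auto.
Qed.

Lemma E_polar (lam : C) (th c phi r : R) :
  lam = (Cmod lam * cos th, Cmod lam * sin th) -> 0 < Cmod lam -> 0 < r ->
  cos c = cos (- th) -> sin c = sin (- th) ->
  E lam (ln r - ln (Cmod lam), c + phi) = (r * cos phi, r * sin phi).
Proof.
  intros Hlam Hl Hr Hc Hs. unfold E, cexp. simpl Re. simpl Im.
  unfold Rminus. rewrite exp_plus, exp_Ropp, !exp_ln by auto.
  rewrite cos_plus, sin_plus, Hc, Hs, cos_neg, sin_neg.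
  rewrite Hlam at 1. unfold Cmult. simpl fst. simpl snd.
  pose proof (sin2_cos2 th) as H. unfold Rsqr in H.
  f_equal.
  - replace (r * cos phi) with (r * cos phi * (sin th * sin th + cos th * cos th)) by (rewrite H;
      ring).
    field. lra.
  - replace (r * sin phi) with (r * sin phi * (sin th * sin th + cos th * cos th)) by (rewrite H;
      ring).
    field. lra.
Qed.

Lemma E_surjective (lam w : C) (y : R) :
  lam <> (0, 0) -> 0 < Cmod w -> exists z, E lam z = w /\ y <= Im z <= y + 2 * PI.
Proof.
  intros Hl Hw. assert (Hl0 : 0 < Cmod lam) by (apply Cmod_gt_0; exact Hl).
  destruct (polar lam) as [th Hth]. destruct (polar w) as [phi Hphi].
  destruct (angle_in_window (- th) (y - phi)) as [c [Hc [H1 H2]]].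
  exists (ln (Cmod w) - ln (Cmod lam), c + phi). split.
  - rewrite (E_polar lam th c phi (Cmod w)); auto.
  - simpl. lra.
Qed.

Lemma acos_quadrant x : 0 <= x <= 1 -> 0 <= acos x <= PI / 2.
Proof.
  intros Hx. pose proof (acos_bound x). split; [lra |].
  apply Rnot_lt_le. intros H1. pose proof PI_RGT_0.
  pose proof (cos_lt_0 (acos x) H1 ltac:(lra)). rewrite cos_acos in H2 by lra. lra.
Qed.

(* On a quarter plane the branch of [E^-1] is chosen with a constant angular shift, so that
   it is a contraction there. *)
Lemma E_branch (lam : C) (y : R) :
  lam <> (0, 0) -> exists g : C -> C, forall w, 0 < Cmod w -> 0 <= Re w -> 0 <= Im w ->
    E lam (g w) = w /\ y <= Im (g w) <= y + 5 * PI / 2 /\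
    (forall w', 0 < Cmod w' -> 0 <= Re w' -> 0 <= Im w' -> Rabs (Im (g w) - Im (g w')) <= 2).
Proof.
  intros Hl. assert (Hl0 : 0 < Cmod lam) by (apply Cmod_gt_0; exact Hl).
  destruct (polar lam) as [th Hth].
  destruct (angle_in_window (- th) y) as [c [Hc [H1 H2]]].
  assert (Hq : forall w, 0 < Cmod w -> 0 <= Re w -> 0 <= acos (Re w / Cmod w) <= PI / 2).
  { intros w Hw Hr. apply acos_quadrant.
    pose proof (re_le_Cmod w) as HR. rewrite Rabs_pos_eq in HR by auto. split.
    - apply Rmult_le_pos; [auto | left; apply Rinv_0_lt_compat; auto].
    - apply Rmult_le_reg_r with (Cmod w); auto. unfold Rdiv. rewrite Rmult_assoc, Rinv_l; lra. }
  exists (fun w => (ln (Cmod w) - ln (Cmod lam), c + acos (Re w / Cmod w))).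
  intros w Hw Hr Hi. simpl Im. pose proof (Hq w Hw Hr) as Hqw. pose proof PI_4. split; [| split].
  - rewrite (E_polar lam th) by auto. destruct (polar_upper w Hw Hi) as [-> ->].
    transitivity (Re w, Im w); [f_equal; field; lra | destruct w; reflexivity].
  - lra.
  - intros w' Hw' Hr' Hi'. pose proof (Hq w' Hw' Hr'). apply Rabs_le. lra.
Qed.

Lemma geometric_cauchy (v : nat -> R) (M : R) :
  (forall n m, Rabs (v n - v (n + m)%nat) <= M * (/ 2) ^ n) ->
  exists l, forall n, Rabs (v n - l) <= M * (/ 2) ^ n.
Proof.
  intros H.
  assert (HM : 0 <= M).
  { specialize (H 0%nat 0%nat). simpl in H. pose proof (Rabs_pos (v 0%nat - v 0%nat)). lra. }
  assert (Hc : Cauchy_crit v).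
  { intros e He. destruct (half_pow_small (e / (2 * (M + 1)))) as [N HN];
      [apply Rdiv_lt_0_compat; lra |].
    assert (HN' : M * (/ 2) ^ N < e / 2).
    { assert (0 < (/ 2) ^ N) by (apply pow_lt; lra).
      apply Rle_lt_trans with ((M + 1) * (/ 2) ^ N); [nra |].
      apply (Rmult_lt_compat_l (M + 1)) in HN; [| lra].
      replace ((M + 1) * (e / (2 * (M + 1)))) with (e / 2) in HN by (field; lra). exact HN. }
    exists N. intros n m Hn Hm. unfold Rdist.
    pose proof (H N (n - N)%nat) as H1. pose proof (H N (m - N)%nat) as H2.
    replace (N + (n - N))%nat with n in H1 by lia. replace (N + (m - N))%nat with m in H2 by lia.
    replace (v n - v m) with ((v N - v m) - (v N - v n)) by ring.
    apply Rle_lt_trans with (1 := Rabs_triang _ _). rewrite Rabs_Ropp. lra. }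
  destruct (Rcomplete.R_complete v Hc) as [l Hl]. exists l. intros n.
  apply le_epsilon. intros e He. destruct (Hl e He) as [N HN].
  specialize (HN (n + N)%nat ltac:(lia)). unfold Rdist in HN. specialize (H n N).
  replace (v n - l) with ((v n - v (n + N)%nat) + (v (n + N)%nat - l)) by ring.
  apply Rle_trans with (1 := Rabs_triang _ _). lra.
Qed.

(** The truncated backward orbit: the reference point of level [k + n] pulled back to level [k] by
    [g k, ..., g (k + n - 1)]. *)
Fixpoint backward (g : nat -> C -> C) (p : nat -> C) (n k : nat) : C :=
  match n with
  | O => p k
  | S n' => g k (backward g p n' (S k))
  end.

Lemma le_all_half_pow (x c : R) : (forall n, x <= c * (/ 2) ^ n) -> x <= 0.
Proof.
  intros H. apply Rnot_lt_le. intros Hx.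
  assert (Hc : 0 < c) by (specialize (H 0%nat); simpl in H; lra).
  destruct (half_pow_small (x / c)) as [n Hn]; [apply Rdiv_lt_0_compat; lra |].
  specialize (H n). apply (Rmult_lt_compat_l c) in Hn; auto.
  replace (c * (x / c)) with x in Hn by (field; lra). lra.
Qed.

(** The truncations converge geometrically, closed rectangles keep the limits, and the contraction
    passes the relation between consecutive levels to the limit. *)
Lemma backward_limit (x1 y1 : nat -> R) (h1 h2 : R) (g : nat -> C -> C) :
  let D := fun k z => x1 k <= Re z <= x1 k + h1 /\ y1 k <= Im z <= y1 k + h2 in
  0 <= h1 -> 0 <= h2 ->
  (forall k w, D (S k) w -> D k (g k w)) ->
  (forall k w w', D (S k) w -> D (S k) w' ->
     Cmod (Cminus (g k w) (g k w')) <= / 2 * Cmod (Cminus w w')) ->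
  exists w : nat -> C, forall k, D k (w k) /\ w k = g k (w (S k)).
Proof.
  intros D Hh1 Hh2 Hg Hlip. set (M := h1 + h2).
  set (G := backward g (fun k => (x1 k, y1 k))).
  assert (HG : forall n k, D k (G n k)).
  { induction n as [| n IH]; intros k; [unfold D; simpl; lra |]. apply Hg. apply IH. }
  assert (HGc : forall n m k, Cmod (Cminus (G n k) (G (n + m)%nat k)) <= M * (/ 2) ^ n).
  { induction n as [| n IH]; intros m k.
    - simpl pow. rewrite Rmult_1_r. apply Rle_trans with (1 := Cmod_le_abs _).
      rewrite Re_minus, Im_minus. destruct (HG 0%nat k) as [A1 A2]. destruct (HG m k) as [B1 B2].
      assert (Rabs (Re (G 0%nat k) - Re (G m k)) <= h1) by (apply Rabs_le; lra).
      assert (Rabs (Im (G 0%nat k) - Im (G m k)) <= h2) by (apply Rabs_le; lra).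
      unfold M. change (0 + m)%nat with m. lra.
    - change (G (S n + m)%nat k) with (g k (G (n + m)%nat (S k))).
      change (G (S n) k) with (g k (G n (S k))).
      apply Rle_trans with (1 := Hlip k _ _ (HG n (S k)) (HG (n + m)%nat (S k))).
      specialize (IH m (S k)). simpl pow. lra. }
  assert (HR : forall k, exists w, forall n, Cmod (Cminus (G n k) w) <= 2 * M * (/ 2) ^ n).
  { intros k.
    destruct (geometric_cauchy (fun n => Re (G n k)) M) as [l1 Hl1].
    { intros n m. apply Rle_trans with (2 := HGc n m k). rewrite <- Re_minus. apply re_le_Cmod. }
    destruct (geometric_cauchy (fun n => Im (G n k)) M) as [l2 Hl2].
    { intros n m. apply Rle_trans with (2 := HGc n m k). rewrite <- Im_minus. apply
        abs_Im_le_Cmod. }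
    exists (l1, l2). intros n. apply Rle_trans with (1 := Cmod_le_abs _).
    rewrite Re_minus, Im_minus. simpl (Re (l1, l2)). simpl (Im (l1, l2)).
    specialize (Hl1 n). specialize (Hl2 n). simpl in Hl1, Hl2. lra. }
  destruct (choice_fun _ HR) as [w Hw].
  assert (HD : forall k, D k (w k)).
  { intros k.
    assert (Hre : forall n, Rabs (Re (G n k) - Re (w k)) <= 2 * M * (/ 2) ^ n).
    { intros n. apply Rle_trans with (2 := Hw k n). rewrite <- Re_minus. apply re_le_Cmod. }
    assert (Him : forall n, Rabs (Im (G n k) - Im (w k)) <= 2 * M * (/ 2) ^ n).
    { intros n. apply Rle_trans with (2 := Hw k n). rewrite <- Im_minus. apply abs_Im_le_Cmod. }
    assert (A1 : x1 k - Re (w k) <= 0).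
    { apply (le_all_half_pow _ (2 * M)). intros n. specialize (Hre n). apply Rabs_le_between in Hre.
      destruct (HG n k). lra. }
    assert (A2 : Re (w k) - (x1 k + h1) <= 0).
    { apply (le_all_half_pow _ (2 * M)). intros n. specialize (Hre n). apply Rabs_le_between in Hre.
      destruct (HG n k). lra. }
    assert (A3 : y1 k - Im (w k) <= 0).
    { apply (le_all_half_pow _ (2 * M)). intros n. specialize (Him n). apply Rabs_le_between in Him.
      destruct (HG n k). lra. }
    assert (A4 : Im (w k) - (y1 k + h2) <= 0).
    { apply (le_all_half_pow _ (2 * M)). intros n. specialize (Him n). apply Rabs_le_between in Him.
      destruct (HG n k). lra. }
    unfold D. lra. }
  exists w. intros k. split; auto.
  assert (H0 : Cmod (Cminus (w k) (g k (w (S k)))) <= 0).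
  { apply (le_all_half_pow _ (2 * M)). intros n.
    apply Rle_trans with (1 := Cmod_minus_triangle _ (G (S n) k) _).
    pose proof (Hw k (S n)) as H1. rewrite Cmod_minus_sym in H1. simpl pow in H1.
    change (G (S n) k) with (g k (G n (S k))) in *.
    pose proof (Hlip k _ _ (HG n (S k)) (HD (S k))) as H2. pose proof (Hw (S k) n). lra. }
  pose proof (Cmod_ge_0 (Cminus (w k) (g k (w (S k))))).
  assert (Hz : Cminus (w k) (g k (w (S k))) = 0) by (apply Cmod_eq_0; lra).
  replace (w k) with (Cplus (Cminus (w k) (g k (w (S k)))) (g k (w (S k)))) at 1 by ring.
  rewrite Hz. ring.
Qed.

(** * A tree of boxes *)

(* Level [k] carries the annulus of inner radius [a k] and the strip of width [wd k] starting at
   [l k]; [b k] bounds the moduli at level [S k].  The strip is cut into [m k] columns, and each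
   column contains [J k] boxes. *)
Record grid (Delta : R) (mu : nat -> C) (a wd l b : nat -> R) (J m : nat -> nat) : Prop := {
  grid_Delta : 0 < Delta;
  grid_mu : forall k, mu k <> (0, 0);
  grid_a : forall k, 4 <= a k;
  grid_l : forall k, 0 <= l k <= a k;
  grid_l_eq : forall k, l k = ln (a (S k)) - ln (Cmod (mu k));
  grid_wd : forall k, wd k <= Delta / 3 * a k;
  grid_b : forall k, a (S k) * exp (wd k) <= b k;
  grid_m : forall k, (1 <= m k)%nat;
  grid_m_le : forall k, (2 * (INR (m k) - 1) + 1) * Delta <= wd k;
  grid_J : forall k, (2 <= J k)%nat;
  grid_J_le : forall k, 4 * PI * INR (J k) <= Delta / 2 * a k
}.

(* The column chosen at level [k] fixes the sub-annulus met at level [S k]. *)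
Definition base_mod (Delta : R) (a : nat -> R) (i : nat -> nat) (k : nat) : R :=
  match k with
  | O => a O
  | S k' => a (S k') * exp (2 * INR (i k') * Delta)
  end.

(** Columns of width [Delta] start [2 * Delta] apart, which leaves a gap of [Delta] between
    neighbours. *)
Definition box_x (Delta : R) (l : nat -> R) (i : nat -> nat) (k : nat) : R :=
  l k + 2 * INR (i k) * Delta.

(** The square root is the height at which the line [Re = l k] meets the circle of radius
    [base_mod]. Rows start [4 PI] apart. The box height [5 PI / 2] is what [E_branch] needs: [2 PI]
    to place the angular window and [PI / 2] for the argument. *)
Definition box_y (Delta : R) (a l : nat -> R) (i j : nat -> nat) (k : nat) : R :=
  sqrt (base_mod Delta a i k * base_mod Delta a i k - l k * l k) + 4 * PI * INR (j k).

Definition in_box Delta a l i j k (z : C) : Prop :=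
  box_x Delta l i k <= Re z <= box_x Delta l i k + Delta /\
  box_y Delta a l i j k <= Im z <= box_y Delta a l i j k + 5 * PI / 2.

(** The cross terms add at most [(2/3 + 1) Delta u^2], less than the [2 Delta u^2] in
    [(1 + Delta)^2 u^2]; the fractions 1/3 and 1/2 in the grid are chosen for this. *)
Lemma annulus_arith (Delta u l d x y h : R) :
  0 < Delta -> 0 < u -> 0 <= l <= u -> 0 <= d <= Delta / 3 * u -> l <= x <= l + d ->
  h = sqrt (u * u - l * l) -> h <= y <= h + Delta / 2 * u ->
  u * u <= x * x + y * y <= (u * exp Delta) * (u * exp Delta).
Proof.
  intros HD Hu Hl Hd Hx Hh Hy.
  assert (Hh0 : 0 <= h) by (rewrite Hh; apply sqrt_pos).
  assert (Hh2 : h * h = u * u - l * l) by (rewrite Hh; apply sqrt_sqrt; nra).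
  assert (Hhu : h <= u) by nra.
  split; [nra |].
  pose proof (exp_ineq1_le Delta) as He.
  assert (H1 : x * x <= (l + d) * (l + d)) by (apply Rmult_le_compat; lra).
  assert (H2 : y * y <= (h + Delta / 2 * u) * (h + Delta / 2 * u)) by (apply Rmult_le_compat; nra).
  assert (H3 : l * d <= u * (Delta / 3 * u)) by (apply Rmult_le_compat; lra).
  assert (H4 : d * d <= (Delta / 3 * u) * (Delta / 3 * u)) by (apply Rmult_le_compat; lra).
  assert (H5 : h * (Delta * u) <= u * (Delta * u)) by (apply Rmult_le_compat_r; nra).
  assert (H6 : (u * (1 + Delta)) * (u * (1 + Delta)) <= (u * exp Delta) * (u * exp Delta)).
  { assert (u * (1 + Delta) <= u * exp Delta) by (apply Rmult_le_compat_l; lra).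
    apply Rmult_le_compat; nra. }
  apply Rle_trans with (2 := H6).
  assert (0 < Delta * (u * u)) by (apply Rmult_lt_0_compat; nra).
  assert (0 < Delta * Delta * (u * u)) by (apply Rmult_lt_0_compat; nra).
  nra.
Qed.

Lemma base_mod_ge Delta a i k :
  0 < Delta -> 0 < a k -> a k <= base_mod Delta a i k.
Proof.
  intros HD Ha. destruct k as [| k]; simpl; [lra |].
  pose proof (pos_INR (i k)). pose proof (exp_ineq1_le (2 * INR (i k) * Delta)).
  assert (0 <= 2 * INR (i k) * Delta) by (apply Rmult_le_pos; lra). nra.
Qed.

Lemma in_box_Cmod Delta mu a wd l b J m i j k z :
  grid Delta mu a wd l b J m -> (i k < m k)%nat -> (j k < J k)%nat ->
  in_box Delta a l i j k z ->
  base_mod Delta a i k <= Cmod z <= base_mod Delta a i k * exp Delta /\ 0 <= Re z /\ 0 <= Im z.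
Proof.
  intros G Hi Hj [Hx Hy]. set (u := base_mod Delta a i k) in *.
  pose proof (grid_Delta _ _ _ _ _ _ _ _ G) as HD. pose proof (grid_a _ _ _ _ _ _ _ _ G k) as Ha.
  pose proof (grid_l _ _ _ _ _ _ _ _ G k) as Hl. pose proof (grid_wd _ _ _ _ _ _ _ _ G k) as Hw.
  pose proof (grid_m_le _ _ _ _ _ _ _ _ G k) as Hm. pose proof (grid_J_le _ _ _ _ _ _ _ _ G k) as
      HJ.
  assert (Hu : a k <= u) by (apply base_mod_ge; lra).
  pose proof PI_RGT_0 as Hpi.
  assert (Hi' : INR (i k) <= INR (m k) - 1).
  { apply (le_INR (S (i k)) (m k)) in Hi. rewrite S_INR in Hi. lra. }
  assert (Hj' : INR (j k) <= INR (J k) - 1).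
  { apply (le_INR (S (j k)) (J k)) in Hj. rewrite S_INR in Hj. lra. }
  pose proof (pos_INR (i k)). pose proof (pos_INR (j k)).
  unfold box_x in Hx. unfold box_y in Hy. fold u in Hy.
  set (h := sqrt (u * u - l k * l k)) in *.
  assert (Hh : 0 <= h) by apply sqrt_pos.
  assert (H1 : 0 <= INR (i k) * Delta) by (apply Rmult_le_pos; lra).
  assert (H2 : 0 <= PI * INR (j k)) by (apply Rmult_le_pos; lra).
  assert (H3 : INR (i k) * Delta <= (INR (m k) - 1) * Delta) by (apply Rmult_le_compat_r; lra).
  assert (H4 : PI * INR (j k) <= PI * (INR (J k) - 1)) by (apply Rmult_le_compat_l; lra).
  assert (H5 : Delta / 3 * a k <= Delta / 3 * u) by (apply Rmult_le_compat_l; lra).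
  assert (H6 : Delta / 2 * a k <= Delta / 2 * u) by (apply Rmult_le_compat_l; lra).
  destruct (annulus_arith Delta u (l k) (wd k) (Re z) (Im z) h) as [A1 A2]; try lra; try
      reflexivity.
  pose proof (exp_pos Delta).
  repeat split; try lra.
  - apply Cmod_ge_of_sq. auto.
  - apply Cmod_le_of_sq; auto. apply Rmult_le_pos; lra.
Qed.

(** The branch sends the box of level [S k] into that of level [k]: moduli between [base_mod] and
    [base_mod * exp Delta] become exactly the column [i k], and the angular window is the row [j k].
    Since [a >= 4], the ratio [2 / a] is at most 1/2. *)
Lemma grid_orbit Delta mu a wd l b J m i j :
  grid Delta mu a wd l b J m -> (forall k, i k < m k)%nat -> (forall k, j k < J k)%nat ->
  exists w : nat -> C, forall k, in_box Delta a l i j k (w k) /\ E (mu k) (w k) = w (S k).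
Proof.
  intros G Hi Hj.
  pose proof (grid_Delta _ _ _ _ _ _ _ _ G) as HD. pose proof PI_RGT_0 as Hpi.
  destruct (choice_fun _ (fun k => E_branch (mu k) (box_y Delta a l i j k)
    (grid_mu _ _ _ _ _ _ _ _ G k))) as [g Hg].
  assert (HB : forall k w, in_box Delta a l i j (S k) w ->
    a (S k) <= Cmod w /\ base_mod Delta a i (S k) <= Cmod w <= base_mod Delta a i (S k) * exp
        Delta /\
    0 < Cmod w /\ 0 <= Re w /\ 0 <= Im w).
  { intros k w Hw. pose proof (grid_a _ _ _ _ _ _ _ _ G (S k)) as Ha.
    destruct (in_box_Cmod _ _ _ _ _ _ _ _ _ _ _ _ G (Hi (S k)) (Hj (S k)) Hw) as [H1 [H2 H3]].
    pose proof (base_mod_ge Delta a i (S k) HD ltac:(lra)). repeat split; lra. }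
  destruct (backward_limit (box_x Delta l i) (box_y Delta a l i j) Delta (5 * PI / 2) g) as [w Hw].
  - lra.
  - lra.
  - intros k w Hw. destruct (HB k w Hw) as [H1 [H2 [H3 [H4 H5]]]].
    destruct (Hg k w H3 H4 H5) as [HE [HI _]]. split; [| exact HI].
    rewrite (Re_eq_ln (mu k) (g k w) (grid_mu _ _ _ _ _ _ _ _ G k)), HE. unfold box_x.
    rewrite (grid_l_eq _ _ _ _ _ _ _ _ G). simpl base_mod in H2.
    pose proof (grid_a _ _ _ _ _ _ _ _ G (S k)) as Ha. pose proof (exp_pos (2 * INR (i k) * Delta)).
    pose proof (exp_pos Delta).
    assert (Hp : 0 < a (S k) * exp (2 * INR (i k) * Delta)) by (apply Rmult_lt_0_compat; lra).
    pose proof (ln_le _ _ Hp (proj1 H2)) as L1. pose proof (ln_le _ _ H3 (proj2 H2)) as L2.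
    rewrite ln_mult, ln_exp in L1 by lra. rewrite !ln_mult, !ln_exp in L2 by lra. lra.
  - intros k w w' Hw Hw'. destruct (HB k w Hw) as [H1 [_ [H3 [H4 H5]]]].
    destruct (HB k w' Hw') as [H1' [_ [H3' [H4' H5']]]].
    destruct (Hg k w H3 H4 H5) as [HE [_ HI]]. destruct (Hg k w' H3' H4' H5') as [HE' _].
    pose proof (grid_a _ _ _ _ _ _ _ _ G (S k)) as Ha.
    pose proof (E_contract (mu k) (g k w) (g k w') (a (S k)) ltac:(lra) (HI w' H3' H4' H5')) as Hc.
    rewrite HE, HE' in Hc. specialize (Hc H1 H1').
    apply Rle_trans with (1 := Hc). apply Rmult_le_compat_r; [apply Cmod_ge_0 |].
    apply Rmult_le_reg_r with (a (S k)); [lra |]. unfold Rdiv. rewrite Rmult_assoc, Rinv_l; lra.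
  - exists w. intros k. destruct (Hw k) as [H1 H2]. split; [exact H1 |].
    rewrite H2. destruct (Hw (S k)) as [H3 _].
    destruct (HB k _ H3) as [_ [_ [H4 [H5 H6]]]]. apply Hg; auto.
Qed.

Lemma grid_orbit_bounds Delta mu a wd l b J m i j w :
  grid Delta mu a wd l b J m -> (forall k, i k < m k)%nat -> (forall k, j k < J k)%nat ->
  (forall k, in_box Delta a l i j k (w k)) ->
  (forall k, a k <= Cmod (w k)) /\ Cmod (w O) <= a O * exp Delta /\
  (forall k, Cmod (w (S k)) <= a (S k) * exp (wd k)).
Proof.
  intros G Hi Hj Hw. pose proof (grid_Delta _ _ _ _ _ _ _ _ G) as HD.
  assert (H : forall k, base_mod Delta a i k <= Cmod (w k) <= base_mod Delta a i k * exp Delta).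
  { intros k. apply (in_box_Cmod _ _ _ _ _ _ _ _ _ _ _ _ G (Hi k) (Hj k) (Hw k)). }
  repeat split.
  - intros k. pose proof (grid_a _ _ _ _ _ _ _ _ G k).
    pose proof (base_mod_ge Delta a i k HD ltac:(lra)). specialize (H k). lra.
  - apply (H O).
  - intros k. apply Rle_trans with (1 := proj2 (H (S k))). simpl base_mod.
    rewrite Rmult_assoc, <- exp_plus. pose proof (grid_a _ _ _ _ _ _ _ _ G (S k)).
    apply Rmult_le_compat_l; [lra |]. apply exp_le_mono.
    pose proof (grid_m_le _ _ _ _ _ _ _ _ G k) as Hm.
    assert (Hi' : INR (i k) <= INR (m k) - 1).
    { specialize (Hi k). apply (le_INR (S (i k)) (m k)) in Hi. rewrite S_INR in Hi. lra. }
    assert (INR (i k) * Delta <= (INR (m k) - 1) * Delta) by (apply Rmult_le_compat_r; lra). lra.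
Qed.

Fixpoint prod0 (b : nat -> R) (n : nat) : R :=
  match n with
  | O => 1
  | S m => prod0 b m * b m
  end.

Lemma orbit_expand (mu : nat -> C) (b : nat -> R) (w w' : nat -> C) k :
  (forall k, 0 <= b k) ->
  (forall k, E (mu k) (w k) = w (S k)) -> (forall k, E (mu k) (w' k) = w' (S k)) ->
  (forall k, Cmod (w (S k)) <= b k) -> (forall k, Cmod (w' (S k)) <= b k) ->
  Cmod (Cminus (w k) (w' k)) <= prod0 b k * Cmod (Cminus (w O) (w' O)).
Proof.
  intros Hb HE HE' Hw Hw'. induction k as [| k IH]; simpl; [lra |].
  rewrite <- HE, <- HE'.
  apply Rle_trans with (b k * Cmod (Cminus (w k) (w' k))).
  - apply E_expand; [rewrite HE; auto | rewrite HE'; auto].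
  - rewrite (Rmult_comm (prod0 b k)), Rmult_assoc. apply Rmult_le_compat_l; auto.
Qed.

Lemma INR_sep (p q : nat) : p <> q -> 1 <= Rabs (INR p - INR q).
Proof.
  intros H. destruct (lt_dec p q) as [Hl | Hl].
  - apply (le_INR (S p)) in Hl. rewrite S_INR in Hl. rewrite Rabs_left; lra.
  - assert (Hl' : (S q <= p)%nat) by lia. apply le_INR in Hl'. rewrite S_INR in Hl'.
    rewrite Rabs_pos_eq; lra.
Qed.

Lemma separation_1d (x1 h s z z' : R) (p q : nat) :
  x1 + s * INR p <= z <= x1 + s * INR p + h -> x1 + s * INR q <= z' <= x1 + s * INR q + h ->
  0 < s -> s * Rabs (INR p - INR q) - h <= Rabs (z - z').
Proof.
  intros Hz Hz' Hs.
  replace (s * Rabs (INR p - INR q)) with (Rabs (s * INR p - s * INR q)).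
  - replace (s * INR p - s * INR q) with ((z - z') + ((z' - (x1 + s * INR q)) - (z - (x1 + s * INR
      p)))) by ring.
    pose proof (Rabs_triang (z - z') ((z' - (x1 + s * INR q)) - (z - (x1 + s * INR p)))).
    assert (Rabs ((z' - (x1 + s * INR q)) - (z - (x1 + s * INR p))) <= h) by (apply Rabs_le; lra).
    lra.
  - rewrite <- Rmult_minus_distr_l, Rabs_mult, Rabs_pos_eq; lra.
Qed.

(** Equal earlier columns give both boxes the same base modulus, hence the same lattice. Rows are
    then [4 PI |j - j'| - 5 PI / 2 >= |j - j'|] apart, and columns at least [2 Delta - Delta]. *)
Lemma box_separation Delta a l i j i' j' k z z' :
  0 < Delta -> (forall p, (p < k)%nat -> i p = i' p) ->
  in_box Delta a l i j k z -> in_box Delta a l i' j' k z' ->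
  (j k <> j' k -> Rabs (INR (j k) - INR (j' k)) <= Cmod (Cminus z z')) /\
  (i k <> i' k -> Delta <= Cmod (Cminus z z')).
Proof.
  intros HD Hag [Hx Hy] [Hx' Hy'].
  assert (Hu : base_mod Delta a i k = base_mod Delta a i' k).
  { destruct k as [| k]; simpl; auto. rewrite Hag by lia. reflexivity. }
  unfold box_x, box_y in *. rewrite <- Hu in Hy'. pose proof PI2_1 as Hpi.
  pose proof (re_le_Cmod (Cminus z z')) as HR. pose proof (abs_Im_le_Cmod (Cminus z z')) as HI.
  rewrite Re_minus in HR. rewrite Im_minus in HI.
  split; intros Hne; apply INR_sep in Hne.
  - pose proof (separation_1d _ (5 * PI / 2) (4 * PI) (Im z) (Im z') (j k) (j' k) Hy Hy'
      ltac:(lra)).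
    nra.
  - pose proof (separation_1d (l k) Delta (2 * Delta) (Re z) (Re z') (i k) (i' k) ltac:(lra)
      ltac:(lra) ltac:(lra)).
    nra.
Qed.

(** * Coding by mixed radix expansions *)

Fixpoint prodn (q : nat -> nat) (n : nat) : nat :=
  match n with
  | O => 1%nat
  | S k => (prodn q k * q k)%nat
  end.

Lemma floor_function_exists : exists f : R -> nat, forall x, 0 <= x -> INR (f x) <= x < INR (f x)
    + 1.
Proof.
  apply (choice_fun (fun x n => 0 <= x -> INR n <= x < INR n + 1)).
  intros x. destruct (Rle_dec 0 x) as [H | H].
  - destruct (nfloor_ex x H) as [n Hn]. exists n. auto.
  - exists 0%nat. lra.
Qed.

(** With [pre t k] the floor of [N k * t], digits are the increments of these floors. Agreement up
    to level [k] means equal floors there, and [N k >= 2^k] separates distinct parameters. *)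
Lemma mixed_radix (q : nat -> nat) :
  (forall k, 2 <= q k)%nat ->
  exists dig : R -> nat -> nat,
    (forall t k, 0 <= t < 1 -> (dig t k < q k)%nat) /\
    (forall t t', 0 <= t < 1 -> 0 <= t' < 1 -> t <> t' ->
       exists k, (forall p, (p < k)%nat -> dig t p = dig t' p) /\ dig t k <> dig t' k /\
         Rabs (t - t') * INR (prodn q k) <= 1 /\
         Rabs (t - t') * INR (prodn q (S k)) <= Rabs (INR (dig t k) - INR (dig t' k)) + 1).
Proof.
  intros Hq. destruct floor_function_exists as [fl Hfl].
  set (N := fun k => INR (prodn q k)).
  assert (HN1 : forall k, 2 ^ k <= N k).
  { induction k as [| k IH]; unfold N in *; simpl; [lra |]. rewrite mult_INR.
    pose proof (le_INR 2 (q k) (Hq k)) as H2. simpl in H2.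
    assert (0 < 2 ^ k) by (apply pow_lt; lra). nra. }
  assert (HN : forall k, 0 < N k).
  { intros k. apply Rlt_le_trans with (2 := HN1 k). apply pow_lt. lra. }
  assert (HNS : forall k, N (S k) = INR (q k) * N k).
  { intros k. unfold N. simpl. rewrite mult_INR. ring. }
  pose (pre := fun t k => fl (N k * t)).
  assert (Hpre : forall t k, 0 <= t < 1 -> INR (pre t k) <= N k * t < INR (pre t k) + 1).
  { intros t k Ht. apply Hfl. apply Rmult_le_pos; [left; apply HN | lra]. }
  pose (dig := fun t k => (pre t (S k) - q k * pre t k)%nat).
  assert (Hdig : forall t k, 0 <= t < 1 -> pre t (S k) = (q k * pre t k + dig t k)%nat /\ (dig t k
      < q k)%nat).
  { intros t k Ht. pose proof (Hpre t k Ht) as H1. pose proof (Hpre t (S k) Ht) as H2.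
    rewrite HNS in H2. pose proof (le_INR 2 (q k) (Hq k)) as Hqk. simpl in Hqk.
    assert (A : (q k * pre t k <= pre t (S k))%nat).
    { apply Nat.lt_succ_r. apply INR_lt. rewrite S_INR, mult_INR. nra. }
    assert (B : (pre t (S k) < q k * (pre t k + 1))%nat).
    { apply INR_lt. rewrite mult_INR, plus_INR. simpl (INR 1). nra. }
    unfold dig. lia. }
  exists dig. split; [intros t k Ht; apply (Hdig t k Ht) |].
  intros t t' Ht Ht' Hne.
  assert (Hagree : forall k, (forall p, (p < k)%nat -> dig t p = dig t' p) -> pre t k = pre t' k).
  { induction k as [| k IH]; intros Hp.
    - pose proof (Hpre t 0%nat Ht) as H1. pose proof (Hpre t' 0%nat Ht') as H2.
      unfold N in H1, H2. simpl prodn in H1, H2. simpl (INR 1) in H1, H2.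
      assert (pre t 0%nat < 1)%nat by (apply INR_lt; simpl; lra).
      assert (pre t' 0%nat < 1)%nat by (apply INR_lt; simpl; lra). lia.
    - rewrite (proj1 (Hdig t k Ht)), (proj1 (Hdig t' k Ht')), IH by (intros; apply Hp; lia).
      rewrite (Hp k) by lia. reflexivity. }
  assert (Hclose : forall k, Rabs (t - t') * N k <= Rabs (INR (pre t k) - INR (pre t' k)) + 1).
  { intros k. pose proof (Hpre t k Ht). pose proof (Hpre t' k Ht').
    rewrite <- (Rabs_pos_eq (N k)) by (left; apply HN). rewrite <- Rabs_mult.
    replace ((t - t') * N k) with ((INR (pre t k) - INR (pre t' k)) +
      ((N k * t - INR (pre t k)) - (N k * t' - INR (pre t' k)))) by ring.
    apply Rle_trans with (1 := Rabs_triang _ _). apply Rplus_le_compat_l. apply Rabs_le. lra. }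
  assert (Hdiff : exists k, dig t k <> dig t' k).
  { apply NNPP. intros Hn.
    assert (Heq : forall k, dig t k = dig t' k).
    { intros k. apply NNPP. intros Hk. apply Hn. eauto. }
    assert (H0 : Rabs (t - t') <= 0).
    { apply (le_all_half_pow _ 1). intros k. specialize (Hclose k).
      rewrite (Hagree k), Rminus_diag, Rabs_R0 in Hclose by auto.
      specialize (HN1 k). assert (0 < 2 ^ k) by (apply pow_lt; lra).
      rewrite pow_inv, Rmult_1_l. apply Rmult_le_reg_r with (2 ^ k); auto.
      rewrite Rinv_l by lra. pose proof (Rabs_pos (t - t')). nra. }
    pose proof (Rabs_pos_lt (t - t') (Rminus_eq_contra _ _ Hne)). lra. }
  destruct (dec_inh_nat_subset_has_unique_least_element (fun k => dig t k <> dig t' k)) as [k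
      [[Hk1 Hk2] _]].
  - intros k. destruct (Nat.eq_dec (dig t k) (dig t' k)); auto.
  - exact Hdiff.
  - assert (Hbelow : forall p, (p < k)%nat -> dig t p = dig t' p).
    { intros p Hp. apply NNPP. intros Hn. specialize (Hk2 p Hn). lia. }
    exists k. split; [exact Hbelow | split; [exact Hk1 | split]].
    + specialize (Hclose k). rewrite (Hagree k Hbelow), Rminus_diag, Rabs_R0 in Hclose.
      unfold N in Hclose. lra.
    + specialize (Hclose (S k)).
      rewrite (proj1 (Hdig t k Ht)), (proj1 (Hdig t' k Ht')), (Hagree k Hbelow), !plus_INR in
          Hclose.
      replace (INR (q k * pre t' k) + INR (dig t k) - (INR (q k * pre t' k) + INR (dig t' k)))
        with (INR (dig t k) - INR (dig t' k)) in Hclose by ring.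
      exact Hclose.
Qed.

(** A digit in base [J k * m k] encodes the row as quotient and the column as remainder. With a
    single column the digit is the row, so a first difference of many digits forces a proportional
    distance; this is the last estimate, with [|dig - dig'| + 1 <= 2 |dig - dig'|]. *)
Lemma grid_param Delta mu a wd l b J m :
  grid Delta mu a wd l b J m ->
  exists W : R -> nat -> C,
    (forall t, 0 <= t < 1 ->
       (forall k, E (mu k) (W t k) = W t (S k)) /\ (forall k, a k <= Cmod (W t k)) /\
       Cmod (W t O) <= a O * exp Delta /\ (forall k, Cmod (W t (S k)) <= a (S k) * exp (wd k))) /\
    (forall t t', 0 <= t < 1 -> 0 <= t' < 1 -> t <> t' ->
       exists k, let d := prod0 b k * Cmod (Cminus (W t O) (W t' O)) in
         Rabs (t - t') * INR (prodn (fun k => (J k * m k)%nat) k) <= 1 /\ Rmin 1 Delta <= d /\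
         (m k = 1%nat -> Rabs (t - t') * INR (prodn (fun k => (J k * m k)%nat) (S k)) <= 2 * d)).
Proof.
  intros G. set (q := fun k => (J k * m k)%nat).
  pose proof (grid_Delta _ _ _ _ _ _ _ _ G) as HD.
  destruct (mixed_radix q) as [dig [Hd1 Hd2]].
  { intros k. unfold q. pose proof (grid_J _ _ _ _ _ _ _ _ G k). pose proof (grid_m _ _ _ _ _ _ _
      _ G k). nia. }
  pose (i := fun t k => (dig t k mod m k)%nat). pose (j := fun t k => (dig t k / m k)%nat).
  assert (Hm : forall k, m k <> 0%nat) by (intros k; pose proof (grid_m _ _ _ _ _ _ _ _ G k); lia).
  assert (Hi : forall t k, (i t k < m k)%nat) by (intros; apply Nat.mod_upper_bound; auto).
  assert (Hj : forall t, 0 <= t < 1 -> forall k, (j t k < J k)%nat).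
  { intros t Ht k. apply Nat.Div0.div_lt_upper_bound. specialize (Hd1 t k Ht). unfold q in Hd1.
      lia. }
  assert (HW : forall t, exists w : nat -> C, 0 <= t < 1 ->
    forall k, in_box Delta a l (i t) (j t) k (w k) /\ E (mu k) (w k) = w (S k)).
  { intros t. destruct (classic (0 <= t < 1)) as [Ht | Ht].
    - destruct (grid_orbit _ _ _ _ _ _ _ _ (i t) (j t) G (Hi t) (Hj t Ht)) as [w Hw]. exists w.
        auto.
    - exists (fun _ => RtoC 0). contradiction. }
  destruct (choice_fun _ HW) as [W HW']. exists W.
  assert (Hb : forall t, 0 <= t < 1 ->
     (forall k, a k <= Cmod (W t k)) /\ Cmod (W t O) <= a O * exp Delta /\
     (forall k, Cmod (W t (S k)) <= a (S k) * exp (wd k))).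
  { intros t Ht. apply (grid_orbit_bounds _ _ _ _ _ _ _ _ (i t) (j t) (W t) G (Hi t) (Hj t Ht)).
    intros k. apply (HW' t Ht k). }
  split.
  - intros t Ht. split; [intros k; apply (HW' t Ht k) | auto].
  - intros t t' Ht Ht' Hne. destruct (Hd2 t t' Ht Ht' Hne) as [k [Hag [Hdf [H1 H2]]]].
    exists k. intros d.
    assert (Hexp : Cmod (Cminus (W t k) (W t' k)) <= d).
    { apply orbit_expand with (mu := mu).
      - intros p. apply Rle_trans with (2 := grid_b _ _ _ _ _ _ _ _ G p).
        pose proof (grid_a _ _ _ _ _ _ _ _ G (S p)). pose proof (exp_pos (wd p)). nra.
      - intros p. apply (HW' t Ht p).
      - intros p. apply (HW' t' Ht' p).
      - intros p. apply Rle_trans with (2 := grid_b _ _ _ _ _ _ _ _ G p). apply (Hb t Ht).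
      - intros p. apply Rle_trans with (2 := grid_b _ _ _ _ _ _ _ _ G p). apply (Hb t' Ht'). }
    assert (Hagi : forall p, (p < k)%nat -> i t p = i t' p).
    { intros p Hp. unfold i. rewrite (Hag p Hp). reflexivity. }
    destruct (box_separation Delta a l (i t) (j t) (i t') (j t') k (W t k) (W t' k) HD Hagi
      (proj1 (HW' t Ht k)) (proj1 (HW' t' Ht' k))) as [S1 S2].
    split; [exact H1 |]. split.
    + destruct (Nat.eq_dec (j t k) (j t' k)) as [Ej | Ej].
      * apply Rle_trans with Delta; [apply Rmin_r |]. apply Rle_trans with (2 := Hexp). apply S2.
        intros Ei. apply Hdf. unfold i, j in *.
        rewrite (Nat.div_mod_eq (dig t k) (m k)), (Nat.div_mod_eq (dig t' k) (m k)). congruence.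
      * apply Rle_trans with 1; [apply Rmin_l |]. apply Rle_trans with (2 := Hexp).
        apply Rle_trans with (2 := S1 Ej). apply INR_sep. auto.
    + intros Hmk. apply Rle_trans with (1 := H2).
      assert (Ej : forall t, j t k = dig t k) by (intros x; unfold j; rewrite Hmk; apply
          Nat.div_1_r).
      rewrite !Ej in S1. specialize (S1 Hdf). pose proof (INR_sep _ _ Hdf). lra.
Qed.

(** * Dimensions *)

(** Carries the tree from level [N] back to the plane. Preimages are chosen point by point: the
    distance bound comes from the expansion estimate for [E], whatever the choice. *)
Lemma Eiter_right_inverse (lam : nat -> C) (N : nat) (R0 : R) :
  (forall k, (1 <= k)%nat -> lam k <> (0, 0)) -> 1 <= R0 ->
  exists (g : C -> C) (L : R), 0 < L /\
    (forall w, 1 <= Cmod w <= R0 -> Eiter lam N (g w) = w) /\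
    (forall w w', 1 <= Cmod w <= R0 -> 1 <= Cmod w' <= R0 ->
       Cmod (Cminus w w') <= L * Cmod (Cminus (g w) (g w'))).
Proof.
  intros Hlam. revert R0. induction N as [| N IH]; intros R0 HR.
  - exists (fun w => w), 1. split; [lra | split; [reflexivity |]]. intros. lra.
  - set (mu := lam (S N)). assert (Hmu : mu <> (0, 0)) by (apply Hlam; lia).
    (* The window starts at [2 PI] so that preimages have modulus at least 1, as the induction
       hypothesis requires. *)
    assert (Hex : forall w : C, exists z, 0 < Cmod w -> E mu z = w /\ 2 * PI <= Im z <= 2 * PI + 2
        * PI).
    { intros w. destruct (classic (0 < Cmod w)) as [Hw | Hw].
      - destruct (E_surjective mu w (2 * PI) Hmu Hw) as [z Hz]. exists z. auto.
      - exists (RtoC 0). contradiction. }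
    destruct (choice_fun _ Hex) as [h Hh].
    set (R1 := ln R0 + Rabs (ln (Cmod mu)) + 4 * PI).
    pose proof PI2_1 as Hpi.
    assert (Hrange : forall w, 1 <= Cmod w <= R0 -> 1 <= Cmod (h w) <= R1).
    { intros w Hw. destruct (Hh w ltac:(lra)) as [HE HI].
      pose proof (abs_Im_le_Cmod (h w)) as H1. rewrite Rabs_pos_eq in H1 by lra.
      split; [lra |]. apply Rle_trans with (1 := Cmod_le_abs _).
      rewrite (Rabs_pos_eq (Im (h w))) by lra.
      rewrite (Re_eq_ln mu (h w) Hmu), HE.
      assert (0 <= ln (Cmod w)) by (rewrite <- ln_1; apply ln_le; lra).
      pose proof (ln_le (Cmod w) R0 ltac:(lra) ltac:(lra)).
      unfold Rminus. pose proof (Rabs_triang (ln (Cmod w)) (- ln (Cmod mu))) as H3.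
      rewrite Rabs_Ropp, (Rabs_pos_eq (ln (Cmod w))) in H3 by lra. unfold R1. lra. }
    assert (HR1 : 1 <= R1) by (pose proof (Hrange (RtoC 1)) as H; rewrite Cmod_1 in H; lra).
    destruct (IH R1 HR1) as [g [L [HL [Hg1 Hg2]]]].
    exists (fun w => g (h w)), (R0 * L). split; [apply Rmult_lt_0_compat; lra |]. split.
    + intros w Hw. simpl. rewrite Hg1 by auto. apply Hh. lra.
    + intros w w' Hw Hw'. apply Rle_trans with (R0 * Cmod (Cminus (h w) (h w'))).
      * destruct (Hh w ltac:(lra)) as [HE _]. destruct (Hh w' ltac:(lra)) as [HE' _].
        rewrite <- HE, <- HE' at 1. apply E_expand; [rewrite HE; lra | rewrite HE'; lra].
      * rewrite Rmult_assoc. apply Rmult_le_compat_l; [lra |]. apply Hg2; auto.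
Qed.

Definition tail_mu (lam : nat -> C) (N k : nat) : C := lam (S (N + k)).
Definition tail_a (a : nat -> R) (N k : nat) : R := a (N + k)%nat.
Definition tail_l (lam : nat -> C) (a : nat -> R) (N k : nat) : R :=
  ln (a (S (N + k))) - ln (Cmod (lam (S (N + k)))).
Definition tail_b (a wd : nat -> R) (N k : nat) : R := a (S (N + k)) * exp (wd k).

(** Digits are defined on [[0, 1)]; the interval [[0, 1/2]] is a compact part of it, as the interval
    covers require. [L] is the distortion of the first [N] levels. *)
Lemma cantor_in_Iab Delta lam a b N wd J m :
  tame Delta lam a b ->
  grid Delta (tail_mu lam N) (tail_a a N) wd (tail_l lam a N) (tail_b a wd N) J m ->
  (forall k, wd k <= logratio a b (S (N + k))) ->
  exists (x : R -> C) (L : R), 0 < L /\ (forall t, 0 <= t <= / 2 -> Iab lam a b (x t)) /\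
    (forall t t', 0 <= t <= / 2 -> 0 <= t' <= / 2 -> t <> t' ->
       exists k, let d := L * prod0 (tail_b a wd N) k * Cmod (Cminus (x t) (x t')) in
         Rabs (t - t') * INR (prodn (fun k => (J k * m k)%nat) k) <= 1 /\ Rmin 1 Delta <= d /\
         (m k = 1%nat -> Rabs (t - t') * INR (prodn (fun k => (J k * m k)%nat) (S k)) <= 2 * d)).
Proof.
  intros HT G Hwd.
  destruct (grid_param _ _ _ _ _ _ _ _ G) as [W [HW1 HW2]].
  set (R0 := tail_a a N 0 * exp Delta).
  pose proof (grid_a _ _ _ _ _ _ _ _ G) as Ha.
  assert (HR0 : 1 <= R0).
  { unfold R0. pose proof (exp_ineq1_le Delta). pose proof (grid_Delta _ _ _ _ _ _ _ _ G).
    specialize (Ha 0%nat). nra. }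
  destruct (Eiter_right_inverse lam N R0 (tame_lam _ _ _ _ HT) HR0) as [g [L [HL [Hg1 Hg2]]]].
  exists (fun t => g (W t 0%nat)), L.
  assert (Hr : forall t, 0 <= t <= / 2 -> 1 <= Cmod (W t 0%nat) <= R0).
  { intros t Ht. destruct (HW1 t ltac:(lra)) as [_ [H1 [H2 _]]].
    specialize (H1 0%nat). specialize (Ha 0%nat). unfold R0. lra. }
  split; [exact HL | split].
  - intros t Ht. destruct (HW1 t ltac:(lra)) as [HE [Hlo [_ Hup]]].
    assert (Horb : forall k, orbit_from lam N k (W t 0%nat) = W t k).
    { induction k as [| k IH]; [reflexivity |]. simpl. rewrite IH, <- HE. unfold tail_mu.
      rewrite Nat.add_succ_r. reflexivity. }
    exists (S N). intros n Hn. destruct (Nat.le_exists_sub (S N) n Hn) as [k [-> _]].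
    replace (k + S N)%nat with (N + S k)%nat by lia.
    rewrite <- orbit_from_Eiter, Hg1, Horb by auto.
    specialize (Hlo (S k)). specialize (Hup k). unfold tail_a in *.
    rewrite Nat.add_succ_r in *. split; [exact Hlo |].
    apply Rle_trans with (1 := Hup). rewrite (tame_b_eq _ _ _ _ (S (N + k)) HT) by lia.
    apply Rmult_le_compat_l; [specialize (Ha (S k)); unfold tail_a in Ha; rewrite Nat.add_succ_r
        in Ha; lra |].
    apply exp_le_mono. apply Hwd.
  - intros t t' Ht Ht' Hne. destruct (HW2 t t' ltac:(lra) ltac:(lra) Hne) as [k [H1 [H2 H3]]].
    assert (Hb0 : 0 <= prod0 (tail_b a wd N) k).
    { clear - HT. induction k as [| k IH]; simpl; [lra |]. apply Rmult_le_pos; auto.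
      unfold tail_b. apply Rmult_le_pos; [left; apply (tame_pos _ _ _ _ HT); lia | left; apply
          exp_pos]. }
    assert (Hd : prod0 (tail_b a wd N) k * Cmod (Cminus (W t 0%nat) (W t' 0%nat)) <=
       L * prod0 (tail_b a wd N) k * Cmod (Cminus (g (W t 0%nat)) (g (W t' 0%nat)))).
    { rewrite (Rmult_comm L), Rmult_assoc. apply Rmult_le_compat_l; auto. }
    exists k. intros d. unfold d. split; [exact H1 | split; [lra |]].
    intros Hm. specialize (H3 Hm). lra.
Qed.

(** [J] is the floor of [Delta * a / (8 PI)], a number at least 2, so rounding loses at most a
    factor 2. *)
Lemma digit_count_J (Delta a : R) :
  0 < Delta -> 16 * PI / Delta <= a ->
  exists J : nat, (2 <= J)%nat /\ 4 * PI * INR J <= Delta / 2 * a /\ a <= 16 * PI / Delta * INR J.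
Proof.
  intros HD Ha. pose proof PI_RGT_0 as Hpi.
  assert (Hx : 2 <= Delta * a / (8 * PI)).
  { apply Rmult_le_reg_r with (8 * PI / Delta); [apply Rdiv_lt_0_compat; lra |].
    replace (Delta * a / (8 * PI) * (8 * PI / Delta)) with a by (field; lra).
    replace (2 * (8 * PI / Delta)) with (16 * PI / Delta) by (field; lra). exact Ha. }
  destruct (nfloor_ex (Delta * a / (8 * PI))) as [J HJ]; [lra |]. exists J. split; [| split].
  - assert (1 < J)%nat; [apply INR_lt; simpl; lra | lia].
  - replace (Delta / 2 * a) with (4 * PI * (Delta * a / (8 * PI))) by (field; lra).
    apply Rmult_le_compat_l; lra.
  - replace a with (8 * PI / Delta * (Delta * a / (8 * PI))) at 1 by (field; lra).
    replace (16 * PI / Delta * INR J) with (8 * PI / Delta * (2 * INR J)) by (field; lra).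
    apply Rmult_le_compat_l; [left; apply Rdiv_lt_0_compat |]; lra.
Qed.

Lemma digit_count_m (Delta wd : R) :
  0 < Delta -> Delta <= wd ->
  exists m : nat, (1 <= m)%nat /\ (2 * (INR m - 1) + 1) * Delta <= wd /\ wd <= 3 * Delta * INR m.
Proof.
  intros HD Hw. assert (Hy : 1 <= wd / Delta).
  { apply Rmult_le_reg_r with Delta; auto. unfold Rdiv. rewrite Rmult_assoc, Rinv_l; lra. }
  assert (Hwd : wd = wd / Delta * Delta) by (field; lra).
  destruct (nfloor_ex ((wd / Delta - 1) / 2)) as [m Hm]; [lra |].
  set (y := wd / Delta) in *.
  exists (S m). rewrite S_INR, Hwd. pose proof (pos_INR m). split; [lia |]. split.
  - apply Rmult_le_compat_r; lra.
  - replace (3 * Delta * (INR m + 1)) with (3 * (INR m + 1) * Delta) by ring.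
    apply Rmult_le_compat_r; lra.
Qed.

(** [wd] and [m] stay free for the two uses: width [Delta] with one column for the Hausdorff bound,
    the whole strip with all its columns for the packing bound. *)
Lemma tame_grid Delta lam a b (X : R) :
  tame Delta lam a b ->
  exists N0, forall N, (N0 <= N)%nat ->
    (forall k, X <= a (N + k)%nat) /\
    forall wd : nat -> R, (forall k, Delta <= wd k <= logratio a b (S (N + k))) ->
    forall m : nat -> nat, (forall k, (1 <= m k)%nat) ->
      (forall k, (2 * (INR (m k) - 1) + 1) * Delta <= wd k) ->
    exists J : nat -> nat,
      grid Delta (tail_mu lam N) (tail_a a N) wd (tail_l lam a N) (tail_b a wd N) J m /\
      (forall k, a (N + k)%nat <= 16 * PI / Delta * INR (J k)).
Proof.
  intros HT. pose proof (tame_Delta _ _ _ _ HT) as HD.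
  destruct (tame_a _ _ _ _ HT (Rmax X (Rmax 4 (16 * PI / Delta)))) as [N1 HN1].
  destruct (tame_left _ _ _ _ HT) as [N2 HN2].
  destruct (tame_width _ _ _ _ HT (Delta / 3) ltac:(lra)) as [N3 HN3].
  exists (N1 + N2 + N3)%nat. intros N HN.
  assert (Ha : forall k, X <= a (N + k)%nat /\ 4 <= a (N + k)%nat /\ 16 * PI / Delta <= a (N +
      k)%nat).
  { intros k. specialize (HN1 (N + k)%nat ltac:(lia)).
    pose proof (Rmax_l X (Rmax 4 (16 * PI / Delta))). pose proof (Rmax_r X (Rmax 4 (16 * PI /
        Delta))).
    pose proof (Rmax_l 4 (16 * PI / Delta)). pose proof (Rmax_r 4 (16 * PI / Delta)). lra. }
  split; [intros k; apply (Ha k) |].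
  intros wd Hwd m Hm1 Hm2.
  destruct (choice_fun _ (fun k => digit_count_J Delta (a (N + k)%nat) HD (proj2 (proj2 (Ha k)))))
      as [J HJ].
  exists J. split; [| intros k; apply (HJ k)].
  constructor; auto.
  - intros k. apply (tame_lam _ _ _ _ HT). lia.
  - intros k. apply (Ha k).
  - intros k. apply (HN2 (N + k)%nat). lia.
  - intros k. unfold tail_l, tail_a, tail_mu. rewrite Nat.add_succ_r. reflexivity.
  - intros k. apply Rle_trans with (1 := proj2 (Hwd k)). apply (HN3 (N + k)%nat). lia.
  - intros k. unfold tail_a, tail_b. rewrite Nat.add_succ_r. lra.
  - intros k. apply (HJ k).
  - intros k. apply (HJ k).
Qed.

Lemma prod0_pos b k : (forall p, 0 < b p) -> 0 < prod0 b k.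
Proof. intros H. induction k as [| k IH]; simpl; [lra | apply Rmult_lt_0_compat; auto]. Qed.

Lemma prodn_pos q k : (forall p, (1 <= q p)%nat) -> 0 < INR (prodn q k).
Proof.
  intros H. apply lt_0_INR. induction k as [| k IH]; simpl; [lia |]. specialize (H k). nia.
Qed.

Lemma ln_prodn_S q k : (forall p, (1 <= q p)%nat) ->
  ln (INR (prodn q (S k))) = ln (INR (prodn q k)) + ln (INR (q k)).
Proof.
  intros H. simpl. rewrite mult_INR, ln_mult; auto; [apply prodn_pos; auto |].
  apply lt_0_INR. specialize (H k). lia.
Qed.

Lemma ln_prod0_S b k : (forall p, 0 < b p) -> ln (prod0 b (S k)) = ln (prod0 b k) + ln (b k).
Proof. intros H. simpl. rewrite ln_mult; auto. apply prod0_pos; auto. Qed.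

Lemma tame_hausdorff_lower Delta lam a b s :
  tame Delta lam a b -> 0 < s < 1 -> hausdorff_measure s (Iab lam a b) <> 0.
Proof.
  intros HT Hs. pose proof (tame_Delta _ _ _ _ HT) as HD. pose proof PI_RGT_0 as Hpi.
  set (c0 := 16 * PI / Delta). assert (Hc0 : 0 < c0) by (apply Rdiv_lt_0_compat; lra).
  (* [X] is chosen so that [J^(1-s)] absorbs the factor [(b/J)^s] lost at each level. *)
  set (X := c0 * exp (s / (1 - s) * (ln c0 + Delta))).
  destruct (tame_grid Delta lam a b X HT) as [N HN].
  destruct (HN N (le_n N)) as [HX Hgrid].
  destruct (Hgrid (fun _ => Delta)) with (m := fun _ : nat => 1%nat) as [J [G HJ]].
  - intros k. split; [lra |]. left. apply (tame_logratio _ _ _ _ HT). lia.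
  - auto.
  - intros k. simpl. lra.
  - destruct (cantor_in_Iab _ _ _ _ _ _ _ _ HT G) as [x [L [HL [Hx1 Hx2]]]].
    { intros k. left. apply (tame_logratio _ _ _ _ HT). lia. }
    set (B := tail_b a (fun _ => Delta) N) in *. set (q := fun k => (J k * 1)%nat) in *.
    assert (HJ0 : forall k, 0 < INR (J k)).
    { intros k. apply lt_0_INR. pose proof (grid_J _ _ _ _ _ _ _ _ G k). lia. }
    assert (Hq1 : forall k, (1 <= q k)%nat).
    { intros k. unfold q. pose proof (grid_J _ _ _ _ _ _ _ _ G k). lia. }
    assert (HlnJ : forall k, ln (a (N + k)%nat) <= ln c0 + ln (INR (J k))).
    { intros k. rewrite <- ln_mult by auto. apply ln_le; [| apply HJ].
      pose proof (grid_a _ _ _ _ _ _ _ _ G k) as H4. unfold tail_a in H4. lra. }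
    assert (HXJ : forall k, s / (1 - s) * (ln c0 + Delta) <= ln (INR (J k))).
    { intros k. apply le_ln_of_exp_le; auto. apply Rmult_le_reg_l with c0; auto.
      apply Rle_trans with (2 := HJ k). apply HX. }
    assert (HB0 : forall k, 0 < B k).
    { intros k. unfold B, tail_b. apply Rmult_lt_0_compat; [apply (tame_pos _ _ _ _ HT); lia |
        apply exp_pos]. }
    assert (HlnB : forall k, ln (B k) <= ln c0 + ln (INR (J (S k))) + Delta).
    { intros k. unfold B, tail_b. rewrite ln_mult, ln_exp by (try apply exp_pos; apply (tame_pos _
        _ _ _ HT); lia).
      specialize (HlnJ (S k)). rewrite Nat.add_succ_r in HlnJ. lra. }
    (* From [k] to [k + 1] the left side gains at most [s (ln c0 + ln J(k+1) + Delta)] and the right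
       side [s ln J(k+1) + (1 - s) ln J(k)]. *)
    assert (Hkey : forall k, s * ln (prod0 B k) <=
       s * ln (INR (prodn q (S k))) + (1 - s) * ln (INR (prodn q k))).
    { induction k as [| k IH].
      - rewrite ln_prodn_S by auto. simpl (prod0 B 0). simpl (prodn q 0). simpl (INR 1). rewrite
          ln_1.
        assert (0 <= ln (INR (q 0%nat))).
        { rewrite <- ln_1. apply ln_le; [lra |]. apply (le_INR 1). auto. }
        nra.
      - rewrite (ln_prodn_S q (S k)), ln_prod0_S by auto.
        rewrite (ln_prodn_S q k) in * by auto.
        rewrite (Nat.mul_1_r (J k) : q k = J k) in *.
        rewrite (Nat.mul_1_r (J (S k)) : q (S k) = J (S k)).
        specialize (HlnB k). specialize (HXJ k).
        assert (Hx : s * (ln c0 + Delta) <= (1 - s) * ln (INR (J k))).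
        { replace (s * (ln c0 + Delta)) with ((1 - s) * (s / (1 - s) * (ln c0 + Delta))) by
            (field; lra).
          apply Rmult_le_compat_l; lra. }
        assert (s * ln (B k) <= s * (ln c0 + ln (INR (J (S k))) + Delta)) by (apply
            Rmult_le_compat_l; lra).
        lra. }
    apply (hausdorff_lower s (/ 2) (Rpower (2 * L) s) (Iab lam a b) x); auto; try lra.
    + apply Rpower_pos.
    + intros t t' Ht Ht'. destruct (Req_dec t t') as [<- | Hne].
      { rewrite Rminus_diag, Rabs_R0. apply Rmult_le_pos; [left; apply Rpower_pos | apply
          rpow_nonneg]. }
      destruct (Hx2 t t' Ht Ht' Hne) as [k [H1 [H2 H3]]]. specialize (H3 eq_refl).
      set (rho := Cmod (Cminus (x t) (x t'))) in *.
      pose proof (prod0_pos B k HB0) as HBk. pose proof (prodn_pos q k Hq1) as HNk.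
      pose proof (prodn_pos q (S k) Hq1) as HNSk.
      pose proof (Rabs_pos_lt (t - t') (Rminus_eq_contra _ _ Hne)) as Htau.
      set (tau := Rabs (t - t')) in *.
      assert (Hrho : 0 < rho).
      { assert (0 < Rmin 1 Delta) by (apply Rmin_pos; lra).
        assert (0 < L * prod0 B k) by (apply Rmult_lt_0_compat; auto).
        assert (0 <= rho) by apply Cmod_ge_0.
        destruct (Req_dec rho 0) as [E | E]; [rewrite E in H2; lra | lra]. }
      rewrite rpow_pos_eq by auto. rewrite Rpower_mult_distr by lra.
      rewrite <- (exp_ln tau) by auto. apply exp_le_mono.
      apply ln_le in H1; [| apply Rmult_lt_0_compat; auto].
      apply ln_le in H3; [| apply Rmult_lt_0_compat; auto].
      rewrite ln_1, ln_mult in H1 by auto.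
      replace (2 * (L * prod0 B k * rho)) with (2 * L * rho * prod0 B k) in H3 by ring.
      rewrite !(ln_mult tau), (ln_mult (2 * L * rho)) in H3 by (auto; repeat apply
          Rmult_lt_0_compat; lra).
      specialize (Hkey k).
      (* Interpolation between two levels: [tau N_k <= 1] to the power [1 - s] times
         [tau N_{k+1} <= 2 L B_k rho] to the power [s]; [Hkey] then removes the products. *)
      apply (Rmult_le_compat_l (1 - s)) in H1; [| lra].
      apply (Rmult_le_compat_l s) in H3; [| lra]. lra.
Qed.

Lemma tame_packing_lower Delta lam a b (s : R) :
  tame Delta lam a b -> 0 < s -> Rbar_lt s (Rbar_plus 1 (LimSup_seq (logratio_quotient a b))) ->
  packing_measure s (Iab lam a b) <> 0.
Proof.
  intros HT Hs HsD. pose proof (tame_Delta _ _ _ _ HT) as HD. pose proof PI_RGT_0 as Hpi.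
  assert (Hy : exists y : R, s - 1 < y /\ Rbar_lt y (LimSup_seq (logratio_quotient a b))).
  { destruct (LimSup_seq (logratio_quotient a b)) as [d | |]; simpl in *; try contradiction.
    - exists ((s - 1 + d) / 2). lra.
    - exists s. split; [lra | auto]. }
  destruct Hy as [y [Hy1 Hy2]].
  (* Up to bounded factors the number of codes is at least [P^(1 - e + y)] and the inverse scale at
     most [P^(1 + e)], with [P = a_1 ... a_n]; [e] solves [s (1 + e) = 1 - e + y]. *)
  set (e := (1 + y - s) / (s + 1)). assert (He : 0 < e) by (apply Rdiv_lt_0_compat; lra).
  assert (He' : e * (s + 1) = 1 + y - s) by (unfold e; field; lra).
  set (c0 := 16 * PI / Delta). assert (Hc0 : 0 < c0) by (apply Rdiv_lt_0_compat; lra).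
  destruct (tame_grid Delta lam a b (exp (ln c0 / e)) HT) as [N1 HN1].
  destruct (tame_small _ _ _ _ HT e He) as [N2 HN2].
  set (N := (N1 + N2)%nat).
  destruct (HN1 N ltac:(lia)) as [HX Hgrid].
  set (wd := fun k => logratio a b (S (N + k))).
  assert (Hwd : forall k, Delta <= wd k) by (intros k; left; apply (tame_logratio _ _ _ _ HT); lia).
  destruct (choice_fun _ (fun k => digit_count_m Delta (wd k) HD (Hwd k))) as [m Hm].
  destruct (Hgrid wd) with (m := m) as [J [G HJ]].
  - intros k. split; [apply Hwd | unfold wd; lra].
  - intros k. apply (Hm k).
  - intros k. apply (Hm k).
  - destruct (cantor_in_Iab _ _ _ _ _ _ _ _ HT G) as [x [L [HL [Hx1 Hx2]]]].
    { intros k. unfold wd. lra. }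
    set (B := tail_b a wd N) in *. set (q := fun k => (J k * m k)%nat) in *.
    assert (HJ0 : forall k, 1 <= INR (J k)).
    { intros k. apply (le_INR 1). pose proof (grid_J _ _ _ _ _ _ _ _ G k). lia. }
    assert (Hm0 : forall k, 1 <= INR (m k)) by (intros k; apply (le_INR 1); apply (Hm k)).
    assert (Hq1 : forall k, (1 <= q k)%nat).
    { intros k. unfold q. pose proof (grid_J _ _ _ _ _ _ _ _ G k). destruct (Hm k). nia. }
    assert (Hlnq : forall k, ln (INR (q k)) = ln (INR (J k)) + ln (INR (m k))).
    { intros k. unfold q. specialize (HJ0 k). specialize (Hm0 k). rewrite mult_INR, ln_mult; lra. }
    assert (Ha4 : forall k, 4 <= a (N + k)%nat) by (intros k; apply (grid_a _ _ _ _ _ _ _ _ G k)).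
    assert (HlnJ : forall k, (1 - e) * ln (a (N + k)%nat) <= ln (INR (J k))).
    { intros k. assert (H1 : ln (a (N + k)%nat) <= ln c0 + ln (INR (J k))).
      { specialize (HJ0 k). specialize (Ha4 k).
        rewrite <- ln_mult by lra. apply ln_le; [lra | apply HJ]. }
      assert (H2 : ln c0 / e <= ln (a (N + k)%nat)).
      { apply le_ln_of_exp_le; [specialize (Ha4 k); lra | apply HX]. }
      apply (Rmult_le_compat_l e) in H2; [| lra].
      replace (e * (ln c0 / e)) with (ln c0) in H2 by (field; lra). lra. }
    assert (Hlnm : forall k, 0 <= ln (INR (m k)) /\ ln (wd k) - ln (3 * Delta) <= ln (INR (m k))).
    { intros k. specialize (Hm0 k). split; [rewrite <- ln_1; apply ln_le; lra |].
      destruct (Hm k) as [_ [_ H3]]. specialize (Hwd k). apply ln_le in H3; [| lra].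
      rewrite ln_mult in H3 by lra. lra. }
    assert (HB4 : forall k, 4 <= B k).
    { intros k. unfold B, tail_b. specialize (Ha4 (S k)). rewrite Nat.add_succ_r in Ha4.
      specialize (Hwd k). pose proof (exp_ineq1_le (wd k)). nra. }
    assert (HB0 : forall k, 0 < B k) by (intros k; specialize (HB4 k); lra).
    assert (HlnB : forall k, ln (B k) <= (1 + e) * ln (a (S (N + k)))).
    { intros k. unfold B, tail_b. rewrite ln_mult, ln_exp by (try apply exp_pos; apply (tame_pos _
        _ _ _ HT); lia).
      pose proof (HN2 (S (N + k)) ltac:(unfold N; lia)). unfold wd. lra. }
    set (LL := fun n => ln (prod1 a n)).
    assert (HLL : forall n, LL (S n) = LL n + ln (a (S n))).
    { intros n. apply ln_prod1_S. apply (tame_pos _ _ _ _ HT). }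
    assert (HLa : forall k, 0 <= ln (a (N + k)%nat)).
    { intros k. specialize (Ha4 k). rewrite <- ln_1. apply ln_le; lra. }
    assert (Hc1 : forall k, (1 - e) * (LL (N + k)%nat - LL N) + ln (INR (m k)) <= ln (INR (prodn q
        (S k)))).
    { induction k as [| k IH].
      - rewrite ln_prodn_S, Hlnq by auto. simpl (prodn q 0). simpl (INR 1). rewrite ln_1,
          Nat.add_0_r.
        assert (0 <= ln (INR (J 0%nat))) by (rewrite <- ln_1; apply ln_le; [lra | apply HJ0]). lra.
      - rewrite ln_prodn_S, Hlnq by auto. rewrite Nat.add_succ_r, HLL.
        specialize (HlnJ (S k)). rewrite Nat.add_succ_r in HlnJ. destruct (Hlnm k). lra. }
    assert (Hc2 : forall k, ln (prod0 B k) <= (1 + e) * (LL (N + k)%nat - LL N)).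
    { induction k as [| k IH].
      - simpl. rewrite ln_1, Nat.add_0_r. lra.
      - rewrite ln_prod0_S by auto. rewrite Nat.add_succ_r, HLL. specialize (HlnB k). lra. }
    assert (Hc3 : forall k, 0 <= LL (N + k)%nat - LL N).
    { induction k as [| k IH]; [rewrite Nat.add_0_r; lra |].
      rewrite Nat.add_succ_r, HLL. specialize (HLa (S k)). rewrite Nat.add_succ_r in HLa. lra. }
    (* Collects the terms that do not depend on the level: the rounding of [m] and the first [N]
       factors of [a_1 ... a_n]. *)
    set (kap := ln (3 * Delta) - y * LL N).
    assert (Hio : forall k0, exists k, (k0 <= k)%nat /\ s * ln (prod0 B k) <= ln (INR (prodn q (S
        k))) + kap).
    { intros k0. destruct (tame_logratio_ge _ _ _ _ y HT Hy2 (N + k0)%nat) as [n [Hn Hn']].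
      exists (n - N)%nat. split; [lia |].
      specialize (Hc1 (n - N)%nat). specialize (Hc2 (n - N)%nat). specialize (Hc3 (n - N)%nat).
      destruct (Hlnm (n - N)%nat) as [_ Hl]. unfold wd in Hl.
      replace (N + (n - N))%nat with n in * by lia. fold (LL n) in Hn'.
      apply (Rmult_le_compat_l s) in Hc2; [| lra]. unfold kap.
      assert (Hz : s * (1 + e) * (LL n - LL N) = (1 - e + y) * (LL n - LL N)) by (f_equal; lra).
      lra. }
    assert (HBmono : forall k p, (p <= k)%nat -> prod0 B p <= prod0 B k).
    { induction k as [| k IH]; intros p Hp.
      - replace p with 0%nat by lia. lra.
      - destruct (Nat.eq_dec p (S k)) as [-> | Hne]; [lra |].
        simpl. pose proof (prod0_pos B k HB0). specialize (HB4 k). specialize (IH p ltac:(lia)).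
            nra. }
    assert (Hqmono : forall k p, (p <= k)%nat -> (prodn q p <= prodn q k)%nat).
    { induction k as [| k IH]; intros p Hp.
      - replace p with 0%nat by lia. lia.
      - destruct (Nat.eq_dec p (S k)) as [-> | Hne]; [lia |].
        simpl. specialize (Hq1 k). specialize (IH p ltac:(lia)). nia. }
    assert (HBgrow : forall k, 2 ^ k <= prod0 B k).
    { induction k as [| k IH]; simpl; [lra |]. pose proof (prod0_pos B k HB0). specialize (HB4 k).
        nra. }
    set (mn := Rmin 1 Delta) in *. assert (Hmn : 0 < mn) by (apply Rmin_pos; lra).
    apply (packing_lower s (/ 2) (exp kap * Rpower (2 * L / mn) s) (Iab lam a b) x); auto; try lra.
    + apply Rmult_lt_0_compat; [apply exp_pos | apply Rpower_pos].
    + intros rho Hrho.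
      destruct (half_pow_small (rho * L / mn)) as [k0 Hk0].
      { apply Rdiv_lt_0_compat; [apply Rmult_lt_0_compat; lra | lra]. }
      destruct (Hio k0) as [k [Hk Hk']].
      pose proof (prod0_pos B k HB0) as HBk.
      assert (HLB : 0 < L * prod0 B k) by (apply Rmult_lt_0_compat; auto).
      (* With this radius [L * prod0 B k * (2 r) = mn / 2], strictly below the separation [mn] of
         points whose codes first differ at level [k] or earlier. *)
      exists (mn / (4 * (L * prod0 B k))). split.
      * split; [apply Rdiv_lt_0_compat; lra |].
        assert (H2k : (/ 2) ^ k0 * prod0 B k >= 1).
        { pose proof (HBgrow k0). pose proof (HBmono k k0 Hk).
          assert (0 < (/ 2) ^ k0) by (apply pow_lt; lra).
          assert (Hone : (/ 2) ^ k0 * 2 ^ k0 = 1) by (rewrite <- Rpow_mult_distr, Rinv_l, pow1;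
              lra).
          nra. }
        apply (Rmult_lt_compat_r (prod0 B k)) in Hk0; auto.
        apply Rmult_lt_reg_r with (4 * (L * prod0 B k)); [lra |].
        replace (mn / (4 * (L * prod0 B k)) * (4 * (L * prod0 B k))) with mn by (field; split; lra).
        assert (Hlt : 1 < rho * L / mn * prod0 B k) by lra.
        apply (Rmult_lt_compat_l mn) in Hlt; auto.
        replace (mn * (rho * L / mn * prod0 B k)) with (rho * (L * prod0 B k)) in Hlt by (field;
            lra).
        assert (0 < rho * (L * prod0 B k)) by (apply Rmult_lt_0_compat; lra). lra.
      * set (r2 := 2 * (mn / (4 * (L * prod0 B k)))).
        assert (Hr2 : r2 = mn / (2 * L) * / prod0 B k) by (unfold r2; field; split; lra).
        assert (Hr2L : L * prod0 B k * r2 = mn / 2) by (rewrite Hr2; field; split; lra).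
        assert (HK : exp kap * Rpower (2 * L / mn) s * Rpower r2 s = exp (kap - s * ln (prod0 B
            k))).
        { rewrite Hr2, Rmult_assoc.
          assert (0 < / prod0 B k) by (apply Rinv_0_lt_compat; auto).
          assert (0 < 2 * L / mn) by (apply Rdiv_lt_0_compat; lra).
          assert (0 < mn / (2 * L)) by (apply Rdiv_lt_0_compat; lra).
          rewrite Rpower_mult_distr by (auto; apply Rmult_lt_0_compat; auto).
          replace (2 * L / mn * (mn / (2 * L) * / prod0 B k)) with (/ prod0 B k) by (field; repeat
              split; lra).
          unfold Rpower. rewrite <- exp_plus, ln_Rinv by auto. f_equal. ring. }
        intros t t' Ht Ht' Hd. rewrite HK.
        destruct (Req_dec t t') as [<- | Hne].
        { rewrite Rminus_diag, Rabs_R0. left. apply exp_pos. }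
        destruct (Hx2 t t' Ht Ht' Hne) as [p [H1 [H2 _]]].
        (* Points within [2 r] therefore agree in their first [k + 1] digits, and their parameters
           differ by at most the inverse of [prodn q (S k)], which includes the columns of the wide
           level [k]. *)
        assert (Hp : (S k <= p)%nat).
        { apply Nat.nlt_ge. intros Hp. pose proof (HBmono k p ltac:(lia)) as Hbp.
          assert (L * prod0 B p * Cmod (Cminus (x t) (x t')) <= L * prod0 B k * r2).
          { pose proof (prod0_pos B p HB0). pose proof (Cmod_ge_0 (Cminus (x t) (x t'))).
            apply Rmult_le_compat; auto; [apply Rmult_le_pos; lra | apply Rmult_le_compat_l; lra]. }
          lra. }
        pose proof (prodn_pos q (S k) Hq1) as HNk.
        pose proof (le_INR _ _ (Hqmono p (S k) Hp)) as HNp.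
        apply Rle_trans with (exp (- ln (INR (prodn q (S k))))).
        -- rewrite exp_Ropp, exp_ln by auto.
           apply Rmult_le_reg_r with (INR (prodn q (S k))); auto. rewrite Rinv_l by lra.
           apply Rle_trans with (2 := H1). apply Rmult_le_compat_l; [apply Rabs_pos | auto].
        -- apply exp_le_mono. lra.
Qed.

Lemma tame_dims Delta lam a b :
  tame Delta lam a b ->
  dimH (Iab lam a b) = 1 /\ dimP (Iab lam a b) = Rbar_plus 1 (LimSup_seq (logratio_quotient a b)).
Proof.
  intros HT. split; apply Rbar_le_antisym.
  - apply (tame_dimH_le _ _ _ _ HT).
  - apply Rbar_glb_ge. intros x [s [-> [Hs H0]]]. apply Rbar_not_lt_le. intros Hlt.
    apply (tame_hausdorff_lower _ _ _ _ s HT); auto.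
  - apply (tame_dimP_le _ _ _ _ HT).
  - apply Rbar_glb_ge. intros x [s [-> [Hs H0]]]. apply Rbar_not_lt_le. intros Hlt.
    apply (tame_packing_lower _ _ _ _ s HT); auto.
Qed.

Theorem theorem2p16 :
  forall (q Delta : R), 0 < q < 1 -> 0 < Delta ->
  exists a0 : R, 0 < a0 /\
  forall (lam : nat -> C) (a b : nat -> R),
    (forall n, (1 <= n)%nat -> lam n <> (0,0)) ->
    (exists M : R, forall n, (1 <= n)%nat -> Cmod (lam n) <= M) ->
    (forall n, (1 <= n)%nat -> 0 < a n < b n) ->
    (* (a) *)
    (exists N : nat, forall n, (N <= n)%nat ->
        a (S n) <= Cmod (lam (S n)) * exp (q * a n) /\
        b (S n) >= Cmod (lam (S n)) * exp (- (q * a n))) ->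
    (* (b) *)
    is_lim_seq (fun n => Rpower (prod1 a n) (/ INR n)) p_infty ->
    (* (c) *)
    (forall n, (1 <= n)%nat -> ln (b n / a n) > Delta) ->
    (* (d) *)
    Rbar_lt (Finite a0) (LimInf_seq a) ->
    is_lim_seq (fun n => ln (b n) / ln (a n)) 1 ->
    dimH (Iab lam a b) = Finite 1 /\
    dimP (Iab lam a b) =
      Rbar_plus (Finite 1)
        (LimSup_seq (fun n =>
           ln (prod1 (fun k => ln (b k / a k)) (S n)) / ln (prod1 a n))).
Proof.
  intros q Delta Hq HD. exists 1. split; [lra |].
  intros lam a b Hlam HM Hab [N HN] Hgrow Hc Hinf Hlim.
  apply (tame_dims Delta lam a b).
  apply (tame_intro q); auto.
  exists N. intros n Hn. apply (HN n Hn).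
Qed.
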